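(* Let $A\in K(H)^+$ and assume that $A$ has infinite rank. Then: (i) $$\bigcup_{\substack{p\in\mathbb Z_+\\ 0\le p\le\operatorname{Tr}(R_A^\perp)}}\Big(E(\mathscr V(A))\cap\big\{B\in\mathscr D\cap K(H)^+\ \big|\ s(B)\overset{p}{\prec}s(A),\ \operatorname{Tr}(R_A^\perp)-p\le\operatorname{Tr}(R_B^\perp)\le\operatorname{Tr}(R_A^\perp)\big\}\Big)\subset E(\mathscr U(A)).$$ (ii) If $R_A\ne I$, then the inclusion in (i) is proper.
   Context: $H$ is a complex separable infinite-dimensional Hilbert space with a fixed orthonormal basis $\{e_k\}_{k\in\mathbb N}$; $B(H)$ is the algebra of bounded operators, $K(H)^+$ the positive compact operators, $\operatorname{Tr}$ the usual trace (with values in $[0,\infty]$ on positive operators; $\infty-p=\infty$). $\mathbb Z_+$ denotes the nonnegative integers. $\mathscr D$ is the algebra of operators that are diagonal with respect to $\{e_k\}$, and $E:B(H)\to\mathscr D$ sends an operator to its main diagonal. $R_A$ denotes the range projection of $A$ and $R_A^\perp=I-R_A$. The unitary orbit of $A$ is $\mathscr U(A):=\{UAU^*\mid U\in B(H)\text{ unitary}\}$ and the partial isometry orbit of $A$ is $\mathscr V(A):=\{VAV^*\mid V\in B(H)\text{ a partial isometry},\ V^*V=R_A\vee R_{A^*}\}$; $E(\mathscr U(A))$, $E(\mathscr V(A))$ are their images under $E$. For compact $A$, $s(A)$ is the nonincreasing sequence of singular numbers of $A$, repeated according to multiplicity, with infinitely many zeros added if $A$ has finite rank. For nonnegative nonincreasing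 sequences $\xi,\eta$ converging to $0$, $\xi\prec\eta$ means $\sum_{j=1}^n\xi_j\le\sum_{j=1}^n\eta_j$ for every $n$; for $p\in\mathbb Z_+$, $\xi\overset{p}{\prec}\eta$ means that $\xi\prec\eta$ and there is an $N\in\mathbb N$ such that $\sum_{j=1}^{n+p}\xi_j\le\sum_{j=1}^n\eta_j$ for all $n\ge N$. *)

(* Defs.v *)
From HB Require Import structures.
From mathcomp Require Import all_boot all_order all_algebra.
From mathcomp Require Import all_classical all_reals all_analysis.
From mathcomp Require Import complex.

Set Implicit Arguments.
Unset Strict Implicit.
Unset Printing Implicit Defensive.

Import Order.TTheory GRing.Theory Num.Theory.
Import numFieldNormedType.Exports.

Local Open Scope classical_set_scope.
Local Open Scope complex_scope.
Local Open Scope ring_scope.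

Section Sequences.
Variable R : realType.
Implicit Types xi eta : nat -> R.

(* Sequences are indexed from 0: the sum of the first n terms is the sum over
   0 <= j < n. *)
Definition majorized xi eta : Prop :=
  forall n : nat, \sum_(0 <= j < n) xi j <= \sum_(0 <= j < n) eta j.

Definition p_majorized (p : nat) xi eta : Prop :=
  majorized xi eta /\
  exists N : nat, forall n : nat, (N <= n)%N ->
    \sum_(0 <= j < n + p) xi j <= \sum_(0 <= j < n) eta j.

End Sequences.

(* A complex Hilbert space is a complete normed module over R[i] together with
   an inner product (linear in the first variable) inducing its norm. *)
Definition inner_product_norm (R : realType) (H : completeNormedModType R[i])
    (dot : {dot H for Num.conj}) : Prop :=
  forall x : H, dot x x = `|x| ^+ 2.

Section Hilbert.
Variables (R : realType) (H : completeNormedModType R[i]).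
Variable dot : {dot H for Num.conj}.
Implicit Types (A B P Q T U V : H -> H) (M : set H) (e : nat -> H).

(* A countably infinite orthonormal basis forces H to be separable and
   infinite-dimensional. *)
Definition orthonormal_basis e : Prop :=
  (forall j k : nat, dot (e j) (e k) = (j == k)%:R) /\
  (forall x : H, series (fun k => dot x (e k) *: e k) @ \oo --> x).

(* Operators are plain functions H -> H subject to the predicates below, so
   that equality of operators is Leibniz equality. *)
Definition bounded_op T : Prop :=
  linear T /\ exists M : R[i], forall x : H, `|T x| <= M * `|x|.

Definition adjoint T : H -> H :=
  fun y => xget 0 [set z | forall x : H, dot (T x) y = dot x z].

Definition positive_op T : Prop := forall x : H, 0 <= dot (T x) x.

Definition compact_op T : Prop :=
  bounded_op T /\ precompact (T @` [set x : H | `|x| <= 1]).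

Definition compact_positive : set (H -> H) :=
  [set T | compact_op T /\ positive_op T].

Definition finite_rank T : Prop :=
  exists (n : nat) (v : 'I_n -> H),
    forall x : H, exists c : 'I_n -> R[i], T x = \sum_(i < n) c i *: v i.

(* The orthogonal projection onto M, for M a closed linear subspace. *)
Definition orth_proj M : H -> H :=
  fun x => xget 0 [set y | M y /\ forall z : H, M z -> dot (x - y) z = 0].

Definition range_proj T : H -> H := orth_proj (closure (range T)).

Definition corange_proj T : H -> H := fun x => x - range_proj T x.

(* The supremum of two projections. *)
Definition proj_join P Q : H -> H :=
  orth_proj (closure [set x + y | x in range P & y in range Q]).

Definition unitary_op U : Prop :=
  [/\ bounded_op U, adjoint U \o U = id & U \o adjoint U = id].

(* Bounded, and isometric on the orthogonal complement of its kernel. *)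
Definition partial_isometry V : Prop :=
  bounded_op V /\
  forall x : H, (forall y : H, V y = 0 -> dot x y = 0) -> `|V x| = `|x|.

Definition unitary_orbit A : set (H -> H) :=
  [set U \o A \o adjoint U | U in [set U | unitary_op U]].

Definition partial_isometry_orbit A : set (H -> H) :=
  [set V \o A \o adjoint V | V in [set V | partial_isometry V /\
     adjoint V \o V = proj_join (range_proj A) (range_proj (adjoint A))]].

Definition has_dim M (n : nat) : Prop :=
  exists b : 'I_n -> H,
  [/\ forall i, M (b i),
      forall c : 'I_n -> R[i], \sum_(i < n) c i *: b i = 0 ->
        forall i, c i = 0
    & forall x, M x -> exists c : 'I_n -> R[i], x = \sum_(i < n) c i *: b i].

(* The nonzero singular numbers of T are the positive square roots of the
   eigenvalues of T^* T; each l > 0 is listed as often as the dimension of the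
   eigenspace of T^* T for l ^ 2.  Since s is nonincreasing, zeros occur only
   after all the nonzero singular numbers, that is, only in finite rank. *)
Definition singular_sequence T (s : nat -> R) : Prop :=
  [/\ forall j, 0 <= s j,
      forall j k, (j <= k)%N -> s k <= s j
    & forall l : R, 0 < l -> exists n : nat,
        ([set j | s j = l] #= `I_n)%card /\
        has_dim [set x : H | adjoint T (T x) = (l ^+ 2)%:C *: x] n].

(* For compact T there is exactly one such sequence. *)
Definition singular_numbers T : nat -> R :=
  xget (fun=> 0) [set s | singular_sequence T s].

Section Basis.
Variable e : nat -> H.

(* Meant for positive T only, where every dot (T (e k)) (e k) is a
   nonnegative real. *)
Definition trace_op T : \bar R :=
  (\sum_(0 <= k <oo) (complex.Re (dot (T (e k)) (e k)))%:E)%E.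

Definition diagonal_ops : set (H -> H) :=
  [set T | bounded_op T /\ forall j k : nat, j != k -> dot (T (e j)) (e k) = 0].

(* The diagonal operator e_k |-> dot (T e_k) e_k *: e_k. *)
Definition diagonal_part T : H -> H :=
  fun x => limn (series (fun k => (dot x (e k) * dot (T (e k)) (e k)) *: e k)).

End Basis.

End Hilbert.

(* Main.v *)
Require Import Defs.
From HB Require Import structures.
From mathcomp Require Import all_boot all_order all_algebra.
From mathcomp Require Import all_classical all_reals all_analysis.
From mathcomp Require Import complex.
From mathcomp Require Import ring lra zify.

Set Implicit Arguments.
Unset Strict Implicit.
Unset Printing Implicit Defensive.

Import Order.TTheory GRing.Theory Num.Theory.
Import numFieldNormedType.Exports.

Local Open Scope classical_set_scope.
Local Open Scope complex_scope.
Local Open Scope ring_scope.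

(** Diagonalize [A] by eigenvectors [g n], with eigenvalues [eta n > 0], together with
    an orthonormal family [z k] of its kernel. Membership of [B] in [E (U (A))] means
    that some orthonormal basis [F] satisfies [<A (F k), F k> = <B (e k), e k>]. Kernel
    vectors are used at the zeros of the diagonal of [B]; [p]-majorization leaves room
    to insert the remaining ones, at most [p], among the eigenvectors. The nonzero
    diagonal entries are then realized in finite Schur-Horn steps, each of which leaves
    a single unit vector [w] with [<A w, w>] small besides the vectors not used yet. As
    [<A w, w>] dominates [|<w, v>| ^ 2 <A v, v>] for every vector [v] of the list, nothing
    is lost in the limit and the system obtained is complete. When the partial sums of
    the eigenvalues exceed those of the diagonal by an amount that does not tend to [0],
    the step starts at an index where this excess is almost minimal among the later
    ones, and the infinite sum of the diagonal absorbs it.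

    For properness, an infinite-dimensional kernel is mixed with the eigenvectors, so
    that the diagonal has no zeros while [oo - p = oo] of them are required. For a
    finite-dimensional kernel, Gram-Schmidt applied to [v, g 0, g 1, ...], with [v] having
    a component along one kernel vector and along every [g n], gives a basis whose
    first [n + 1] diagonal entries sum to more than the first [n] eigenvalues, which
    contradicts [p]-majorization for every [p >= 1]. *)

(** A zero diagonal entry leaves no choice: for positive [A], [<A f, f> = 0] forces [A f = 0]. Only
    the positive entries can be reached by rotating vectors into one another. The obstacle is
    completeness: after infinitely many finite steps every diagonal value may be attained although
    some vector has escaped from the span. Majorization bounds the sums of the diagonal by those of
    the eigenvalues, but completeness also needs the reverse in the limit. If the diagonal is
    summable, the partial isometry orbit supplies it, since conjugation by [V] loses no trace, and
    the excess becomes arbitrarily small. If the diagonal is not summable, the excess may stay away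
    from 0; a step then borrows [u] vectors of tiny value from far out in the list. This leaves the
    available total almost unchanged but makes room for [u] more diagonal entries, on which the
    excess is spent. *)

(** Serves greedy constructions in which a term depends on all earlier ones: decreasing
    enumerations, successive top eigenvectors, Gram-Schmidt. *)
Lemma history_choice (T : Type) (x0 : T) (good : seq T -> Prop)
    (P : seq T -> T -> Prop) :
  good [::] ->
  (forall s, good s -> exists x, P s x /\ good (rcons s x)) ->
  exists f : nat -> T,
    forall n, good (mkseq f n) /\ P (mkseq f n) (f n).
Proof.
move=> g0 ex.
have /choice[next nextP] : forall s, exists x, good s -> P s x /\ good (rcons s x).
  move=> s; have [/ex[x Px]|ng] := pselect (good s); first by exists x.
  by exists x0 => /ng.
pose S n := iter n (fun s => rcons s (next s)) [::].
pose f n := next (S n).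
have Sf n : S n = mkseq f n.
  by elim: n => [//|n IH]; rewrite mkseqS -IH.
have gS n : good (S n) by elim: n => //= n /nextP[].
by exists f => n; rewrite -Sf; split=> //; have [] := nextP _ (gS n).
Qed.

(** Serves the infinite iteration of Schur-Horn steps: each state carries a whole list of vectors
    and is related to its predecessor alone. *)
Lemma dependent_choice (T : Type) (G : nat -> T -> Prop) (Q : nat -> T -> T -> Prop)
    (s0 : T) :
  G 0%N s0 ->
  (forall n s, G n s -> exists s', G n.+1 s' /\ Q n s s') ->
  exists f : nat -> T, [/\ f 0%N = s0, forall n, G n (f n) & forall n, Q n (f n) (f n.+1)].
Proof.
move=> G0 ex.
have /choice[next nextP] :
    forall p : nat * T, exists s', G p.1 p.2 -> G p.1.+1 s' /\ Q p.1 p.2 s'.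
  move=> [n s]; have [/ex[x Px]|ng] := pselect (G n s); first by exists x.
  by exists s => /ng.
pose f := fix f n := if n is m.+1 then next (m, f m) else s0.
have Gf n : G n (f n) by elim: n => // n IH; have [] := nextP (n, f n) IH.
by exists f; split=> // n; have [] := nextP (n, f n) (Gf n).
Qed.

(** * Majorization of real sequences *)

Section RealSequences.
Variable R : realType.
Implicit Types (x y : nat -> R) (n m N u p : nat).

Definition psum x n : R := \sum_(0 <= j < n) x j.

Lemma psum0 x : psum x 0 = 0.
Proof. by rewrite /psum big_geq. Qed.

Lemma psumS x n : psum x n.+1 = psum x n + x n.
Proof. by rewrite /psum big_nat_recr. Qed.

Lemma psumSl x n : psum x n.+1 = x 0%N + psum (fun i => x i.+1) n.
Proof. by rewrite /psum big_nat_recl. Qed.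

Lemma psumD x m n : psum x (m + n) = psum x m + psum (fun i => x (m + i)%N) n.
Proof.
elim: n => [|n IH]; first by rewrite addn0 psum0 addr0.
by rewrite addnS !psumS IH addrA.
Qed.

Lemma eq_psum x y n : (forall i, (i < n)%N -> x i = y i) -> psum x n = psum y n.
Proof. by move=> xy; apply: eq_big_nat => i /andP[_]; exact: xy. Qed.

Lemma ler_psum x y n : (forall i, (i < n)%N -> x i <= y i) -> psum x n <= psum y n.
Proof. by move=> xy; apply: ler_sum_nat => i /andP[_]; exact: xy. Qed.

Lemma psum_const (c : R) n : psum (fun=> c) n = n%:R * c.
Proof. by elim: n => [|n IH]; rewrite ?psum0 ?mul0r // psumS IH -natr1 mulrDl mul1r. Qed.

Lemma psum_homo x m n : (forall i, 0 <= x i) -> (m <= n)%N -> psum x m <= psum x n.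
Proof.
move=> x0 mn; rewrite -(subnKC mn) psumD lerDl.
by rewrite /psum big_nat sumr_ge0.
Qed.

Lemma psum_ge0 x n : (forall i, 0 <= x i) -> 0 <= psum x n.
Proof. by move=> x0; rewrite -(psum0 x) psum_homo. Qed.

(** For nonnegative sequences this is convergence to 0, so no absolute value is taken. *)
Definition vanishing x := forall t : R, 0 < t -> exists N, forall n, (N <= n)%N -> x n <= t.

(* No part of the excess of [y] over [x] is lost in the limit: either it vanishes
   along a subsequence, or [x] has infinite sum and can absorb it. *)
Definition absorbing x y :=
  (forall c : R, exists n, c < psum x n) \/
  (forall (t : R) M, 0 < t -> exists2 n, (M <= n)%N & psum y n - psum x n <= t).

Lemma finite_lbound_gt0 x M : (forall n, (0 < n)%N -> 0 < x n) ->
  exists2 m, 0 < m & forall n, (0 < n <= M)%N -> m <= x n.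
Proof.
move=> x0; elim: M => [|M [m m0 mP]]; first by exists 1 => // -[].
exists (Num.min m (x M.+1)); first by rewrite lt_min m0 x0.
move=> n /andP[n0]; rewrite leq_eqVlt => /predU1P[->|nM].
  by rewrite ge_min lexx orbT.
by rewrite ge_min mP ?n0.
Qed.

(** Otherwise the sequence could drop by [c] again and again and become negative. Applied to a bound
    minus partial sums, this replaces the convergence of bounded monotone sequences. *)
Lemma almost_minimal_tail x (c : R) M : (forall n, 0 <= x n) -> 0 < c ->
  exists2 N, (M <= N)%N & forall n, (N <= n)%N -> x N - c <= x n.
Proof.
move=> x0 c0; apply: contrapT => nex.
have step N : (M <= N)%N -> exists2 n, (N <= n)%N & x n < x N - c.
  move=> MN; apply: contrapT => nn; apply: nex; exists N => // n Nn.
  by rewrite leNgt; apply/negP => lt; apply: nn; exists n.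
have desc k : exists2 N, (M <= N)%N & x N <= x M - k%:R * c.
  elim: k => [|k [N MN le]]; first by exists M; rewrite // mul0r subr0.
  have [n Nn lt] := step _ MN; exists n; first exact: leq_trans Nn.
  by rewrite -natr1 mulrDl mul1r; lra.
have [N _] := desc (Num.truncn (x M / c)).+1.
have := Num.Theory.truncnS_gt (x M / c).
by rewrite ltr_pdivrMr// => lt le; have := x0 N; lra.
Qed.

Lemma step_parameters x y (t : R) M :
  (forall n, 0 < x n) -> (forall n m, (n <= m)%N -> x m <= x n) -> vanishing x ->
  (forall n, psum x n <= psum y n) -> absorbing x y -> 0 < t ->
  exists N u (k : R),
    [/\ (M < N)%N, 0 <= k /\ ((0 < u)%N -> 0 < k),
        forall n, (N <= n)%N -> psum x (n + u) <= psum y n,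
        psum y N - psum x (N + u).-1 + k <= t
      & forall n, (0 < n <= N)%N ->
          psum y N - psum x (N + u).-1 + k <= psum y n - psum x n.-1].
Proof.
move=> x0 xnincr xv xy abs t0.
have rhoE n : (0 < n)%N -> psum y n - psum x n.-1 = psum y n - psum x n + x n.-1.
  by case: n => // n _; rewrite (psumS x) /=; ring.
have rho0 n : (0 < n)%N -> 0 < psum y n - psum x n.-1.
  by move=> n0; rewrite rhoE //; have := xy n; have := x0 n.-1; lra.
have [L|nL] := pselect (forall (t : R) M, 0 < t ->
    exists2 n, (M <= n)%N & psum y n - psum x n <= t).
  (* When the excess comes arbitrarily close to 0, nothing is borrowed. [N] is the first index
     beyond [M] whose remainder is at most [t] and at most [m0], hence it minimizes the remainder
     among all [0 < n <= N]. *)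
  have [m0 m00 m0P] := finite_lbound_gt0 M.+1 rho0.
  pose m1 := Num.min m0 t; have m10 : 0 < m1 by rewrite lt_min m00.
  have exN : exists n, (M < n)%N && (psum y n - psum x n.-1 <= m1).
    have [|N1 N1P] := xv (m1 / 2); first by lra.
    have [|n nP dn] := L (m1 / 2) (maxn M N1).+1; first by lra.
    exists n; apply/andP; split; first by lia.
    by rewrite rhoE; [have := N1P n.-1; have -> : (N1 <= n.-1)%N by lia | lia];
       move=> /(_ isT); lra.
  case: (ex_minnP exN) => N /andP[MN leN] minN.
  exists N, 0%N, 0; split=> //.
  - by move=> n Nn; rewrite addn0.
  - by rewrite addn0 addr0 (le_trans leN)// ge_min lexx orbT.
  - move=> n /andP[n0 nN]; rewrite addn0 addr0.
    have [nM|nM] := leqP n M.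
      by rewrite (le_trans leN)// ge_min m0P ?n0// leqW.
    rewrite leNgt; apply/negP => lt.
    have nN' : (N <= n)%N by apply: minN; rewrite nM /= (le_trans (ltW lt)).
    have E : n = N by apply/eqP; rewrite eqn_leq nN.
    by move: lt; rewrite E ltxx.
have U : forall c : R, exists n, c < psum x n by case: abs.
have [t1 [M0 [t10 M0P]]] : exists (t1 : R) M0, 0 < t1 /\
    forall n, (M0 <= n)%N -> t1 < psum y n - psum x n.
  apply: contrapT => ne; apply: nL => t1 M1 t10; apply: contrapT => nn; apply: ne.
  exists t1, M1; split=> // n Mn; rewrite ltNge; apply/negP => le; apply: nn.
  by exists n.
(* [c] bounds every remainder from below: from [M0] on the excess alone is more than [t1], and
   before that the remainder contains a term [x n.-1 >= x M0]. *)
pose c := Num.min (Num.min t1 (x M0)) t.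
have c0 : 0 < c by rewrite !lt_min t10 x0 t0.
have ct : c <= t by rewrite ge_min lexx orbT.
have ct1 : c <= t1 by rewrite !ge_min lexx.
have cx : c <= x M0 by rewrite !ge_min lexx !orbT.
have crho n : (0 < n)%N -> c <= psum y n - psum x n.-1.
  move=> n0; rewrite rhoE//; have [le|lt] := leqP M0 n.
    by have := M0P _ le; have := x0 n.-1; lra.
  have nM : (n.-1 <= M0)%N by lia.
  by have := xy n; have := xnincr _ _ nM; lra.
have [|N1 N1P] := xv (c / 8); first by lra.
(* The eighths add up: the tolerance in [mu] and the allowance [k] cost [c / 8] each, and two
   entries of [x] beyond [N] at most [c / 8] each, so the final remainder stays below [c]. *)
have [||N NP Nmin] := @almost_minimal_tail (fun n => psum y n - psum x n) (c / 8)
    (maxn M.+1 (maxn M0 N1)).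
  - by move=> n; rewrite subr_ge0.
  - by lra.
pose mu := psum y N - psum x N - c / 8.
have dN : t1 < psum y N - psum x N by apply: M0P; lia.
have xN n : (N <= n)%N -> x n <= c / 8 by move=> Nn; apply: N1P; lia.
have exu : exists u, mu < psum x (N + u) - psum x N.
  have [n nP] := U (mu + psum x N); exists n.
  have : psum x n <= psum x (N + n) by apply: psum_homo => [i|]; [exact: ltW|exact: leq_addl].
  by lra.
(* The block of [x] after [N] ends one entry before its sum exceeds [mu], so it fits into the excess
   at every [n >= N]. Lengths 0 and 1 cannot exceed [mu], which is at least [7 c / 8] while
   [x N <= c / 8]. *)
case: (ex_minnP exu) => -[|[|u]] uP umin.
- by move: uP; rewrite addn0 /mu; lra.
- by move: uP; rewrite addn1 psumS /mu; have := xN N; rewrite leqnn => /(_ isT); lra.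
have ule : psum x (N + u.+1) - psum x N <= mu.
  by rewrite leNgt; apply/negP => /umin; rewrite ltnn.
exists N, u.+1, (c / 8).
have rhole : psum y N - psum x (N + u.+1).-1 + c / 8 <= c.
  move: uP; rewrite !addnS !psumS /= /mu.
  have := xN (N + u)%N; rewrite leq_addr => /(_ isT).
  have := xN (N + u).+1; have -> : (N <= (N + u).+1)%N by lia.
  by move=> /(_ isT); lra.
split.
- by lia.
- by split=> [|_]; lra.
- move=> n Nn; have := Nmin _ Nn; rewrite /= -/mu => h.
  rewrite psumD.
  have : psum (fun i => x (n + i)%N) u.+1 <= psum (fun i => x (N + i)%N) u.+1.
    by apply: ler_psum => i _; apply: xnincr; rewrite leq_add2r.
  by move: ule; rewrite psumD /mu; move: h; rewrite /mu; lra.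
- exact: le_trans ct.
- by move=> n /andP[n0 nN]; exact: le_trans (crho _ n0).
Qed.

Lemma insertion_index x (r : R) L : (forall n m, (n <= m)%N -> x m <= x n) ->
  exists p, [/\ (p <= L)%N, forall i, (i < p)%N -> r <= x i &
                forall i, (p <= i < L)%N -> x i <= r].
Proof.
move=> xn; have ex : exists p, (p == L) || (x p < r) by exists L; rewrite eqxx.
case: (ex_minnP ex) => p pP pmin; exists p; split.
- by apply: pmin; rewrite eqxx.
- move=> i ip; rewrite leNgt; apply/negP => lt.
  by have := pmin i; rewrite lt orbT leqNgt ip => /(_ isT).
- move=> i /andP[pi iL]; case/orP: pP => [/eqP pL|/ltW]; first by lia.
  exact/le_trans/xn.
Qed.

(* [vanishing] makes the supremum over the unused indices a maximum; an index
   never used would bound infinitely many values from below. *)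
Lemma decreasing_enumeration x :
  (forall k, 0 <= x k) -> vanishing x -> (forall K, exists2 k, (K <= k)%N & 0 < x k) ->
  exists s : nat -> nat,
    [/\ injective s, forall n, 0 < x (s n),
        forall n m, (n <= m)%N -> x (s m) <= x (s n) &
        forall k, 0 < x k -> exists n, s n = k].
Proof.
move=> x0 xv xinf.
pose P (l : seq nat) k := [/\ k \notin l, 0 < x k & forall k', k' \notin l -> x k' <= x k].
have [||s sP] := @history_choice nat 0%N (fun=> True) P => //.
  move=> l _; pose K := (\max_(i <- l) i).+1.
  have [k1 Kk1 k1p] := xinf K.
  have k1l : k1 \notin l.
    apply/negP => k1l; have : (k1 <= \max_(i <- l) i)%N by exact: leq_bigmax_seq.
    by move: Kk1; rewrite /K; lia.
  have [N NP] := xv _ k1p.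
  pose N' := maxn N k1.+1.
  pose k := [arg max_(i > Ordinal (leq_maxr N k1.+1 : (k1 < N')%N) | (val i) \notin l) x i]%O.
  exists k; split=> //; rewrite /k.
  case: arg_maxP => //= i il imax.
  split=> //; first by apply: lt_le_trans k1p (imax (Ordinal (leq_maxr N k1.+1 : (k1 < N')%N)) _).
  move=> k' k'l; have [lt|le] := ltnP k' N'; first exact: (imax (Ordinal lt)).
  apply: le_trans (imax (Ordinal (leq_maxr N k1.+1 : (k1 < N')%N)) k1l).
  by apply: NP; move: le; rewrite /N'; lia.
have mem n k : (k \in mkseq s n) = [exists i : 'I_n, s i == k].
  apply/mapP/existsP => [[j]|[j /eqP <-]]; first by rewrite mem_iota => /= lt ->; exists (Ordinal lt).
  by exists (val j); rewrite ?mem_iota /=.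
have sinj' n m : (n < m)%N -> s n != s m.
  move=> nm; have [_ [+ _ _]] := sP m; apply: contra => /eqP E.
  by rewrite mem; apply/existsP; exists (Ordinal nm); rewrite E.
have sinj : injective s.
  move=> n m E; have [lt|lt|//] := ltngtP n m.
    by have := sinj' _ _ lt; rewrite E eqxx.
  by have := sinj' _ _ lt; rewrite E eqxx.
exists s; split=> //.
- by move=> n; have [_ []] := sP n.
- move=> n m; rewrite leq_eqVlt => /predU1P[->//|nm].
  have [_ [_ _]] := sP n; apply; apply/negP; rewrite mem => /existsP[i /eqP/sinj E].
  by have := ltn_ord i; rewrite E; lia.
- move=> k kp; apply: contrapT => nk.
  have lek n : x k <= x (s n).
    have [_ [_ _]] := sP n; apply; apply/negP; rewrite mem => /existsP[i /eqP E].
    by apply: nk; exists i.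
  have [|N NP] := xv (x k / 2); first by lra.
  have lt n : (s n < N)%N.
    by rewrite ltnNge; apply/negP => /NP; have := lek n; lra.
  have /leq_card : injective (fun i : 'I_N.+1 => Ordinal (lt i)).
    by move=> i j [] /sinj/val_inj.
  by rewrite !card_ord ltnn.
Qed.

End RealSequences.

(** * Inner products and limits *)

Section Basics.
Variables (R : realType) (H : completeNormedModType R[i]).
Variable dot : {dot H for Num.conj}.
Hypothesis hdot : inner_product_norm dot.
Implicit Types (x y z : H) (a b : R[i]).

Lemma rcD (r s : R) : (r + s)%:C = r%:C + s%:C. Proof. exact: rmorphD. Qed.
Lemma rcB (r s : R) : (r - s)%:C = r%:C - s%:C. Proof. exact: rmorphB. Qed.
Lemma rcN (r : R) : (- r)%:C = - r%:C. Proof. exact: rmorphN. Qed.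
Lemma rcM (r s : R) : (r * s)%:C = r%:C * s%:C. Proof. exact: rmorphM. Qed.
Lemma rcX (r : R) n : (r ^+ n)%:C = r%:C ^+ n. Proof. exact: rmorphXn. Qed.
Lemma conj_rc (r : R) : Num.conj r%:C = r%:C. Proof. exact: conjc_real. Qed.

(** Norms take values in [R[i]], which is only partially ordered; [nrm] and [cabs] move them to the
    totally ordered field [R]. *)
Definition nrm x : R := complex.Re `|x|.
Definition cabs a : R := complex.Re `|a|.

Lemma cabsE a : (cabs a)%:C = `|a|.
Proof. by rewrite /cabs RRe_real// normr_real. Qed.

Lemma nrmE x : (nrm x)%:C = `|x|.
Proof. by rewrite /nrm RRe_real// ger0_real. Qed.

Lemma nrm_ge0 x : 0 <= nrm x.
Proof. by rewrite -lecR nrmE normr_ge0. Qed.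

Lemma cabs_ge0 a : 0 <= cabs a.
Proof. by rewrite -lecR cabsE normr_ge0. Qed.

Lemma nrm_eq0 x : nrm x = 0 -> x = 0.
Proof. by move=> n0; apply/eqP; rewrite -normr_eq0 -nrmE n0. Qed.

Lemma nrm0 : nrm 0 = 0.
Proof. by rewrite /nrm normr0. Qed.

Lemma nrmZ a x : nrm (a *: x) = cabs a * nrm x.
Proof. by apply: complexI; rewrite rmorphM /= !nrmE cabsE normrZ. Qed.

Lemma nrmD x y : nrm (x + y) <= nrm x + nrm y.
Proof. by rewrite -lecR rmorphD /= !nrmE ler_normD. Qed.

Lemma nrmN x : nrm (- x) = nrm x.
Proof. by rewrite /nrm normrN. Qed.

Lemma nrmB x y : nrm (x - y) = nrm (y - x).
Proof. by rewrite -nrmN opprB. Qed.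

Lemma cabsM a b : cabs (a * b) = cabs a * cabs b.
Proof. by apply: complexI; rewrite rmorphM /= !cabsE normrM. Qed.

Lemma cabsD a b : cabs (a + b) <= cabs a + cabs b.
Proof. by rewrite -lecR rmorphD /= !cabsE ler_normD. Qed.

Lemma cabs_eq0 a : cabs a = 0 -> a = 0.
Proof. by move=> n0; apply/eqP; rewrite -normr_eq0 -cabsE n0. Qed.

Lemma cabs_real (r : R) : cabs r%:C = `|r|.
Proof. by apply: complexI; rewrite cabsE normc_def /= expr0n addr0 sqrtr_sqr. Qed.

Lemma cabs_conj a : cabs (Num.conj a) = cabs a.
Proof. by rewrite /cabs norm_conjC. Qed.

Lemma mul_conj a : a * Num.conj a = (cabs a ^+ 2)%:C.
Proof. by rewrite -normCK rmorphXn /= cabsE. Qed.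

Lemma Re_le_cabs a : complex.Re a <= cabs a.
Proof.
rewrite /cabs normc_def /=; apply: le_trans (ler_norm _) _.
by rewrite -sqrtr_sqr ler_wsqrtr// lerDl sqr_ge0.
Qed.

Lemma dotDl x y z : dot (x + y) z = dot x z + dot y z. Proof. exact: linearDl. Qed.
Lemma dotDr x y z : dot x (y + z) = dot x y + dot x z. Proof. exact: linearDr. Qed.
Lemma dotBl x y z : dot (x - y) z = dot x z - dot y z. Proof. exact: linearBl. Qed.
Lemma dotBr x y z : dot x (y - z) = dot x y - dot x z. Proof. exact: linearBr. Qed.
Lemma dotZl a x y : dot (a *: x) y = a * dot x y. Proof. exact: linearZl_LR. Qed.
Lemma dotZr a x y : dot x (a *: y) = Num.conj a * dot x y.
Proof. exact: linearZr_LR. Qed.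
Lemma dot0l x : dot 0 x = 0. Proof. exact: linear0l. Qed.
Lemma dot0r x : dot x 0 = 0. Proof. exact: linear0r. Qed.
Lemma dotC x y : dot x y = Num.conj (dot y x).
Proof. by rewrite hermC expr0 mul1r. Qed.

Lemma dot_eq0C x y : dot x y = 0 -> dot y x = 0.
Proof. by move=> h; rewrite dotC h rmorph0. Qed.

Lemma dot_suml I (r : seq I) (P : pred I) (F : I -> H) y :
  dot (\sum_(i <- r | P i) F i) y = \sum_(i <- r | P i) dot (F i) y.
Proof. exact: (raddf_sum (applyr dot y)). Qed.

Lemma dot_sumr I (r : seq I) (P : pred I) (F : I -> H) y :
  dot y (\sum_(i <- r | P i) F i) = \sum_(i <- r | P i) dot y (F i).
Proof. exact: linear_sumr. Qed.

Lemma dotE x : dot x x = (nrm x ^+ 2)%:C.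
Proof. by rewrite hdot rmorphXn /= nrmE. Qed.

Lemma cauchy_schwarz x y : cabs (dot x y) <= nrm x * nrm y.
Proof.
have [y0|yn0] := eqVneq (nrm y) 0.
  by rewrite (nrm_eq0 y0) dot0r nrm0 mulr0 /cabs normr0.
have ny : 0 < nrm y by rewrite lt_def yn0 nrm_ge0.
set c := dot x y; pose r := (nrm y ^+ 2)^-1; pose t := c * r%:C.
have : 0 <= dot (x - t *: y) (x - t *: y) by rewrite dotE lecR sqr_ge0.
have -> : dot (x - t *: y) (x - t *: y) = (nrm x ^+ 2 - cabs c ^+ 2 / nrm y ^+ 2)%:C.
  rewrite dotBl !dotBr !dotZl !dotZr !dotE (dotC y x) -/c.
  have -> : Num.conj t = Num.conj c * r%:C by rewrite rmorphM; congr (_ * _); exact: conj_rc.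
  have -> : (nrm x ^+ 2 - cabs c ^+ 2 / nrm y ^+ 2)%:C =
     (nrm x ^+ 2)%:C - (c * Num.conj c) * r%:C.
    by rewrite mul_conj rcB rcM.
  have rE : r%:C * (nrm y ^+ 2)%:C = 1 :> R[i].
    by rewrite -rcM /r mulVf ?expf_neq0.
  rewrite /t; transitivity ((nrm x ^+ 2)%:C - c * Num.conj c * r%:C *
    (2 - r%:C * (nrm y ^+ 2)%:C)); first by ring.
  by rewrite rE; ring.
rewrite lecR subr_ge0 ler_pdivrMr ?exprn_gt0// -exprMn.
by rewrite ler_pXn2r// nnegrE ?cabs_ge0// mulr_ge0 ?nrm_ge0.
Qed.

Lemma dot_ext x y : (forall z, dot x z = dot y z) -> x = y.
Proof.
move=> h; apply/eqP; rewrite -subr_eq0; apply/eqP/nrm_eq0/eqP.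
have : dot (x - y) (x - y) = 0 by rewrite dotBl h subrr.
by rewrite dotE => /complexI/eqP; rewrite expf_eq0.
Qed.

Lemma dot_extr x y : (forall z, dot z x = dot z y) -> x = y.
Proof. by move=> h; apply: dot_ext => z; rewrite dotC h -dotC. Qed.

Lemma cvg_nrmP (u : nat -> H) (l : H) :
  u @ \oo --> l <->
  (forall t : R, 0 < t -> exists N, forall n, (N <= n)%N -> nrm (u n - l) <= t).
Proof.
split=> [/cvgrPdist_le h t t0|h].
  have [|N _ NP] := h t%:C; first by rewrite ltcR.
  by exists N => n Nn; have := NP n Nn; rewrite -nrmE lecR nrmB.
apply/cvgrPdist_le => eps eps0.
have epsE : eps = (complex.Re eps)%:C by rewrite RRe_real// gtr0_real.
have [|N NP] := h (complex.Re eps); first by rewrite -ltcR -epsE.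
by exists N => // n /NP; rewrite -lecR nrmE -epsE distrC.
Qed.

Lemma cauchy_nrm (u : nat -> H) :
  (forall t : R, 0 < t -> exists N, forall m n, (N <= m)%N -> (N <= n)%N ->
    nrm (u m - u n) <= t) ->
  exists l : H, u @ \oo --> l.
Proof.
move=> h; suff c : cvg (u @ \oo) by exists (limn u).
apply: cauchy_cvg; apply: cauchy_exP => eps eps0.
have epsE : eps = (complex.Re eps)%:C by rewrite RRe_real// gtr0_real.
have r0 : 0 < complex.Re eps by rewrite -ltcR -epsE.
have [|N NP] := h (complex.Re eps / 2); first by lra.
exists (u N); exists N => // n Nn /=; rewrite -ball_normE /=.
by rewrite -nrmE epsE ltcR; apply: le_lt_trans (NP _ _ (leqnn N) Nn) _; lra.
Qed.

Lemma closure_nrmP (S : set H) x :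
  closure S x <-> forall t : R, 0 < t -> exists2 y, S y & nrm (x - y) <= t.
Proof.
split=> [cl t t0|h B].
  have [|y [Sy yB]] := cl (ball x t%:C); first by apply: nbhsx_ballx; rewrite ltcR.
  by exists y => //; move: yB; rewrite -ball_normE /= -nrmE ltcR => /ltW.
rewrite -nbhs_ballE => -[eps /= eps0 epsB].
have epsE : eps = (complex.Re eps)%:C by rewrite RRe_real// gtr0_real.
have r0 : 0 < complex.Re eps by rewrite -ltcR -epsE.
have [|y Sy ny] := h (complex.Re eps / 2); first by lra.
exists y; split=> //; apply: epsB; rewrite -ball_normE /= -nrmE epsE ltcR.
by apply: le_lt_trans ny _; lra.
Qed.

Lemma precompact_cluster (S : set H) (u : nat -> H) :
  precompact S -> (forall n, S (u n)) ->
  exists w, forall (t : R) M, 0 < t -> exists2 n, (M <= n)%N & nrm (u n - w) <= t.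
Proof.
rewrite precompactE => cS uS.
have [|w [_ wcl]] := cS (u @ \oo).
  by exists 0%N => // n _; apply: subset_closure; exact: uS.
exists w => t M t0.
have [||x [[n Mn <-] nb]] := wcl (u @` [set n | (M <= n)%N]) (ball w t%:C).
- by exists M => // n Mn; exists n.
- by apply: nbhsx_ballx; rewrite ltcR.
by exists n => //; move: nb; rewrite -ball_normE /= -nrmE ltcR nrmB => /ltW.
Qed.

End Basics.

(** * Schur-Horn constructions *)

Section PsumUpdate.
Variable R : realType.

Lemma psum_update (f : nat -> R) k (a : R) n :
  psum (fun i => if i == k then a else f i) n =
  psum f n + (if (k < n)%N then a - f k else 0).
Proof.
elim: n => [|n IH]; first by rewrite !psum0 addr0.
rewrite !psumS IH; have [->|nk] := eqVneq n k.
  by rewrite ltnn ltnSn; ring.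
have -> : (k < n.+1)%N = (k < n)%N by move: nk; lia.
by ring.
Qed.

End PsumUpdate.

(** * Linear spans and linear maps *)

Section Span.
Variables (R : realType) (H : completeNormedModType R[i]).
Variable dot : {dot H for Num.conj}.
Implicit Types (S T W : set H) (x y z : H).

Definition subsp W := W 0 /\ forall a x y, W x -> W y -> W (a *: x + y).

(** The algebraic span, encoded as an intersection of subspaces so that claims about it reduce to
    generators without handling coefficients. *)
Definition lspan S : set H := [set x | forall W, subsp W -> S `<=` W -> W x].

Lemma subspZ W a x : subsp W -> W x -> W (a *: x).
Proof. by move=> [W0 WP] Wx; rewrite -[_ *: _]addr0; exact: WP. Qed.

Lemma subspD W x y : subsp W -> W x -> W y -> W (x + y).
Proof. by move=> [W0 WP] Wx Wy; rewrite -[x]scale1r; exact: WP. Qed.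

Lemma lspan_subsp S : subsp (lspan S).
Proof.
split=> [W [] //|a x y xS yS W sW SW].
by case: (sW) => _; apply; [exact: xS|exact: yS].
Qed.

Lemma lspanD S x y : lspan S x -> lspan S y -> lspan S (x + y).
Proof. by move=> Sx Sy; exact: (subspD (lspan_subsp S)). Qed.

Lemma lspanZ S a x : lspan S x -> lspan S (a *: x).
Proof. by move=> Sx; exact: (subspZ _ (lspan_subsp S)). Qed.

Lemma lspan_in S x : S x -> lspan S x.
Proof. by move=> Sx W _; exact. Qed.

Lemma lspan_min S W : subsp W -> S `<=` W -> lspan S `<=` W.
Proof. by move=> sW SW x; exact. Qed.

Lemma lspan_trans S T : S `<=` lspan T -> lspan S `<=` lspan T.
Proof. by move=> h; apply: lspan_min h; exact: lspan_subsp. Qed.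

Lemma lspan_mono S T : S `<=` T -> lspan S `<=` lspan T.
Proof. by move=> ST; apply: lspan_trans => x /ST; exact: lspan_in. Qed.

Lemma lspan_dot S y : (forall x, S x -> dot x y = 0) -> forall x, lspan S x -> dot x y = 0.
Proof.
move=> h; apply: (@lspan_min S [set x | dot x y = 0]) => //.
split=> [|a x x' /= hx hx']; first by rewrite /= dot0l.
by rewrite dotDl dotZl hx hx' mulr0 addr0.
Qed.

Section Linear.
Variable A : H -> H.
Hypothesis lA : linear A.

Lemma lin0 : A 0 = 0.
Proof. by have := lA (-1) 0 0; rewrite !scaleN1r oppr0 addr0 addNr. Qed.
Lemma linZ a x : A (a *: x) = a *: A x.
Proof. by rewrite -[a *: x]addr0 lA lin0 addr0. Qed.
Lemma linD x y : A (x + y) = A x + A y.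
Proof. by rewrite -[x in LHS]scale1r lA scale1r. Qed.
Lemma linB x y : A (x - y) = A x - A y.
Proof. by rewrite -scaleN1r linD linZ scaleN1r. Qed.
Lemma lin_sum I (r : seq I) (F : I -> H) : A (\sum_(i <- r) F i) = \sum_(i <- r) A (F i).
Proof. by elim/big_rec2: _ => [|i y1 y2 _ <-]; [exact: lin0|exact: linD]. Qed.

End Linear.

End Span.

Section Values.
Variables (R : realType) (H : completeNormedModType R[i]).
Variable dot : {dot H for Num.conj}.
Hypothesis hdot : inner_product_norm dot.
Variable A : H -> H.
Hypothesis lA : linear A.
Hypothesis pA : positive_op dot A.
Implicit Types (x y z u v w : H).

(** Over the complex numbers positivity makes [dot (A u) u] real for every [u]; polarizing with
    [x + y] and [x + 'i *: y] gives symmetry. *)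
Lemma self_adjoint x y : dot (A x) y = dot x (A y).
Proof.
have q u : dot (A u) u = dot u (A u).
  rewrite [RHS]dotC; apply/esym/CrealP; exact/ger0_real/pA.
have h1 := q (x + y); have h2 := q (x + 'i *: y).
rewrite (linD lA) !dotDl !dotDr !q in h1.
rewrite (linD lA) (linZ lA) !dotDl !dotDr !dotZl !dotZr !q in h2.
have iN : Num.conj 'i = - 'i :> R[i] by exact: conjCi.
rewrite iN in h2.
set a := dot (A x) y in h1 h2 *; set b := dot x (A y) in h1 h2 *.
set c := dot (A y) x in h1 h2; set d := dot y (A x) in h1 h2.
have e1 : a + c - (b + d) = 0.
  by move/eqP: h1; rewrite -subr_eq0 => /eqP <-; ring.
have e2 : 'i * (c - a - (d - b)) = 0.
  by move/eqP: h2; rewrite -subr_eq0 => /eqP <-; ring.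
move/eqP: e2; rewrite mulf_eq0 (negPf (neq0Ci _)) /= => /eqP e2.
have : 2 * (a - b) = 0 by transitivity (a + c - (b + d) - (c - a - (d - b))); [ring | rewrite e1 e2 subrr].
by move/eqP; rewrite mulf_eq0 pnatr_eq0 /= subr_eq0 => /eqP.
Qed.

Definition quad u : R := complex.Re (dot (A u) u).

End Values.

(** * The finite Schur-Horn theorem by plane rotations *)

Section FiniteSchurHorn.
Variables (R : realType) (H : completeNormedModType R[i]).
Variable dot : {dot H for Num.conj}.
Hypothesis hdot : inner_product_norm dot.
Variable A : H -> H.
Hypothesis lA : linear A.
Hypothesis pA : positive_op dot A.
Implicit Types (x y z u v w : H).

Local Notation quad := (quad dot A).

Lemma quadE u : dot (A u) u = (quad u)%:C.
Proof. by rewrite RRe_real//; exact/ger0_real/pA. Qed.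

Lemma quad_ge0 u : 0 <= quad u.
Proof. by rewrite -ler0c -quadE. Qed.

Lemma Aorth_sym u v : dot (A u) v = 0 -> dot (A v) u = 0.
Proof. by move=> h; rewrite (self_adjoint lA pA) dotC h rmorph0. Qed.

Lemma quad_comb u v (a b : R) : dot (A u) v = 0 ->
  quad (a%:C *: u + b%:C *: v) = a ^+ 2 * quad u + b ^+ 2 * quad v.
Proof.
move=> uv; apply: complexI; rewrite -quadE (linD lA) !(linZ lA) !dotDl !dotDr !dotZl !dotZr.
by rewrite uv (Aorth_sym uv) !quadE !conj_rc rcD !rcM; ring.
Qed.

Definition orthonormal_on (D : set nat) (v : nat -> H) :=
  forall i j, D i -> D j -> dot (v i) (v j) = (i == j)%:R.

Definition Aorth_on (D : set nat) (v : nat -> H) :=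
  forall i j, D i -> D j -> i <> j -> dot (A (v i)) (v j) = 0.

(** The angle has squared cosine [c]. As [u] and [v] are orthogonal for [A] too, no cross term
    appears and the two values move along a segment with constant sum. *)
Lemma rotation u v (c : R) : 0 <= c <= 1 ->
  dot u u = 1 -> dot v v = 1 -> dot u v = 0 -> dot (A u) v = 0 ->
  exists w z, [/\ [/\ dot w w = 1, dot z z = 1 & dot w z = 0],
    quad w = c * quad u + (1 - c) * quad v, quad z = (1 - c) * quad u + c * quad v,
    lspan [set u; v] w /\ lspan [set u; v] z &
    lspan [set w; z] u /\ lspan [set w; z] v].
Proof.
move=> /andP[c0 c1] uu vv uv Auv.
pose p := Num.sqrt c; pose q := Num.sqrt (1 - c).
have pp : p ^+ 2 = c by rewrite sqr_sqrtr.
have qq : q ^+ 2 = 1 - c by rewrite sqr_sqrtr// subr_ge0.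
pose w := p%:C *: u + q%:C *: v; pose z := q%:C *: u + (- p)%:C *: v.
have vu := dot_eq0C uv.
have comb (a b a' b' : R) : dot (a%:C *: u + b%:C *: v) (a'%:C *: u + b'%:C *: v)
    = (a * a' + b * b')%:C.
  rewrite !dotDl !dotDr !dotZl !dotZr uu vv uv vu !conj_rc rcD !rcM; ring.
have spuv (a b : R[i]) : lspan [set u; v] (a *: u + b *: v).
  apply: lspanD; apply: lspanZ.
    by apply: lspan_in; left.
  by apply: lspan_in; right.
have spwz (a b : R[i]) : lspan [set w; z] (a *: w + b *: z).
  apply: lspanD; apply: lspanZ.
    by apply: lspan_in; left.
  by apply: lspan_in; right.
exists w, z; split.
- split; rewrite /w /z comb -?expr2 ?sqrrN ?pp ?qq.
  + by congr (_%:C); ring.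
  + by congr (_%:C); ring.
  + by rewrite (_ : _ + _ = 0)//; ring.
- by rewrite /w quad_comb// pp qq.
- by rewrite /z quad_comb// sqrrN pp qq.
- by split; exact: spuv.
- have E : p%:C * p%:C + q%:C * q%:C = 1 :> R[i].
    by rewrite -!rcM -rcD -!expr2 pp qq; congr (_%:C); ring.
  split.
    have -> : u = p%:C *: w + q%:C *: z; last exact: spwz.
    rewrite /w /z !scalerDr !scalerA addrACA -!scalerDl E scale1r.
    have -> : p%:C * q%:C + q%:C * (- p)%:C = 0 :> R[i] by rewrite rcN; ring.
    by rewrite scale0r addr0.
  have -> : v = q%:C *: w + (- p)%:C *: z; last exact: spwz.
  rewrite /w /z !scalerDr !scalerA addrACA -!scalerDl.
  have -> : q%:C * p%:C + (- p)%:C * q%:C = 0 :> R[i] by rewrite rcN; ring.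
  have -> : q%:C * q%:C + (- p)%:C * (- p)%:C = 1 :> R[i] by rewrite -E rcN; ring.
  by rewrite scale0r add0r scale1r.
Qed.

Definition initial (v : nat -> H) n : set H := [set v i | i in [set i | (i < n)%N]].

(** The inductive step of Schur-Horn. The vector [w0] with value [x 0] need not be [A]-orthogonal to
    the others; only the [v'] must remain so among themselves, as only they are rotated again. *)
Lemma peel L (x : nat -> R) (v : nat -> H) :
  (forall i j, (i <= j < L.+1)%N -> x j <= x i) ->
  orthonormal_on [set i | (i < L.+1)%N] v -> Aorth_on [set i | (i < L.+1)%N] v ->
  (forall n, (n <= L.+1)%N -> psum x n <= psum (quad \o v) n) ->
  psum x L.+1 = psum (quad \o v) L.+1 ->
  exists w0 (v' : nat -> H),
  [/\ dot w0 w0 = 1 /\ quad w0 = x 0%N,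
      orthonormal_on [set i | (i < L)%N] v' /\ Aorth_on [set i | (i < L)%N] v',
      (forall n, (n <= L)%N -> psum (x \o succn) n <= psum (quad \o v') n) /\
        psum (x \o succn) L = psum (quad \o v') L,
      [/\ forall i, (i < L)%N -> dot w0 (v' i) = 0, lspan (initial v L.+1) w0 &
        forall i, (i < L)%N -> lspan (initial v L.+1) (v' i)] &
      forall i, (i < L.+1)%N -> lspan (w0 |` initial v' L) (v i)].
Proof.
move=> xn on ao dom tot.
have spv i : (i < L.+1)%N -> lspan (initial v L.+1) (v i).
  by move=> iL; apply: lspan_in; exists i.
have [E|ne] := eqVneq (quad (v 0%N)) (x 0%N).
  exists (v 0%N), (v \o succn); split.
  - by split=> //; rewrite on.
  - by split=> i j /= iL jL; [rewrite on | move=> ij; apply: ao => // -[]].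
  - split=> [n nL|]; last by move: tot; rewrite !psumSl /= E => /addrI.
    by have := dom n.+1 nL; rewrite !psumSl /= E lerD2l.
  - by split=> [i iL||i iL]; [rewrite on | exact: spv | exact: spv].
  - case=> [_|i iL]; first by apply: lspan_in; left.
    by apply: lspan_in; right; exists i.
have y0 : x 0%N < quad (v 0%N).
  rewrite lt_def ne /=; have := dom 1%N isT.
  by rewrite !psumS !psum0 !add0r.
(* If every later value exceeded [x 0], the total of [v] would be larger than that of [x]. The first
   such [j] is taken: all values before it exceed [x 0], which gives the domination of partial sums
   of length below [j]. *)
have exj : exists j, [&& (0 < j)%N, (j < L.+1)%N & quad (v j) <= x 0%N].
  apply: contrapT => nex.
  have big i : (i < L)%N -> x i.+1 <= quad (v i.+1).
    move=> iL; apply: (@le_trans _ _ (x 0%N)); first by apply: xn.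
    by rewrite leNgt; apply/negP => /ltW lt; apply: nex; exists i.+1; rewrite lt andbT; lia.
  move: tot; rewrite !psumSl => tot.
  have : psum (fun i => x i.+1) L <= psum (fun i => (quad \o v) i.+1) L.
    exact: ler_psum.
  by move: tot => /=; lra.
case: (ex_minnP exj) => j /and3P[j0 jL jx] jmin.
have yj i : (0 < i < j)%N -> x 0%N < quad (v i).
  move=> /andP[i0 ij]; rewrite ltNge; apply/negP => le.
  have : (j <= i)%N by apply: jmin; rewrite i0 le andbT; lia.
  by rewrite leqNgt ij.
(* The solution of [c * quad (v 0) + (1 - c) * quad (v j) = x 0]. *)
pose c := (x 0%N - quad (v j)) / (quad (v 0%N) - quad (v j)).
have den : 0 < quad (v 0%N) - quad (v j) by lra.
have c01 : 0 <= c <= 1.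
  by apply/andP; split; [apply: divr_ge0; lra | rewrite ler_pdivrMr // mul1r; lra].
have cE : c * (quad (v 0%N) - quad (v j)) = x 0%N - quad (v j) by rewrite divfK// gt_eqF.
have [||||w0 [z [[ww zz wz] vw vz [spw spz] [sp0 spj]]]] :=
    @rotation (v 0%N) (v j) c c01.
- by rewrite on.
- by rewrite on ?eqxx.
- by rewrite on//= lt_eqF.
- by apply: ao => //; lia.
have onz i i' : (i < L.+1)%N -> (i' < L.+1)%N -> i <> i' -> dot (v i) (v i') = 0.
  by move=> iL i'L ne'; rewrite on//; case: eqP.
have sub2 : [set v 0%N; v j] `<=` initial v L.+1.
  by move=> _ [->|->]; [exists 0%N | exists j].
(* [v 0] is removed and [z] takes the place of [v j], so from length [j] on the partial sums are the
   old ones minus [x 0]. *)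
pose v' i := if i == j.-1 then z else v i.+1.
have jj : j = j.-1.+1 by rewrite prednK.
have zperp y : dot (v 0%N) y = 0 -> dot (v j) y = 0 ->
    forall x, lspan [set v 0%N; v j] x -> dot x y = 0.
  by move=> h1 h2; apply: lspan_dot => _ [->|->].
have Aperp y : dot (A (v 0%N)) y = 0 -> dot (A (v j)) y = 0 ->
    forall x, lspan [set v 0%N; v j] x -> dot (A x) y = 0.
  move=> h1 h2 u us; rewrite (self_adjoint lA pA).
  by apply: (lspan_dot _ us) => _ [->|->]; rewrite -(self_adjoint lA pA).
have vz' : quad z = quad (v 0%N) + quad (v j) - x 0%N.
  by rewrite vz; move: cE; rewrite mulrBr; lra.
have psv n : psum (quad \o v') n = psum (fun i => quad (v i.+1)) n +
    (if (j <= n)%N then quad (v 0%N) - x 0%N else 0).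
  have -> : psum (quad \o v') n =
      psum (fun i => if i == j.-1 then quad z else quad (v i.+1)) n.
    by apply: eq_psum => i _; rewrite /v' /=; case: eqP.
  by rewrite (psum_update (fun i => quad (v i.+1))) -jj; case: leqP => // _; rewrite vz'; ring.
exists w0, v'; split.
- by split=> //; rewrite vw; move: cE; rewrite mulrBr; lra.
- split=> i i' /= iL i'L; rewrite /v'.
    case: eqP => [->|nij]; case: eqP => [->|ni'j].
    + by rewrite eqxx.
    + have -> : (j.-1 == i') = false by lia.
      by apply: (zperp _ _ _ _ spz); apply: onz => //; lia.
    + have -> : (i == j.-1) = false by lia.
      by apply: dot_eq0C; apply: (zperp _ _ _ _ spz); apply: onz => //; lia.
    + by rewrite on.
  move=> nii; case: eqP => [E|nij]; case: eqP => [E'|ni'j].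
  + by move: nii; rewrite E E'.
  + by apply: (Aperp _ _ _ _ spz); apply: ao => //; lia.
  + by apply: Aorth_sym; apply: (Aperp _ _ _ _ spz); apply: ao => //; lia.
  + by apply: ao => //; lia.
- have key n : (n <= L)%N -> (j <= n)%N -> psum (quad \o v') n =
     psum (quad \o v) n.+1 - x 0%N.
    by move=> nL jn; rewrite psv jn psumSl /=; ring.
  split=> [n nL|]; last first.
    by rewrite key//; move: tot; rewrite psumSl /= => <-; ring.
  have [jn|nj] := leqP j n.
    by rewrite key//; have := dom n.+1 nL; rewrite psumSl /=; lra.
  rewrite psv leqNgt nj /= addr0; apply: ler_psum => i iN /=.
  apply: (@le_trans _ _ (x 0%N)); first by apply: xn; lia.
  by apply/ltW/yj; lia.
- split.
  + move=> i iL; rewrite /v'; case: eqP => // nij.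
    by apply: (zperp _ _ _ _ spw); apply: onz => //; lia.
  + exact: lspan_mono sub2 _ spw.
  + move=> i iL; rewrite /v'; case: eqP => _; first exact: lspan_mono sub2 _ spz.
    exact: spv.
- have sub : [set w0; z] `<=` w0 |` initial v' L.
    move=> _ [->|->]; first by left.
    by right; exists j.-1; rewrite /= ?/v' ?eqxx//; lia.
  move=> i iL; have [->|i0] := eqVneq i 0%N; first exact: lspan_mono sub _ sp0.
  have [->|ij] := eqVneq i j; first exact: lspan_mono sub _ spj.
  apply: lspan_in; right; exists i.-1; rewrite /= /v'; first by lia.
  by case: eqP; [lia | rewrite prednK// lt0n].
Qed.

(** The values of [v] may come in any order as long as their partial sums dominate. This lets a
    leftover vector head the list and kernel vectors stand in the middle of it. *)
Lemma finite_schur_horn L (x : nat -> R) (v : nat -> H) :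
  (forall i j, (i <= j < L)%N -> x j <= x i) ->
  orthonormal_on [set i | (i < L)%N] v -> Aorth_on [set i | (i < L)%N] v ->
  (forall n, (n <= L)%N -> psum x n <= psum (quad \o v) n) ->
  psum x L = psum (quad \o v) L ->
  exists w : nat -> H,
  [/\ orthonormal_on [set i | (i < L)%N] w,
      forall i, (i < L)%N -> quad (w i) = x i,
      forall i, (i < L)%N -> lspan (initial v L) (w i) &
      forall i, (i < L)%N -> lspan (initial w L) (v i)].
Proof.
elim: L x v => [|L IH] x v xn on ao dom tot; first by exists v; split=> // i j /=.
have [w0 [v' [[ww vw] [on' ao'] [dom' tot'] [perp spw spv'] spv]]] :=
  peel xn on ao dom tot.
have [|w [onw vwx spvw spwv]] := IH (x \o succn) v' _ on' ao' dom' tot'.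
  by move=> i j ij; apply: xn.
have wperp i : (i < L)%N -> dot (w i) w0 = 0.
  move=> iL; apply: (lspan_dot _ (spvw _ iL)) => _ [k kL <-].
  by apply/dot_eq0C/perp.
exists (fun i => if i is k.+1 then w k else w0); split.
- case=> [|i] [|j] //= iL jL; first by apply/dot_eq0C/wperp.
    exact: wperp.
  by rewrite onw.
- by case=> [|i] //= iL; rewrite vwx.
- case=> [|i] //= iL; apply: lspan_trans (spvw _ iL) => _ [k kL <-].
  exact: spv'.
- move=> i iL; apply: lspan_trans (spv _ iL) => _ [->|[k kL <-]].
    by apply: lspan_in; exists 0%N.
  apply: lspan_trans (spwv _ kL) => _ [m mL <-].
  by apply: lspan_in; exists m.+1.
Qed.

(* [rho] is inserted at its place in the nonincreasing sequence [x]. *)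
Lemma schur_horn_remainder L (x : nat -> R) (rho : R) (v : nat -> H) :
  (forall i j, (i <= j)%N -> x j <= x i) ->
  orthonormal_on [set i | (i < L.+1)%N] v -> Aorth_on [set i | (i < L.+1)%N] v ->
  (forall n, (n <= L)%N -> psum x n <= psum (quad \o v) n) ->
  (forall n, (0 < n <= L.+1)%N -> psum x n.-1 + rho <= psum (quad \o v) n) ->
  psum x L + rho = psum (quad \o v) L.+1 ->
  exists (f : nat -> H) z,
  [/\ orthonormal_on [set i | (i < L)%N] f /\ dot z z = 1,
      forall i, (i < L)%N -> dot (f i) z = 0,
      (forall i, (i < L)%N -> quad (f i) = x i) /\ quad z = rho,
      (forall i, (i < L)%N -> lspan (initial v L.+1) (f i)) /\ lspan (initial v L.+1) z &
      forall i, (i < L.+1)%N -> lspan (z |` initial f L) (v i)].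
Proof.
move=> xn on ao dom1 dom2 tot.
have [p [pL ltp gep]] := insertion_index rho L xn.
pose xo i := if (i < p)%N then x i else if i == p then rho else x i.-1.
have pxo n : (n <= L.+1)%N -> psum xo n = if (n <= p)%N then psum x n else psum x n.-1 + rho.
  elim: n => [|n IH] nL; first by rewrite !psum0.
  rewrite psumS IH ?(ltnW nL)// /xo; case: (ltngtP n p) => np.
  - by rewrite psumS.
  - by rewrite -[n in psum x n.+1.-1](prednK (leq_trans _ np)) ?psumS /= ?prednK ?(leq_trans _ np) //; ring.
  - by [].
have [|||w [onw vw spw spv]] := @finite_schur_horn L.+1 xo v _ on ao.
- move=> i j /andP[ij jL]; rewrite /xo.
  case: (ltngtP j p) => jp; case: (ltngtP i p) => ip; try lia.
  + exact: xn.
  + by apply: le_trans (ltp _ ip); apply: gep; lia.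
  + by apply: xn; lia.
  + by apply: gep; lia.
  + exact: ltp.
  + by [].
- move=> n nL; rewrite pxo//; case: leqP => np; first by apply: dom1; lia.
  by apply: dom2; lia.
- by rewrite pxo// leqNgt ltnS pL.
pose g i := if (i < p)%N then i else i.+1.
have gL i : (i < L)%N -> (g i < L.+1)%N by rewrite /g; case: ifP; lia.
have ginj i j : g i == g j = (i == j) by rewrite /g; do 2!case: ifP; lia.
have gp i : g i == p = false by rewrite /g; case: ifP; lia.
have pL1 : (p < L.+1)%N by rewrite ltnS.
exists (w \o g), (w p); split.
- by split=> [i j /= iL jL|]; rewrite onw/= ?ginj ?eqxx//; exact: gL.
- by move=> i iL; rewrite onw/= ?gp//; exact: gL.
- split=> [i iL|]; rewrite vw//= ?gL// /xo ?ltnn ?eqxx// gp /g.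
  by case: (ltnP i p) => ip; [rewrite ip | rewrite ltnNge leqW].
- by split=> [i iL|]; apply: spw => //; exact: gL.
- move=> i iL; apply: lspan_trans (spv _ iL) => _ [k kL <-].
  apply: lspan_in; have [->|kp] := eqVneq k p; first by left.
  right; exists (if (k < p)%N then k else k.-1); rewrite /=.
    by move: kL kp => /=; case: ifP; lia.
  congr w; rewrite /g; case: (ltnP k p) => kp'; first by rewrite kp'.
  by rewrite ifF; lia.
Qed.

End FiniteSchurHorn.

(** * From finite Schur-Horn steps to a complete infinite system *)

Section Completion.
Variables (R : realType) (H : completeNormedModType R[i]).
Variable dot : {dot H for Num.conj}.
Hypothesis hdot : inner_product_norm dot.
Variable A : H -> H.
Hypothesis lA : linear A.
Hypothesis pA : positive_op dot A.
Implicit Types (u v w z : H) (x : nat -> R) (h : nat -> H).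

Local Notation quad := (quad dot A).
Local Notation quadE := (quadE pA).

Definition admissible x h :=
  [/\ orthonormal_on dot setT h /\ Aorth_on dot A setT h,
      vanishing (quad \o h),
      forall n, psum x n <= psum (quad \o h) n &
      absorbing x (quad \o h)].

Lemma carry_step x h (t : R) M :
  (forall n, 0 < x n) -> (forall n m, (n <= m)%N -> x m <= x n) -> vanishing x ->
  admissible x h -> (forall i, (M < i)%N -> 0 < quad (h i)) -> 0 < t ->
  exists L (f h' : nat -> H),
  [/\ [/\ (0 < L)%N, admissible (fun i => x (L + i)%N) h' & forall i, 0 < quad (h' i)],
      orthonormal_on dot [set i | (i < L)%N] f /\ (forall i, (i < L)%N -> quad (f i) = x i),
      forall i j, (i < L)%N -> dot (f i) (h' j) = 0,
      (forall i, (i < L)%N -> lspan (range h) (f i)) /\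
        (forall j, lspan (range h) (h' j)) &
      [/\ quad (h' 0%N) <= t,
        forall j, lspan (initial h' j.+1 `|` initial f L) (h j) &
        forall j, (j <= M)%N -> lspan (h' 0%N |` initial f L) (h j)]].
Proof.
move=> x0 xn xv [[on ao] yv dom abs] yM t0; set y := quad \o h in yv dom abs.
have y0 i : 0 <= y i by exact: quad_ge0.
have [N [u [k [MN [k0 ku] Na Nb Nc]]]] := step_parameters M.+1 x0 xn xv dom abs t0.
pose L := (N + u).-1; have LE : L.+1 = (N + u)%N by rewrite /L; lia.
(* From [K] on, [u] borrowed values sum to at most [k], which keeps the remainder small; each is
   also at most [x (N + u)], hence at most any entry of [x] realized in this step. *)
have [K [NK KP]] : exists K, (N <= K)%N /\ ((0 < u)%N -> forall n, (K <= n)%N ->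
    y n <= k / u%:R /\ y n <= x (N + u)%N).
  case: (posnP u) => [->|u0]; first by exists N.
  have [|K KP] := yv (Num.min (k / u%:R) (x (N + u)%N)).
    by rewrite lt_min x0 andbT divr_gt0 ?ltr0n//; exact: ku.
  exists (maxn N K); split; first exact: leq_maxl.
  move=> _ n nK; have := KP n; have -> : (K <= n)%N by lia.
  by move=> /(_ isT); rewrite le_min => /andP[].
(* [iota] lists the used indices, those below [N] and those from [K] to [K + u - 1]; [kap] lists all
   others in increasing order. *)
pose iota i := if (i < N)%N then i else (K + (i - N))%N.
pose kap i := if (N + i < K)%N then (N + i)%N else (N + i + u)%N.
have iota_inj i j : (iota i == iota j) = (i == j).
  by rewrite /iota; do 2!case: ifP; lia.
have kap_inj i j : (kap i == kap j) = (i == j).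
  by rewrite /kap; do 2!case: ifP; lia.
have iota_kap i j : (i < N + u)%N -> iota i != kap j.
  by rewrite /kap /iota; do 2!case: ifP; lia.
pose SK := psum (fun i => y (K + i)%N) u.
have SKk : SK <= k.
  case: (posnP u) => [u0|u0]; first by rewrite /SK u0 psum0.
  have : SK <= psum (fun=> k / u%:R) u.
    by apply: ler_psum => i _; have [] := KP u0 (K + i)%N (leq_addr _ _).
  by rewrite psum_const mulrC divfK// pnatr_eq0 -lt0n.
have SK0 : 0 <= SK by apply: psum_ge0 => i; exact: y0.
have py1 n : (n <= N)%N -> psum (quad \o (h \o iota)) n = psum y n.
  by move=> nN; apply: eq_psum => i iN; rewrite /= /iota ifT//; lia.
have py2 m : psum (quad \o (h \o iota)) (N + m) =
    psum y N + psum (fun i => y (K + i)%N) m.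
  rewrite psumD py1//; congr (_ + _); apply: eq_psum => i _.
  by rewrite /= /iota ifF; [congr (quad (h _)); lia | lia].
pose rho := psum y N + SK - psum x L.
have [||||||f [z [[onf zz] fz [qf qz] [spf spz] spv]]] :=
    @schur_horn_remainder R H dot A lA pA L x rho (h \o iota).
- exact: xn.
- by move=> i j _ _; rewrite /= on// iota_inj.
- by move=> i j _ _ ij; apply: ao => //; apply/eqP; rewrite iota_inj; apply/eqP.
- move=> n nL; have [nN|Nn] := leqP n N; first by rewrite py1.
  rewrite -(subnKC (ltnW Nn)) py2.
  have h1 : psum x (N + (n - N)) <= psum x (N + u).
    by apply: psum_homo => [i|]; [exact: ltW | lia].
  have h2 : 0 <= psum (fun i => y (K + i)%N) (n - N).
    by apply: psum_ge0 => i; exact: y0.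
  by have := Na _ (leqnn N); lra.
- move=> n /andP[n0 nL]; have [nN|Nn] := leqP n N.
    by rewrite py1// /rho; have := Nc n; rewrite n0 nN => /(_ isT); rewrite -/L; lra.
  have [m nE] : exists m, n = (N + m.+1)%N by exists (n - N).-1; lia.
  rewrite nE py2 addnS /= /rho /SK.
  have [l uE] : exists l, u = (m.+1 + l)%N by exists (u - m.+1)%N; lia.
  have -> : L = (N + m + l)%N by rewrite /L; lia.
  rewrite uE (psumD _ m.+1 l) (psumD x (N + m) l).
  have : psum (fun i => y (K + (m.+1 + i))%N) l <= psum (fun i => x (N + m + i)%N) l.
    apply: ler_psum => i il.
    have [|_] := KP _ (K + (m.+1 + i))%N (leq_addr _ _); first by lia.
    by move/le_trans; apply; apply: xn; lia.
  by lra.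
- by rewrite LE py2 /rho -/SK; ring.
rewrite LE in spf spz spv.
pose h' i := if i is j.+1 then h (kap j) else z.
have pk n : psum (y \o kap) n + psum y N + (if (N + n <= K)%N then 0 else SK)
    = psum y (if (N + n <= K)%N then N + n else N + n + u)%N.
  elim: n => [|n IH]; first by rewrite addn0 NK psum0 addr0 add0r.
  move: IH; rewrite psumS addnS /kap /=; case: (ltngtP (N + n)%N K) => nK IH.
  - by rewrite psumS -IH; ring.
  - by rewrite addSn psumS -IH; ring.
  - have e : psum y (N + n + u) = psum y (N + n) + SK by rewrite psumD nK.
    by rewrite addSn psumS e -IH; ring.
(* Once the borrowed block has been passed, the new excess is the old one at a shifted index. Hence
   an excess that comes near 0 arbitrarily late still does so for [h']. *)
have py' n : psum (quad \o h') n.+1 - psum (fun i => x (L + i)%N) n.+1 =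
   if (N + n <= K)%N then SK + psum y (N + n) - psum x (N + n + u)
   else psum y (N + n + u) - psum x (N + n + u).
  rewrite psumSl /= qz; have := pk n; have := psumD x L n.+1.
  have -> : (L + n.+1 = N + n + u)%N by rewrite /L; lia.
  by rewrite /rho; case: ifP => _ /=; rewrite -/y => -> <-; lra.
have dom' n : psum (fun i => x (L + i)%N) n <= psum (quad \o h') n.
  case: n => [|n]; first by rewrite !psum0.
  rewrite -subr_ge0 py'; case: ifP => _; last by rewrite subr_ge0.
  by have := Na (N + n)%N (leq_addr _ _); lra.
have spD v : (forall i, (i < N + u)%N -> dot (h (iota i)) v = 0) ->
    forall w, lspan (initial (h \o iota) (N + u)) w -> dot w v = 0.
  by move=> hv; apply: lspan_dot => _ [i iN <-]; exact: hv.
have zh j : dot z (h (kap j)) = 0.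
  by apply: (spD _ _ _ spz) => i iN; rewrite on// (negPf (iota_kap _ _ iN)).
have Azh j : dot (A z) (h (kap j)) = 0.
  rewrite (self_adjoint lA pA); apply: (spD _ _ _ spz) => i iN.
  rewrite -(self_adjoint lA pA); apply: ao => //.
  by apply/eqP; exact: iota_kap.
have rg S i : lspan (initial (h \o iota) S) `<=` lspan (range h) /\ lspan (range h) (h i).
  by split; [apply: lspan_mono => _ [j _ <-]; exists (iota j) | apply: lspan_in; exists i].
have hcases j : [\/ exists2 i, (i < N + u)%N & j = iota i |
    exists2 i, (i < j)%N & j = kap i].
  have [jN|Nj] := ltnP j N.
    by left; exists j; rewrite ?/iota ?jN//; lia.
  have [jK|Kj] := ltnP j K.
    by right; exists (j - N)%N; rewrite /kap; [lia | rewrite ifT; lia].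
  have [jKu|Kuj] := ltnP j (K + u).
    by left; exists (N + (j - K))%N; rewrite /iota; [lia | rewrite ifF; lia].
  by right; exists (j - N - u)%N; rewrite /kap; [lia | rewrite ifF; lia].
have spv' i : (i < N + u)%N -> lspan (h' 0%N |` initial f L) (h (iota i)) by exact: spv.
exists L, f, h'; split.
- split; first by rewrite /L; lia.
  split.
  + split.
      case=> [|i] [|j] _ _ /=; [exact: zz | exact: zh | exact/dot_eq0C/zh |].
      by rewrite on// kap_inj.
    case=> [|i] [|j] _ _ //= ij; first by apply: (Aorth_sym lA pA).
    by apply: ao => //; apply/eqP; rewrite kap_inj; apply/eqP => E; apply: ij; rewrite E.
  + move=> s s0; have [P PP] := yv _ s0; exists P.+1 => -[|n]//= nP.
    by apply: PP; rewrite /kap; case: ifP; lia.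
  + exact: dom'.
  + case: abs => [U|B].
      left=> c; have [n nP] := U (c + psum x L); exists n.
      have : psum x n <= psum x (L + n).
        by apply: psum_homo => [i|]; [exact: ltW | exact: leq_addl].
      by rewrite psumD; lra.
    right=> s M' s0; have [n nP le] := B s (M' + N + K + u + 1)%N s0.
    exists (n - N - u).+1; first by lia.
    by rewrite py' ifF; [have -> : (N + (n - N - u) + u = n)%N by lia | lia].
  + case=> [|i]; last by apply: yM; rewrite /kap; case: ifP; lia.
    have := dom' 1%N; rewrite !psumS !psum0 !add0r addn0 /=.
    exact/lt_le_trans.
- by split.
- move=> i [|j] iL //=; first exact: fz.
  apply: (spD _ _ _ (spf _ iL)) => k' k'N.
  by rewrite on// (negPf (iota_kap _ _ k'N)).
- split=> [i iL|[|j]] /=.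
  + by have [+ _] := rg (N + u)%N 0%N; apply; exact: spf.
  + by have [+ _] := rg (N + u)%N 0%N; apply.
  + by have [_] := rg 0%N (kap j).
- split.
  + by rewrite /= qz /rho; have := Nb; rewrite -/L; lra.
  + move=> j; case: (hcases j) => -[i iP ->].
      apply: lspan_mono (spv' _ iP) => w [->|]; last by right.
      by left; exists 0%N.
    apply: lspan_in; left; exists i.+1 => //=; rewrite ltnS.
    by rewrite /kap; case: ifP; lia.
  + move=> j jM; have -> : j = iota j by rewrite /iota ifT//; lia.
    by apply: spv'; lia.
Qed.

(** Positivity of [A] is applied to [z - c *: v j]. On the span of [v], [A]-orthogonality gives
    [dot (A z) (v j) = c * quad (v j)] as if [v j] were an eigenvector. *)
Lemma bessel_quad (v : nat -> H) z j :
  orthonormal_on dot setT v -> Aorth_on dot A setT v -> lspan (range v) z ->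
  cabs (dot z (v j)) ^+ 2 * quad (v j) <= quad z.
Proof.
move=> on ao zs; set c := dot z (v j).
have Azv : dot (A z) (v j) = c * (quad (v j))%:C.
  suff : forall z, lspan (range v) z -> dot (A z) (v j) = dot z (v j) * (quad (v j))%:C by apply.
  apply: (@lspan_min _ _ (range v)
    [set z | dot (A z) (v j) = dot z (v j) * (quad (v j))%:C]).
    split=> [|a w w' /= hw hw']; first by rewrite /= lin0// !dot0l mul0r.
    by rewrite (linD lA) (linZ lA) !dotDl !dotZl hw hw'; ring.
  move=> _ [k _ <-] /=; have [->|kj] := eqVneq k j.
    by rewrite on// eqxx mul1r quadE.
  by rewrite on// (negPf kj) mul0r ao//; apply/eqP.
have := pA (z - c *: v j).
rewrite (linB lA) (linZ lA) dotBl !dotBr !dotZl !dotZr Azv !quadE.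
rewrite (self_adjoint lA pA (v j) z) (dotC dot (v j)) Azv.
have -> : Num.conj (c * (quad (v j))%:C) = Num.conj c * (quad (v j))%:C.
  by rewrite rmorphM; congr (_ * _); exact: conj_rc.
have -> : (quad z)%:C - Num.conj c * (c * (quad (v j))%:C) -
    (c * (Num.conj c * (quad (v j))%:C) - c * (Num.conj c * (quad (v j))%:C)) =
    (quad z - cabs c ^+ 2 * quad (v j))%:C.
  by rewrite rcB rcM -mul_conj; ring.
by rewrite ler0c subr_ge0.
Qed.

(* After step [s] the vectors [v j] with [j <= s] lie in the span of the vectors
   already chosen and of one unit vector [z] with [quad z <= s.+1%:R^-1]. Since
   [quad z] dominates [|dot z (v j)| ^ 2 * quad (v j)], the component along [z]
   vanishes in the limit. *)
Lemma complete_schur_horn_gt0 x (v : nat -> H) :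
  (forall n, 0 < x n) -> (forall n m, (n <= m)%N -> x m <= x n) -> vanishing x ->
  admissible x v -> (forall i, 0 < quad (v i)) ->
  exists f : nat -> H,
  [/\ orthonormal_on dot setT f, forall i, quad (f i) = x i,
      forall i, lspan (range v) (f i) &
      forall w, (forall i, dot (f i) w = 0) -> forall j, dot (v j) w = 0].
Proof.
move=> x0 xn xv adm y0.
(* In a state [(T, h, F)] the first [T] entries of [x] are realized by [F], and [h] is the list
   available for the remaining ones. *)
pose G (s : nat) (S : nat * (nat -> H) * (nat -> H)) :=
  let: (T, h, F) := S in
  [/\ [/\ (s <= T)%N, admissible (fun i => x (T + i)%N) h & forall i, 0 < quad (h i)],
      orthonormal_on dot [set i | (i < T)%N] F /\ (forall i, (i < T)%N -> quad (F i) = x i),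
      forall i j, (i < T)%N -> dot (F i) (h j) = 0,
      (forall i, (i < T)%N -> lspan (range v) (F i)) /\
        (forall j, lspan (range v) (h j)) &
      forall j, lspan (initial h j.+1 `|` initial F T) (v j)].
pose Q s (S S' : nat * (nat -> H) * (nat -> H)) :=
  let: (T, _, F) := S in let: (T', h', F') := S' in
  [/\ (T <= T')%N, forall i, (i < T)%N -> F' i = F i,
      quad (h' 0%N) <= s.+1%:R^-1 &
      forall j, (j <= s)%N -> lspan (h' 0%N |` initial F' T') (v j)].
have G0 : G 0%N (0%N, v, v).
  split=> //.
  - by split=> // j; apply: lspan_in; exists j.
  - by move=> j; apply: lspan_in; left; exists j => //=.
have step s S : G s S -> exists S', G s.+1 S' /\ Q s S S'.
  case: S => [[T h] F] [[sT ad hp] [onF qF] Fh [spF sph] spv].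
  have [|||||L [f [h' [[L0 ad' hp'] [onf qf] fh' [spf sph'] [qt sp1 sp2]]]]] :=
    @carry_step (fun i => x (T + i)%N) h s.+1%:R^-1 s _ _ _ ad _ _.
  - by [].
  - by move=> n m nm; apply: xn; rewrite leq_add2l.
  - move=> t t0; have [N NP] := xv _ t0; exists N => n Nn.
    by apply: NP; rewrite (leq_trans Nn)// leq_addl.
  - by move=> i _; exact: hp.
  - by rewrite invr_gt0 ltr0n.
  pose F' i := if (i < T)%N then F i else f (i - T)%N.
  have FhS w i : (i < T)%N -> lspan (range h) w -> dot (F i) w = 0.
    by move=> iT ws; apply: dot_eq0C; apply: (lspan_dot _ ws) => _ [j _ <-]; exact/dot_eq0C/Fh.
  have subF : initial F T `<=` initial F' (T + L).
    by move=> _ [i iT <-]; exists i; rewrite /= ?/F' ?iT//; apply: ltn_addr.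
  have subf : initial f L `<=` initial F' (T + L).
    move=> _ [i iL <-]; exists (T + i)%N; rewrite /= ?ltn_add2l//.
    by rewrite /F' ifF; [congr f; lia | lia].
  exists ((T + L)%N, h', F'); split; split.
  - split=> //; first by lia.
    by under eq_fun do rewrite -addnA.
  - split=> [i j /= iT jT|i iT]; rewrite /F'.
      case: (ltnP i T) => i1; case: (ltnP j T) => j1.
      + by rewrite onF.
      + rewrite FhS//; last by apply: spf; lia.
        by rewrite (_ : (i == j) = false)//; lia.
      + rewrite dot_eq0C//; last by apply: FhS => //; apply: spf; lia.
        by rewrite (_ : (i == j) = false)//; lia.
      + by rewrite onf /=; [congr (_%:R); congr nat_of_bool; lia | lia | lia].
    case: (ltnP i T) => i1; first by rewrite qF.
    by rewrite qf; [congr x; lia | lia].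
  - move=> i j iT; rewrite /F'; case: (ltnP i T) => i1; first exact: FhS.
    by apply: fh'; lia.
  - have vh w : lspan (range h) w -> lspan (range v) w.
      by apply: lspan_trans => _ [j _ <-]; exact: sph.
    split=> [i iT|j]; last exact: vh (sph' j).
    rewrite /F'; case: (ltnP i T) => i1; first exact: spF.
    by apply: vh; apply: spf; lia.
  - move=> j; apply: lspan_trans (spv j) => u [[i ij <-]|Fi]; last first.
      by apply: lspan_in; right; exact: subF.
    apply: lspan_mono (sp1 i) => w [[k ki <-]|fw]; last by right; exact: subf.
    by left; exists k => //=; move: ij ki => /=; lia.
  - exact: leq_addr.
  - by move=> i iT; rewrite /F' iT.
  - exact: qt.
  - move=> j js; apply: lspan_trans (spv j) => u [[i ij <-]|Fi]; last first.
      by apply: lspan_in; right; exact: subF.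
    have si : (i <= s)%N by move: ij => /=; lia.
    apply: lspan_mono (sp2 i si) => w [->|fw]; first by left.
    by right; exact: subf.
have [S [S0 GS QS]] := dependent_choice G0 step.
have [on ao] : orthonormal_on dot setT v /\ Aorth_on dot A setT v by case: adm.
pose T s := (S s).1.1; pose h s := (S s).1.2; pose F s := (S s).2.
have sT s : (s <= T s)%N.
  by have := GS s; rewrite /T; case: (S s) => [[? ?] ?] [[]].
(* Chosen vectors are never changed, and after [i.+1] steps at least [i.+1] of them are chosen, so
   this value is final. *)
pose f i := F i.+1 i.
have Fstab s d i : (i < T s)%N -> F (s + d)%N i = F s i /\ (i < T (s + d))%N.
  move=> iT; elim: d => [|d [IH1 IH2]]; first by rewrite addn0.
  have := QS (s + d)%N; rewrite addnS; move: IH1 IH2; rewrite /F /T.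
  case: (S (s + d)%N) => [[T1 h1] F1] /=; case: (S (s + d).+1) => [[T2 h2] F2] /=.
  move=> <- iT1 [le st _ _]; split; first by rewrite st.
  exact: leq_trans le.
have Ff s i : (i < T s)%N -> F s i = f i.
  move=> iT; have iT' : (i < T i.+1)%N by exact: sT.
  have [le|/ltnW le] := leqP s i.+1.
    by rewrite /f -(subnKC le); have [-> _] := Fstab s (i.+1 - s)%N i iT.
  by rewrite /f -(subnKC le); have [-> _] := Fstab i.+1 (s - i.+1)%N i iT'.
have GF s : [/\ orthonormal_on dot [set i | (i < T s)%N] f,
    forall i, (i < T s)%N -> quad (f i) = x i,
    forall i, (i < T s)%N -> dot (f i) (h s 0%N) = 0,
    (forall i, (i < T s)%N -> lspan (range v) (f i)) /\ lspan (range v) (h s 0%N) &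
    dot (h s 0%N) (h s 0%N) = 1].
  have := GS s; have := Ff s; rewrite /F /T /h; case: (S s) => [[T1 h1] F1] /=.
  move=> E [[_ [[onh _] _ _ _] _] [onF qF] Fh [spF sph] _]; split.
  - by move=> i j /= iT jT; rewrite -!E//; exact: onF.
  - by move=> i iT; rewrite -E//; exact: qF.
  - by move=> i iT; rewrite -E//; exact: Fh.
  - by split=> // i iT; rewrite -E//; exact: spF.
  - by rewrite onh.
exists f; split.
- move=> i j _ _; have [onf _ _ _ _] := GF (maxn i j).+1.
  by apply: onf => /=; apply: leq_trans (sT _); rewrite ltnS ?leq_maxl ?leq_maxr.
- by move=> i; have [_ qf _ _ _] := GF i.+1; apply: qf; exact: sT.
- by move=> i; have [_ _ _ [spf _] _] := GF i.+1; apply: spf; exact: sT.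
move=> w fw j.
have bound s : (j <= s)%N -> cabs (dot (v j) w) ^+ 2 * quad (v j) <= nrm w ^+ 2 * s.+1%:R^-1.
  move=> js; have [_ _ fz [_ spz] zz] := GF s.+1; set z := h s.+1 0%N in fz spz zz.
  have [qz spvj] : quad z <= s.+1%:R^-1 /\ lspan (z |` initial f (T s.+1)) (v j).
    have := QS s; have := Ff s.+1; rewrite /z /F /T /h.
    case: (S s) => [[T1 h1] F1] /=; case: (S s.+1) => [[T2 h2] F2] /= E.
    move=> [_ _ qz spj]; split=> //; apply: lspan_mono (spj _ js) => u [->|[i iT <-]]; first by left.
    by right; exists i => //; rewrite E.
  (* [v j] lies in the span of [z] and vectors [f i], and [w] is orthogonal to the latter. *)
  have dE : dot (v j) w = dot (v j) z * dot z w.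
    move: (v j) spvj; apply: (@lspan_min _ _ _ [set u | dot u w = dot u z * dot z w]).
      split=> [|a u u' /= hu hu']; first by rewrite /= !dot0l mul0r.
      by rewrite !dotDl !dotZl hu hu'; ring.
    move=> _ [->|[i iT <-]] /=; first by rewrite zz mul1r.
    by rewrite fw fz// mul0r.
  have nz : nrm z = 1.
    apply/eqP; rewrite -(@eqrXn2 _ 2)// ?nrm_ge0// expr1n; apply/eqP/complexI.
    by rewrite -(dotE hdot) zz.
  have := bessel_quad j on ao spz; rewrite dotC cabs_conj => hb.
  rewrite dE cabsM exprMn mulrAC mulrC; apply: ler_pM.
  - by rewrite sqr_ge0.
  - by rewrite mulr_ge0 ?sqr_ge0// ltW.
  - rewrite ler_pXn2r// ?nnegrE ?cabs_ge0 ?nrm_ge0//.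
    by have := cauchy_schwarz hdot z w; rewrite nz mul1r.
  - exact: le_trans qz.
apply: cabs_eq0; apply/eqP; rewrite -sqrf_eq0; apply/negPn/negP => ne.
pose a := cabs (dot (v j) w) ^+ 2 * quad (v j).
have a0 : 0 < a by rewrite mulr_gt0 // lt_def ne sqr_ge0.
pose s := maxn j (Num.truncn (nrm w ^+ 2 / a)).
have := bound s (leq_maxl _ _); rewrite leNgt => /negP; apply.
rewrite ltr_pdivrMr ?ltr0n// -/a mulrC -ltr_pdivrMr//.
by apply: lt_le_trans (truncnS_gt _) _; rewrite ler_nat ltnS leq_maxr.
Qed.

(* One step absorbs the initial vectors on which [quad] vanishes. *)
Lemma complete_schur_horn x (v : nat -> H) M :
  (forall n, 0 < x n) -> (forall n m, (n <= m)%N -> x m <= x n) -> vanishing x ->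
  admissible x v -> (forall i, (M < i)%N -> 0 < quad (v i)) ->
  exists f : nat -> H,
  [/\ orthonormal_on dot setT f, forall i, quad (f i) = x i,
      forall i, lspan (range v) (f i) &
      forall w, (forall i, dot (f i) w = 0) -> forall j, dot (v j) w = 0].
Proof.
move=> x0 xn xv adm vM.
(* The tolerance 1 is arbitrary: the leftover vector heads the list [h] and is treated by the later
   steps. *)
have [L [f1 [h [[L0 adh hp] [on1 q1] f1h [sp1 sph] [_ spv _]]]]] :=
  carry_step x0 xn xv adm vM ltr01.
have [|||f2 [on2 q2 sp2 tot2]] := @complete_schur_horn_gt0 (fun i => x (L + i)%N) h _ _ _ adh hp.
- by [].
- by move=> n m nm; apply: xn; rewrite leq_add2l.
- move=> t t0; have [N NP] := xv _ t0; exists N => n Nn.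
  by apply: NP; rewrite (leq_trans Nn)// leq_addl.
have f12 i j : (i < L)%N -> dot (f1 i) (f2 j) = 0.
  move=> iL; apply: dot_eq0C; apply: (lspan_dot _ (sp2 j)) => _ [k _ <-].
  exact/dot_eq0C/f1h.
exists (fun i => if (i < L)%N then f1 i else f2 (i - L)%N); split.
- move=> i j _ _; case: (ltnP i L) => iL; case: (ltnP j L) => jL.
  + by rewrite on1.
  + by rewrite f12//; have -> : (i == j) = false by lia.
  + by rewrite (dot_eq0C (f12 _ _ jL)); have -> : (i == j) = false by lia.
  + by rewrite on2//; congr (_%:R); congr nat_of_bool; lia.
- move=> i; case: (ltnP i L) => iL; first exact: q1.
  by rewrite q2; congr x; lia.
- move=> i; case: (ltnP i L) => iL; first exact: sp1.
  by apply: lspan_trans (sp2 _) => _ [k _ <-]; exact: sph.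
- move=> w fw; have hw : forall j, dot (h j) w = 0.
    by apply: tot2 => i; have := fw (L + i)%N; rewrite ifF; [rewrite addKn | lia].
  move=> j; apply: (lspan_dot _ (spv j)) => _ [[k _ <-]|[k kL <-]]; first exact: hw.
  by have := fw k; rewrite kL.
Qed.

End Completion.

(** * Orthonormal systems and adjoints *)

Section HilbertSpace.
Variables (R : realType) (H : completeNormedModType R[i]).
Variable dot : {dot H for Num.conj}.
Hypothesis hdot : inner_product_norm dot.
Implicit Types (x y z : H) (f g : nat -> H) (T V : H -> H).

Definition sqd x y : R := cabs (dot x y) ^+ 2.

Lemma sqdE x y : sqd x y = cabs (dot x y) ^+ 2. Proof. by []. Qed.

Lemma sqdC x y : sqd x y = sqd y x.
Proof. by rewrite /sqd dotC cabs_conj. Qed.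

Lemma sqd_ge0 x y : 0 <= sqd x y. Proof. exact: sqr_ge0. Qed.

Lemma nrm_sqr_eq0 x : nrm x ^+ 2 = 0 -> x = 0.
Proof. by move/eqP; rewrite expf_eq0 /= => /eqP; exact: nrm_eq0. Qed.

Lemma pythagoras x y : dot x y = 0 -> nrm (x + y) ^+ 2 = nrm x ^+ 2 + nrm y ^+ 2.
Proof.
move=> xy; apply: complexI; rewrite -(dotE hdot) rcD -!(dotE hdot).
by rewrite dotDl !dotDr xy (dot_eq0C xy); ring.
Qed.

Lemma nrm_dot1 x : dot x x = 1 -> nrm x = 1.
Proof.
move=> h; apply/eqP; rewrite -(@eqrXn2 _ 2)// ?nrm_ge0// expr1n; apply/eqP/complexI.
by rewrite -(dotE hdot).
Qed.

(** Continuity of [dot], in a form suited to series whose coordinates become constant after finitely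
    many terms. *)
Lemma cvg_dotl (u : nat -> H) (l : H) y (c : R[i]) N :
  u @ \oo --> l -> (forall n, (N <= n)%N -> dot (u n) y = c) -> dot l y = c.
Proof.
move=> /cvg_nrmP ul uc; apply/eqP; rewrite eq_sym -subr_eq0; apply/eqP/cabs_eq0/eqP.
rewrite eq_le cabs_ge0 andbT; apply/ler_addgt0Pr => t t0; rewrite add0r.
have [|N' N'P] := ul (t / (nrm y + 1)); first by rewrite divr_gt0// ltr_wpDl ?nrm_ge0.
pose n := maxn N N'; rewrite -(uc n) ?leq_maxl// -dotBl.
apply: le_trans (cauchy_schwarz hdot _ _) _.
have yp : 0 < nrm y + 1 by rewrite ltr_wpDl ?nrm_ge0.
have := N'P n (leq_maxr _ _); rewrite ler_pdivlMr// => h.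
by apply: le_trans h; rewrite ler_wpM2l ?nrm_ge0// lerDl.
Qed.

Lemma cvg_dot_eq (u v : nat -> H) (l m : H) y z :
  u @ \oo --> l -> v @ \oo --> m -> (forall n, dot (u n) y = dot (v n) z) ->
  dot l y = dot m z.
Proof.
move=> /cvg_nrmP ul /cvg_nrmP vm uv; apply/eqP; rewrite -subr_eq0; apply/eqP/cabs_eq0/eqP.
rewrite eq_le cabs_ge0 andbT; apply/ler_addgt0Pr => t t0; rewrite add0r.
have d0 : 0 < nrm y + nrm z + 1 by have := nrm_ge0 y; have := nrm_ge0 z; lra.
have [|N NP] := ul (t / (nrm y + nrm z + 1)); first exact: divr_gt0.
have [|N' N'P] := vm (t / (nrm y + nrm z + 1)); first exact: divr_gt0.
pose n := maxn N N'.
have -> : dot l y - dot m z = dot (l - u n) y + dot (v n - m) z.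
  by rewrite !dotBl uv; ring.
apply: le_trans (cabsD _ _) _.
have h1 := cauchy_schwarz hdot (l - u n) y.
have h2 := cauchy_schwarz hdot (v n - m) z.
have := NP n (leq_maxl _ _); rewrite nrmB ler_pdivlMr// => h3.
have := N'P n (leq_maxr _ _); rewrite ler_pdivlMr// => h4.
have h5 : nrm (l - u n) <= t / (nrm y + nrm z + 1) by rewrite ler_pdivlMr.
have h6 : nrm (v n - m) <= t / (nrm y + nrm z + 1) by rewrite ler_pdivlMr.
set q := t / _ in h5 h6.
have qE : q * (nrm y + nrm z + 1) = t by rewrite divfK// gt_eqF.
have q0 : 0 <= q by apply: divr_ge0; exact: ltW.
have h7 := ler_wpM2r (nrm_ge0 y) h5.
have h8 := ler_wpM2r (nrm_ge0 z) h6.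
by move: qE; rewrite !mulrDr mulr1; lra.
Qed.

Lemma bounded_nrm T : bounded_op T ->
  exists2 M : R, 0 < M & forall x, nrm (T x) <= M * nrm x.
Proof.
move=> [_ [M MP]]; exists (cabs M + 1); first by rewrite ltr_wpDl ?cabs_ge0.
move=> x; have := MP x; rewrite -!nrmE lecE => /andP[_].
have -> : complex.Re (M * (nrm x)%:C) = complex.Re M * nrm x.
  by case: (M) => a b /=; rewrite mulr0 subr0.
move=> h; apply: le_trans h _.
by rewrite ler_wpM2r ?nrm_ge0//; have := Re_le_cabs M; lra.
Qed.

Lemma bounded_opI T (M : R) : linear T -> (forall x, nrm (T x) <= M * nrm x) ->
  bounded_op T.
Proof. by move=> lT h; split=> //; exists M%:C => x; rewrite -!nrmE -rcM lecR. Qed.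

Lemma bounded_cvg T (u : nat -> H) (l : H) : bounded_op T -> u @ \oo --> l ->
  T \o u @ \oo --> T l.
Proof.
move=> bT /cvg_nrmP ul; have [M M0 MP] := bounded_nrm bT; case: bT => lT _.
apply/cvg_nrmP => t t0; have [|N NP] := ul (t / M); first exact: divr_gt0.
exists N => n Nn; rewrite /= -(linB lT); apply: le_trans (MP _) _.
by rewrite mulrC -ler_pdivlMr// NP.
Qed.

(* Orthonormal up to vanishing entries, so that finite and infinite systems can
   both be indexed by [nat]. *)
Definition onz f := forall i j, dot (f i) (f j) = ((i == j) && (f i != 0))%:R.

Lemma onb_neq0 f k : orthonormal_on dot setT f -> f k != 0.
Proof.
move=> on; apply/eqP => f0; have := on k k I I.
by rewrite f0 dot0l eqxx => /eqP; rewrite eq_sym oner_eq0.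
Qed.

Definition expansion f x n : H := \sum_(0 <= k < n) dot x (f k) *: f k.

Lemma onb_onz f : orthonormal_on dot setT f -> onz f.
Proof.
by move=> on i j; rewrite on// onb_neq0// andbT. Qed.

Section OrthonormalSystem.
Variable f : nat -> H.
Hypothesis onf : onz f.

Lemma dot_comb (c : nat -> R[i]) k m n :
  dot (\sum_(m <= i < n) c i *: f i) (f k) = if (m <= k < n)%N then c k * (f k != 0)%:R else 0.
Proof.
rewrite dot_suml; under eq_bigr do rewrite dotZl onf.
case: ifP => kmn.
  rewrite (bigD1_seq k) ?mem_index_iota ?iota_uniq//= eqxx /= big1 ?addr0//.
  by move=> i /negPf ->; rewrite mulr0.
rewrite big_nat big1// => i imn; case: eqP => [E|_]; last by rewrite mulr0.
by move: kmn; rewrite -E imn.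
Qed.

Lemma nrm_comb (c : nat -> R[i]) m n :
  nrm (\sum_(m <= i < n) c i *: f i) ^+ 2 = \sum_(m <= i < n) (f i != 0)%:R * cabs (c i) ^+ 2.
Proof.
apply: complexI; rewrite -(dotE hdot) dot_sumr rmorph_sum /=.
apply: eq_big_nat => k kmn.
rewrite dotZr dot_comb kmn rcM -mul_conj.
by case: (f k != 0); rewrite ?mulr1 ?mulr0 ?mul0r ?mul1r// mulrC.
Qed.

Lemma expansion_dot x n k : dot (expansion f x n) (f k) = if (k < n)%N then dot x (f k) else 0.
Proof.
rewrite /expansion (dot_comb (fun i => dot x (f i))) /=; case: ifP => // _.
by case: eqVneq => [->|_]; rewrite ?dot0r ?mul0r ?mulr1.
Qed.

Lemma nrm_expansion x n : nrm (expansion f x n) ^+ 2 = psum (fun k => sqd x (f k)) n.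
Proof.
rewrite /expansion (nrm_comb (fun i => dot x (f i))); apply: eq_big_nat => k _; rewrite /sqd.
case: eqVneq => [->|_]; rewrite ?mul1r//.
by rewrite dot0r /cabs normr0 expr0n mulr0.
Qed.

Lemma expansion_perp x n y : dot (x - expansion f x n) (expansion f y n) = 0.
Proof.
rewrite {2}/expansion dot_sumr big_nat big1// => k /andP[_ kn].
by rewrite dotZr dotBl expansion_dot kn subrr mulr0.
Qed.

Lemma bessel x n : psum (fun k => sqd x (f k)) n <= nrm x ^+ 2.
Proof.
rewrite -nrm_expansion -{2}(subrK (expansion f x n) x) pythagoras ?expansion_perp//.
by rewrite lerDr sqr_ge0.
Qed.

Lemma riesz_fischer (c : nat -> R[i]) (M : R) :
  (forall n, psum (fun k => cabs (c k) ^+ 2) n <= M) ->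
  exists l : H, (fun n => \sum_(0 <= k < n) c k *: f k) @ \oo --> l.
Proof.
move=> bd; apply: cauchy_nrm => t t0.
pose a k := cabs (c k) ^+ 2; have a0 k : 0 <= a k by exact: sqr_ge0.
(* From [N] on the bounded sums of squares grow by at most [t ^+ 2], so the partial sums of the
   vectors differ in norm by at most [t]. *)
have [||N _ NP] := @almost_minimal_tail _ (fun n => M - psum a n) (t ^+ 2) 0.
- by move=> n; rewrite subr_ge0.
- by rewrite exprn_gt0.
have tail m n : (N <= m)%N -> (m <= n)%N ->
    nrm (\sum_(0 <= k < n) c k *: f k - \sum_(0 <= k < m) c k *: f k) <= t.
  move=> Nm mn; rewrite -[X in _ <= X]gtr0_norm// -ler_sqr ?nnegrE ?nrm_ge0 ?normr_ge0//.
  rewrite (big_cat_nat (n := m))//= addrAC subrr add0r nrm_comb real_normK ?num_real//.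
  apply: (@le_trans _ _ (\sum_(m <= i < n) a i)).
    by apply: ler_sum => i _; case: (f i != 0); rewrite ?mul1r// mul0r.
  have := NP n (leq_trans Nm mn).
  have -> : psum a n = psum a m + \sum_(m <= i < n) a i.
    by rewrite /psum (big_cat_nat (n := m)).
  by have := psum_homo a0 Nm; lra.
exists N => m n Nm Nn; have [mn|/ltnW nm] := leqP m n.
  by rewrite nrmB; exact: tail.
exact: tail.
Qed.

(** The orthogonal projection onto the closed span of [f]. *)
Definition proj_on x : H := limn (series (fun k => dot x (f k) *: f k)).

Lemma expansion_cvg x : expansion f x @ \oo --> proj_on x.
Proof.
have [l hl] := riesz_fischer (bessel x).
suff -> : proj_on x = l by exact: hl.
by apply: cvg_lim => //; exact: norm_hausdorff.
Qed.

Lemma proj_on_dot x k : dot (proj_on x) (f k) = dot x (f k).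
Proof.
apply: (cvg_dotl (N := k.+1) (@expansion_cvg x)) => n kn.
by rewrite expansion_dot kn.
Qed.

Lemma proj_on_perp x y : (forall k, dot (f k) y = 0) -> dot (proj_on x) y = 0.
Proof.
move=> fy; apply: (cvg_dotl (N := 0) (@expansion_cvg x)) => n _.
by rewrite dot_suml big1// => k _; rewrite dotZl fy mulr0.
Qed.

Lemma proj_on_self x : dot (proj_on x) (proj_on x) = dot (proj_on x) x.
Proof.
have : dot (proj_on x) (x - proj_on x) = 0.
  by apply: proj_on_perp => k; apply: dot_eq0C; rewrite dotBl proj_on_dot subrr.
by rewrite dotBr => /eqP; rewrite subr_eq0 => /eqP ->.
Qed.

Lemma parseval_cvg x (t : R) : 0 < t -> exists N, forall n, (N <= n)%N ->
  nrm (proj_on x) ^+ 2 - t <= psum (fun k => sqd x (f k)) n.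
Proof.
move=> t0; have /cvg_nrmP/(_ (Num.sqrt t)) := @expansion_cvg x.
rewrite sqrtr_gt0 => /(_ t0)[N NP]; exists N => n Nn.
rewrite -nrm_expansion.
have e : dot (proj_on x - expansion f x n) (expansion f x n) = 0.
  rewrite {2}/expansion dot_sumr big_nat big1// => k /andP[_ kn].
  by rewrite dotZr dotBl expansion_dot kn proj_on_dot subrr mulr0.
rewrite -{1}(subrK (expansion f x n) (proj_on x)) pythagoras//.
have : nrm (proj_on x - expansion f x n) ^+ 2 <= t.
  rewrite -(sqr_sqrtr (ltW t0)) ler_sqr ?nnegrE ?nrm_ge0 ?sqrtr_ge0//.
  by rewrite nrmB NP.
by lra.
Qed.

Lemma proj_on_bound x n : psum (fun k => sqd x (f k)) n <= nrm (proj_on x) ^+ 2.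
Proof.
have := bessel (proj_on x) n; congr (_ <= _); apply: eq_psum => k _.
by rewrite /sqd proj_on_dot.
Qed.

Definition total_system := forall x, (forall k, dot x (f k) = 0) -> x = 0.

Lemma proj_on_id x : total_system -> proj_on x = x.
Proof.
move=> tot; apply/eqP; rewrite -subr_eq0; apply/eqP/tot => k.
by rewrite dotBl proj_on_dot subrr.
Qed.

Lemma total_ext x y : total_system -> (forall k, dot x (f k) = dot y (f k)) -> x = y.
Proof.
move=> tot h; apply/eqP; rewrite -subr_eq0; apply/eqP/tot => k.
by rewrite dotBl h subrr.
Qed.

End OrthonormalSystem.

End HilbertSpace.

(** * Adjoints, unitaries and diagonal parts in a fixed basis *)

Section Operators.
Variables (R : realType) (H : completeNormedModType R[i]).
Variable dot : {dot H for Num.conj}.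
Hypothesis hdot : inner_product_norm dot.
Variable e : nat -> H.
Hypothesis he : orthonormal_basis dot e.
Implicit Types (x y z : H) (f g : nat -> H) (T V : H -> H).

Local Notation expansion := (expansion dot).
Local Notation proj_on := (proj_on dot).
Local Notation sqd := (sqd dot).

Lemma onb_e : orthonormal_on dot setT e.
Proof. by case: he => on _ i j _ _; exact: on. Qed.

Let onz_e : onz dot e := onb_onz onb_e.

Lemma cvg_e x : expansion e x @ \oo --> x.
Proof. by case: he => _; exact. Qed.

Lemma total_e : total_system dot e.
Proof.
move=> x xe; apply: nrm_sqr_eq0; apply: complexI; rewrite -(dotE hdot).
apply: (cvg_dotl hdot (N := 0) (@cvg_e x)) => n _.
by rewrite dot_suml big1// => k _; rewrite dotZl (dot_eq0C (xe k)) mulr0.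
Qed.

Lemma expansion_e x n k : dot (expansion e x n) (e k) = if (k < n)%N then dot x (e k) else 0.
Proof. exact: (expansion_dot onz_e). Qed.

(** The adjoint is built from its coordinates [c k]. Their partial sums [zn] satisfy
    [|zn| ^ 2 = <V zn, y> <= M |zn| |y|], so they are square-summable and Riesz-Fischer applies. *)
Lemma riesz_adjoint V : bounded_op V ->
  exists W, forall x y, dot (V x) y = dot x (W y).
Proof.
move=> bV; have [M M0 MP] := bounded_nrm bV; have lV := bV.1.
suff /choice[W WP] : forall y, exists z, forall x, dot (V x) y = dot x z.
  by exists W => x y; exact: WP.
move=> y; pose c k := dot y (V (e k)).
have eN k : (e k != 0)%:R = 1 :> R by rewrite (onb_neq0 _ onb_e).
have eNC k : (e k != 0)%:R = 1 :> R[i] by rewrite (onb_neq0 _ onb_e).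
pose zn n := \sum_(0 <= k < n) c k *: e k.
have nzn n : nrm (zn n) ^+ 2 = psum (fun k => cabs (c k) ^+ 2) n.
  by rewrite (nrm_comb hdot onz_e); apply: eq_big_nat => k _; rewrite eN mul1r.
have Vzn n : dot (V (zn n)) y = (nrm (zn n) ^+ 2)%:C.
  rewrite nzn /zn (lin_sum lV) dot_suml rmorph_sum /=.
  by apply: eq_bigr => k _; rewrite (linZ lV) dotZl -mul_conj -(dotC dot).
have bd n : psum (fun k => cabs (c k) ^+ 2) n <= (M * nrm y) ^+ 2.
  rewrite -nzn.
  have : nrm (zn n) ^+ 2 <= M * nrm (zn n) * nrm y.
    have := cauchy_schwarz hdot (V (zn n)) y.
    rewrite Vzn cabs_real ger0_norm ?sqr_ge0// => /le_trans; apply.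
    by rewrite ler_wpM2r ?nrm_ge0.
  have [-> _|nn] := eqVneq (nrm (zn n)) 0; first by rewrite expr0n sqr_ge0.
  have np : 0 < nrm (zn n) by rewrite lt_def nn nrm_ge0.
  rewrite expr2 mulrAC ler_pM2r// => le.
  by rewrite ler_sqr// nnegrE ?nrm_ge0// mulr_ge0 ?nrm_ge0// ltW.
have [z zcvg] := riesz_fischer hdot onz_e bd.
exists z => x.
have ze k : dot z (e k) = c k.
  apply: (cvg_dotl hdot (N := k.+1) zcvg) => m km.
  by rewrite (dot_comb onz_e) /= km eNC mulr1.
apply: (cvg_dot_eq hdot (bounded_cvg bV (@cvg_e x)) (@cvg_e x)) => n /=.
rewrite /expansion (lin_sum lV) !dot_suml; apply: eq_bigr => k _.
by rewrite (linZ lV) !dotZl; congr (_ * _); rewrite (dotC dot (e k)) ze /c -dotC.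
Qed.

Lemma adjointE V W : (forall x y, dot (V x) y = dot x (W y)) -> adjoint dot V = W.
Proof.
move=> VW; apply/funext => y; rewrite /adjoint.
have : [set z | forall x, dot (V x) y = dot x z] (W y) by move=> x; exact: VW.
move=> Wy; have h : [set z | forall x, dot (V x) y = dot x z]
    (xget 0 [set z | forall x, dot (V x) y = dot x z]) by apply: xgetPex; exists (W y).
by apply: (@dot_extr _ _ dot hdot) => x; rewrite -h VW.
Qed.

Lemma adjointP V : bounded_op V -> forall x y, dot (V x) y = dot x (adjoint dot V y).
Proof. by move=> /riesz_adjoint[W WP] x y; rewrite (adjointE WP). Qed.

(** [U] and [W] exchange coordinates in [f] and in [e]. Once [W] is seen to be both inverse and
    adjoint to [U], isometry follows from [<U x, U x> = <x, W (U x)>]. *)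
Lemma unitary_of_bases f : orthonormal_on dot setT f -> total_system dot f ->
  exists2 U, unitary_op dot U & forall k, adjoint dot U (e k) = f k.
Proof.
move=> onf totf; have onzf := onb_onz onf.
have ex (g h : nat -> H) x : orthonormal_on dot setT g -> orthonormal_on dot setT h ->
    exists y, forall k, dot y (h k) = dot x (g k).
  move=> ong onh.
  have [|y yP] := @riesz_fischer _ _ dot hdot h (onb_onz onh) (fun k => dot x (g k))
     (nrm x ^+ 2).
    by move=> n; apply: (bessel hdot (onb_onz ong)).
  exists y => k; apply: (cvg_dotl hdot (N := k.+1) yP) => m km.
  by rewrite (dot_comb (onb_onz onh)) /= km (onb_neq0 _ onh) mulr1.
have /choice[U UP] : forall x, exists y, forall k, dot y (e k) = dot x (f k).
  by move=> x; apply: ex => //; exact: onb_e.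
have /choice[W WP] : forall x, exists y, forall k, dot y (f k) = dot x (e k).
  by move=> x; apply: ex => //; exact: onb_e.
have UW x : U (W x) = x by apply: (total_ext total_e) => k; rewrite UP WP.
have WU x : W (U x) = x by apply: (total_ext totf) => k; rewrite WP UP.
have UWd x y : dot (U x) y = dot x (W y).
  have cW : expansion f (W y) @ \oo --> W y.
    by rewrite -{2}(proj_on_id hdot onzf (W y) totf); exact: (@expansion_cvg _ _ _ hdot _ onzf).
  rewrite dotC [RHS]dotC; congr (Num.conj _).
  apply: (cvg_dot_eq hdot (@cvg_e y) cW) => n.
  rewrite !dot_suml; apply: eq_bigr => k _; rewrite !dotZl WP; congr (_ * _).
  by rewrite dotC UP -dotC.
have lin (g h : nat -> H) S : total_system dot h -> (forall x k, dot (S x) (h k) = dot x (g k)) ->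
    linear S.
  by move=> th SP a x y; apply: (total_ext th) => k; rewrite SP !(dotDl, dotZl) !SP.
have nU x : nrm (U x) = nrm x.
  apply/eqP; rewrite -(@eqrXn2 _ 2)// ?nrm_ge0//; apply/eqP/complexI.
  by rewrite -!(dotE hdot) UWd WU.
have aU : adjoint dot U = W by exact: adjointE.
exists U.
  split; rewrite ?aU; [|by apply/funext|by apply/funext].
  apply: (@bounded_opI _ _ U 1); first exact: (lin f e U total_e UP).
  by move=> x; rewrite mul1r nU.
move=> k; rewrite aU; apply: (total_ext totf) => j.
by rewrite WP onf// onb_e.
Qed.

Lemma diagonal_partE T B : diagonal_ops dot e B ->
  (forall k, dot (T (e k)) (e k) = dot (B (e k)) (e k)) -> diagonal_part dot e T = B.
Proof.
move=> [bB dB] TB; apply/funext => x; rewrite /diagonal_part.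
have Be k : B (e k) = dot (B (e k)) (e k) *: e k.
  apply: (total_ext total_e) => j; rewrite dotZl onb_e//.
  by have [->|kj] := eqVneq k j; rewrite ?mulr1// mulr0 dB.
have -> : series (fun k => (dot x (e k) * dot (T (e k)) (e k)) *: e k) = B \o expansion e x.
  apply/funext => n; rewrite /series /= /expansion (lin_sum bB.1); apply: eq_bigr => k _.
  by rewrite (linZ bB.1) TB [in RHS]Be scalerA.
by apply: cvg_lim; [exact: norm_hausdorff | exact: (bounded_cvg bB (@cvg_e x))].
Qed.

Lemma diagonal_part_dot T k :
  dot (diagonal_part dot e T (e k)) (e k) = dot (T (e k)) (e k).
Proof.
rewrite /diagonal_part.
have -> : limn (series (fun j => (dot (e k) (e j) * dot (T (e j)) (e j)) *: e j)) =
    dot (T (e k)) (e k) *: e k.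
  apply: cvg_lim; first exact: norm_hausdorff.
  apply/cvg_nrmP => t t0; exists k.+1 => n kn; rewrite /series /=.
  rewrite (bigD1_seq k) ?mem_index_iota ?iota_uniq//= big1 ?addr0.
    by rewrite onb_e// eqxx mul1r subrr nrm0 ltW.
  by move=> j /negPf jk; rewrite onb_e// eq_sym jk mul0r scale0r.
by rewrite dotZl onb_e// eqxx mulr1.
Qed.

End Operators.

(** * Compact positive operators *)

Section Spectral.
Variables (R : realType) (H : completeNormedModType R[i]).
Variable dot : {dot H for Num.conj}.
Hypothesis hdot : inner_product_norm dot.
Variable T : H -> H.
Hypothesis cT : compact_op T.
Hypothesis pT : positive_op dot T.
Implicit Types (x y z w : H) (f g : nat -> H).

Local Notation quad := (quad dot T).
Let bT : bounded_op T := cT.1.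
Let lT : linear T := bT.1.

(** Cauchy-Schwarz for the form [dot (T x) y], which may be degenerate; hence the separate case
    [quad y = 0]. *)
Lemma quad_cauchy_schwarz x y : cabs (dot (T x) y) ^+ 2 <= quad x * quad y.
Proof.
set c := dot (T x) y.
have key (s : R) : 0 <= quad x - 2 * s * cabs c ^+ 2 + s ^+ 2 * cabs c ^+ 2 * quad y.
  have := pT (x - (s%:C * c) *: y).
  rewrite (linB lT) (linZ lT) dotBl !dotBr !dotZl !dotZr !(quadE pT).
  rewrite (self_adjoint lT pT y x) (dotC dot y (T x)) -/c.
  have -> : Num.conj (s%:C * c) = s%:C * Num.conj c.
    by rewrite rmorphM; congr (_ * _); exact: conj_rc.
  have -> : (quad x)%:C - s%:C * Num.conj c * c - (s%:C * c * Num.conj c -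
      s%:C * c * (s%:C * Num.conj c * (quad y)%:C)) =
      (quad x - 2 * s * cabs c ^+ 2 + s ^+ 2 * cabs c ^+ 2 * quad y)%:C.
    have E := mul_conj c; move: (cabs c ^+ 2) E => q E.
    have E2 : (2 : R)%:C = 2 :> R[i] by exact: rmorph_nat.
    by rewrite rcD rcB !rcM -E E2; ring.
  by rewrite ler0c.
have qx := quad_ge0 pT x; have qy := quad_ge0 pT y.
have [y0|yn0] := eqVneq (quad y) 0.
  (* For [c != 0] this multiplier would make the nonnegative expression equal to [- quad x - 2]. *)
  rewrite y0 mulr0; have := key ((quad x + 1) / (cabs c ^+ 2)).
  rewrite y0 mulr0 addr0; have [->//|cn0] := eqVneq (cabs c ^+ 2) 0.
  rewrite -mulrA divfK//; lra.
have yp : 0 < quad y by rewrite lt_def yn0.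
have := key (quad y)^-1.
have -> : quad x - 2 / quad y * cabs c ^+ 2 + (quad y)^-1 ^+ 2 * cabs c ^+ 2 * quad y =
    quad x - cabs c ^+ 2 / quad y by field.
by rewrite subr_ge0 ler_pdivrMr.
Qed.

Lemma quad_eq0 x : quad x = 0 -> T x = 0.
Proof.
move=> q0; apply: nrm_sqr_eq0.
have := quad_cauchy_schwarz x (T x); rewrite q0 mul0r (dotE hdot) cabs_real.
rewrite real_normK ?num_real// => h.
by apply/eqP; rewrite -sqrf_eq0 eq_le h sqr_ge0.
Qed.

Lemma quadZ (a : R[i]) x : quad (a *: x) = cabs a ^+ 2 * quad x.
Proof.
apply: complexI; rewrite -(quadE pT) (linZ lT) dotZl dotZr (quadE pT) rcM -mul_conj.
by rewrite mulrA.
Qed.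

Lemma cluster_image (u : nat -> H) : (forall n, nrm (u n) <= 1) ->
  exists w, forall (t : R) M, 0 < t -> exists2 n, (M <= n)%N & nrm (T (u n) - w) <= t.
Proof.
move=> u1; apply: (@precompact_cluster _ _ (T @` [set x : H | `|x| <= 1])); first exact: cT.2.
by move=> n; exists (u n) => //=; rewrite -nrmE -[1]/(1%:C) lecR.
Qed.

(** Infinitely many eigenvalues above [t] would give images of orthonormal vectors at mutual
    distance more than [t], without a cluster point. *)
Lemma eigenvalues_vanish f (eta : nat -> R) :
  orthonormal_on dot setT f -> (forall n, T (f n) = (eta n)%:C *: f n) -> (forall n, 0 <= eta n) ->
  vanishing eta.
Proof.
move=> on Tf e0 t t0; apply: contrapT => nex.
have /choice[s sP] : forall N, exists n, (N <= n)%N /\ t < eta n.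
  move=> N; apply: contrapT => nn; apply: nex; exists N => n Nn.
  by rewrite leNgt; apply/negP => lt; apply: nn; exists n.
have fn n : nrm (f n) = 1 by apply: (nrm_dot1 hdot); rewrite on// eqxx.
have [w wP] : exists w, forall (t : R) M, 0 < t ->
    exists2 n, (M <= n)%N & nrm (T (f (s n)) - w) <= t.
  by apply: cluster_image => n; rewrite fn.
have [|n1 _ h1] := wP (t / 4) 0%N; first by lra.
have [|n2 n12 h2] := wP (t / 4) (s n1).+1; first by lra.
have [sn1 e1] := sP n1; have [sn2 e2] := sP n2.
have ne : s n1 != s n2 by lia.
have : nrm (T (f (s n1)) - T (f (s n2))) <= t / 2.
  have -> : T (f (s n1)) - T (f (s n2)) = (T (f (s n1)) - w) + (w - T (f (s n2))).
    by rewrite addrA subrK.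
  by apply: le_trans (nrmD _ _) _; move: h2; rewrite nrmB; lra.
have perp : dot (T (f (s n1))) (- T (f (s n2))) = 0.
  by rewrite -scaleN1r dotZr !Tf dotZl dotZr on// (negPf ne) !mulr0.
have := pythagoras hdot perp; rewrite nrmN => P.
have : nrm (T (f (s n1))) = eta (s n1).
  by rewrite Tf nrmZ fn mulr1 cabs_real ger0_norm.
have n0 := nrm_ge0 (T (f (s n1)) - T (f (s n2))).
have : nrm (T (f (s n1))) ^+ 2 <= nrm (T (f (s n1)) - T (f (s n2))) ^+ 2.
  by rewrite P lerDl sqr_ge0.
rewrite ler_sqr ?nnegrE ?nrm_ge0//; lra.
Qed.

(* The supremum [m] of [quad] on the unit sphere of [N] is attained: along a
   maximizing sequence [u], the vectors [T (u k) - m u k] tend to [0] since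
   [|T x| ^ 2 <= m quad x] on [N], and [T (u k)] has a cluster point. *)
Lemma top_eigenvector (N : set H) :
  subsp N -> (forall x, closure N x -> N x) -> (forall x, N x -> N (T x)) ->
  (exists2 x, N x & T x <> 0) ->
  exists g : H, [/\ N g, nrm g = 1, T g = (quad g)%:C *: g, 0 < quad g &
    forall x, N x -> quad x <= quad g * nrm x ^+ 2].
Proof.
move=> sN clN TN [x0 Nx0 Tx0].
have [M M0 MP] := bounded_nrm bT.
have qM x : quad x <= M * nrm x ^+ 2.
  rewrite /quad; apply: le_trans (Re_le_cabs _) _.
  apply: le_trans (cauchy_schwarz hdot _ _) _.
  by rewrite expr2 mulrA ler_wpM2r ?nrm_ge0.
have q0 : 0 < quad x0.
  by rewrite lt_def (quad_ge0 pT) andbT; apply/eqP => /quad_eq0.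
have n0 : 0 < nrm x0.
  rewrite lt_def nrm_ge0 andbT; apply/eqP => /nrm_eq0 x00.
  by apply: Tx0; rewrite x00 (lin0 lT).
pose S := [set quad x | x in [set x | N x /\ nrm x = 1]].
pose nz x := ((nrm x)^-1)%:C *: x.
have nz1 x : 0 < nrm x -> nrm (nz x) = 1.
  by move=> xp; rewrite nrmZ cabs_real gtr0_norm ?invr_gt0// mulVf ?gt_eqF.
have qnz x : quad (nz x) = quad x / nrm x ^+ 2.
  by rewrite quadZ cabs_real real_normK ?num_real// exprVn mulrC.
have Nnz x : N x -> N (nz x) by move=> Nx; exact: subspZ.
have Snz x : N x -> 0 < nrm x -> S (quad (nz x)).
  by move=> Nx xp; exists (nz x) => //=; split; [exact: Nnz | exact: nz1].
have hsS : has_sup S.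
  split; first by exists (quad (nz x0)); exact: Snz.
  by exists M => _ [x [_ x1] <-]; have := qM x; rewrite x1 expr1n mulr1.
pose m := sup S.
have mub x : N x -> quad x <= m * nrm x ^+ 2.
  move=> Nx; have := nrm_ge0 x; rewrite le_eqVlt => /predU1P[x00|xp].
    have -> : x = 0 by apply: nrm_eq0.
    by rewrite /quad (lin0 lT) dot0l nrm0 expr0n mulr0.
  have := sup_upper_bound hsS (Snz _ Nx xp); rewrite qnz.
  by rewrite ler_pdivrMr// exprn_gt0.
have m0 : 0 < m.
  apply: lt_le_trans (sup_upper_bound hsS (Snz _ Nx0 n0)).
  by rewrite qnz divr_gt0// exprn_gt0.
have Tm x : N x -> nrm (T x) ^+ 2 <= m * quad x.
  move=> Nx; have := quad_cauchy_schwarz x (T x).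
  rewrite (dotE hdot) cabs_real real_normK ?num_real// => h.
  have h2 : quad x * quad (T x) <= quad x * (m * nrm (T x) ^+ 2).
    by rewrite ler_wpM2l ?(quad_ge0 pT)//; exact/mub/TN.
  have [->|tn] := eqVneq (nrm (T x) ^+ 2) 0.
    by rewrite mulr_ge0 ?(quad_ge0 pT)// ltW.
  have tp : 0 < nrm (T x) ^+ 2 by rewrite lt_def tn sqr_ge0.
  rewrite -(ler_pM2r tp) -expr2; apply: le_trans h _; apply: le_trans h2 _.
  by rewrite mulrA [m * quad x]mulrC.
have /choice[u uP] : forall k : nat, exists x, [/\ N x, nrm x = 1 & m - k.+1%:R^-1 < quad x].
  move=> k; have [|_ [x [Nx x1] <-] lt] := sup_adherent (eps := k.+1%:R^-1) _ hsS.
    by rewrite invr_gt0 ltr0n.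
  by exists x.
have [|w wP] := @cluster_image u; first by move=> n; have [_ -> _] := uP n.
have near k : nrm (T (u k) - m%:C *: u k) ^+ 2 <= m / k.+1%:R.
  have [Nk k1] := uP k; move: (k.+1%:R^-1) => r qk.
  have -> : nrm (T (u k) - m%:C *: u k) ^+ 2 = nrm (T (u k)) ^+ 2 - 2 * m * quad (u k) + m ^+ 2.
    apply: complexI; rewrite -(dotE hdot) dotBl !dotBr !dotZl !dotZr !(dotE hdot) k1.
    rewrite conj_rc (quadE pT) -(self_adjoint lT pT) (quadE pT) expr1n.
    have E2 : (2 : R)%:C = 2 :> R[i] by exact: rmorph_nat.
    by move: (nrm (T (u k)) ^+ 2) => q; rewrite rcD rcB !rcM E2; ring.
  have := Tm _ Nk; have : m * (m - quad (u k)) <= m * r.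
    by rewrite ler_pM2l//; lra.
  by rewrite mulrBr expr2; lra.
have approx (t : R) : 0 < t -> exists k, nrm (T (u k) - w) <= t /\ nrm (m%:C *: u k - w) <= 2 * t.
  move=> t0; have [k kt h] := wP t (Num.truncn (m / t ^+ 2)) t0.
  exists k; split=> //.
  have : nrm (T (u k) - m%:C *: u k) <= t.
    rewrite -ler_sqr ?nnegrE ?nrm_ge0 ?(ltW t0)//; apply: le_trans (near k) _.
    rewrite ler_pdivrMr ?ltr0n// mulrC -ler_pdivrMr ?exprn_gt0//.
    by apply/ltW/(lt_le_trans (truncnS_gt _)); rewrite ler_nat ltnS.
  have -> : m%:C *: u k - w = (m%:C *: u k - T (u k)) + (T (u k) - w).
    by rewrite addrA subrK.
  by rewrite nrmB => h'; apply: le_trans (nrmD _ _) _; lra.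
have small (a : R) (C : R) : 0 <= a -> 0 < C -> (forall t, 0 < t -> a <= C * t) -> a = 0.
  move=> a0 C0 h; apply/eqP; rewrite eq_le a0 andbT; apply/ler_addgt0Pr => t t0.
  by rewrite add0r; have := h (t / C); rewrite divr_gt0// => /(_ isT); rewrite mulrC divfK ?gt_eqF.
have Nw : N w.
  apply: clN; apply/closure_nrmP => t t0; have [|k [_ h]] := approx (t / 2); first by lra.
  exists (m%:C *: u k); first by apply: subspZ => //; have [] := uP k.
  by rewrite nrmB; lra.
have nw : nrm w = m.
  apply/eqP; rewrite -subr_eq0 -normr_eq0; apply/eqP.
  apply: (small _ 2) => // t t0; have [k [_ h]] := approx t t0.
  have [_ k1 _] := uP k.
  have nk : nrm (m%:C *: u k) = m by rewrite nrmZ k1 mulr1 cabs_real gtr0_norm.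
  rewrite ler_norml; apply/andP; split.
    by have := nrmD (m%:C *: u k - w) w; rewrite subrK nk; lra.
  by have := nrmD (w - m%:C *: u k) (m%:C *: u k); rewrite subrK nk nrmB; lra.
have Tw : T w = m%:C *: w.
  apply/eqP; rewrite -subr_eq0; apply/eqP/nrm_eq0.
  apply: (small _ (2 * M + m)); [exact: nrm_ge0 | lra |] => t t0.
  have [k [h1 h2]] := approx t t0.
  have -> : T w - m%:C *: w = T (w - m%:C *: u k) + m%:C *: (T (u k) - w).
    by rewrite (linB lT) (linZ lT) scalerBr addrA subrK.
  apply: le_trans (nrmD _ _) _; rewrite nrmZ cabs_real gtr0_norm//.
  have := MP (w - m%:C *: u k); rewrite nrmB in h2.
  have : M * nrm (w - m%:C *: u k) <= M * (2 * t) by rewrite ler_pM2l.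
  have : m * nrm (T (u k) - w) <= m * t by rewrite ler_pM2l.
  by rewrite mulrDl; lra.
have wp : 0 < nrm w by rewrite nw.
have qw : quad (nz w) = m.
  apply: complexI; rewrite -(quadE pT) (linZ lT) Tw scalerA mulrC -scalerA dotZl.
  by rewrite (dotE hdot) nz1// expr1n mulr1.
exists (nz w); rewrite qw; split=> //; [exact: Nnz | exact: nz1 |].
by rewrite (linZ lT) Tw !scalerA mulrC.
Qed.

(** Top eigenvectors are chosen successively, each in the orthogonal complement of the earlier
    ones. *)
Lemma spectral_sequence : ~ finite_rank T ->
  exists g (eta : nat -> R),
  [/\ orthonormal_on dot setT g, forall n, T (g n) = (eta n)%:C *: g n, forall n, 0 < eta n,
      forall n m, (n <= m)%N -> eta m <= eta n &
      forall x, (forall n, dot x (g n) = 0) -> T x = 0].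
Proof.
move=> nfr.
pose good (l : seq H) :=
  (forall i j, (i < size l)%N -> (j < size l)%N -> dot (nth 0 l i) (nth 0 l j) = (i == j)%:R) /\
  forall i, (i < size l)%N -> T (nth 0 l i) = (quad (nth 0 l i))%:C *: nth 0 l i.
pose N (l : seq H) : set H := [set x | forall i, (i < size l)%N -> dot x (nth 0 l i) = 0].
pose P (l : seq H) (g : H) := [/\ N l g, nrm g = 1, T g = (quad g)%:C *: g, 0 < quad g &
    forall x, N l x -> quad x <= quad g * nrm x ^+ 2].
have [||g gP] := @history_choice H 0 good P.
- by split.
- move=> l [on eig].
  have [||||g gP] := @top_eigenvector (N l).
  + split=> [i il|a x y xN yN i il]; first by rewrite dot0l.
    by rewrite dotDl dotZl xN// yN// mulr0 addr0.
  + move=> x cx i il; apply: cabs_eq0; apply/eqP.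
    rewrite eq_le cabs_ge0 andbT; apply/ler_addgt0Pr => t t0; rewrite add0r.
    have d0 : 0 < nrm (nth 0 l i) + 1 by rewrite ltr_wpDl ?nrm_ge0.
    have [|y Ny xy] := (closure_nrmP (N l) x).1 cx (t / (nrm (nth 0 l i) + 1)).
      exact: divr_gt0.
    have -> : dot x (nth 0 l i) = dot (x - y) (nth 0 l i) by rewrite dotBl Ny// subr0.
    apply: le_trans (cauchy_schwarz hdot _ _) _.
    move: xy; rewrite ler_pdivlMr// => /(le_trans _); apply.
    by rewrite ler_wpM2l ?nrm_ge0// lerDl.
  + by move=> x xN i il; rewrite (self_adjoint lT pT) eig// dotZr xN// mulr0.
  (* If [T] vanished on the complement of [l], its range would be spanned by the finitely many
     images of [l]. *)
  + apply: contrapT => nex; apply: nfr.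
    exists (size l), (fun i : 'I_(size l) => T (nth 0 l i)) => x.
    exists (fun i : 'I_(size l) => dot x (nth 0 l i)).
    pose y := \sum_(i < size l) dot x (nth 0 l i) *: nth 0 l i.
    have Nxy : N l (x - y).
      move=> i il; rewrite dotBl dot_suml (bigD1 (Ordinal il))//= big1 ?addr0.
        by rewrite dotZl on// eqxx mulr1 subrr.
      move=> j; rewrite -val_eqE /= => /negPf ji.
      by rewrite dotZl on// ji mulr0.
    have : T (x - y) = 0 by apply: contrapT => Txy; apply: nex; exists (x - y).
    rewrite (linB lT) => /eqP; rewrite subr_eq0 => /eqP ->.
    by rewrite (lin_sum lT); apply: eq_bigr => i _; rewrite (linZ lT).
  exists g; split=> //; have [Ng g1 Tg _ _] := gP.
  have sz : size (rcons l g) = (size l).+1 by rewrite size_rcons.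
  split.
    move=> i j; rewrite sz !ltnS !nth_rcons (leq_eqVlt i) (leq_eqVlt j).
    move=> /predU1P[->|il] /predU1P[->|jl]; rewrite ?ltnn ?eqxx ?il ?jl.
    * by rewrite (dotE hdot) g1 expr1n.
    * by rewrite Ng// gt_eqF.
    * by rewrite (dot_eq0C (Ng _ il)) lt_eqF.
    * exact: on.
  move=> i; rewrite sz ltnS nth_rcons leq_eqVlt.
  by move=> /predU1P[->|il]; rewrite ?ltnn ?eqxx ?il//; exact: eig.
have nthg n i : (i < n)%N -> nth 0 (mkseq g n) i = g i by move=> i_n; rewrite nth_mkseq.
have on : orthonormal_on dot setT g.
  move=> i j _ _; have [[+ _] _] := gP (maxn i j).+1.
  move=> /(_ i j); rewrite size_mkseq !nthg ?ltnS ?leq_maxl ?leq_maxr//.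
  by apply.
have Ng n x : N (mkseq g n) x <-> forall i, (i < n)%N -> dot x (g i) = 0.
  split=> h i; first by move=> i_n; have := h i; rewrite size_mkseq nthg//; apply.
  by rewrite size_mkseq => i_n; rewrite nthg// h.
have eig n : T (g n) = (quad (g n))%:C *: g n by have [_ []] := gP n.
have pos n : 0 < quad (g n) by have [_ []] := gP n.
have top n x : (forall i, (i < n)%N -> dot x (g i) = 0) -> quad x <= quad (g n) * nrm x ^+ 2.
  by move=> h; have [_ [_ _ _ _]] := gP n; apply; exact/Ng.
have g1 n : nrm (g n) = 1 by apply: (nrm_dot1 hdot); rewrite on// eqxx.
exists g, (quad \o g); split=> //.
  move=> n m nm /=; have := top n (g m); rewrite g1 expr1n mulr1; apply.
  by move=> i i_n; rewrite on//; have -> : (m == i) = false by lia.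
(* A vector orthogonal to all [g n] competed at every stage, so [quad x <= quad (g n) * nrm x ^+ 2]
   for all [n], and the right side tends to 0. *)
move=> x xg; apply: quad_eq0; apply/eqP; rewrite eq_le (quad_ge0 pT) andbT.
have van := eigenvalues_vanish on eig (fun n => ltW (pos n)).
apply/ler_addgt0Pr => t t0; rewrite add0r.
have d0 : 0 < nrm x ^+ 2 + 1 by rewrite ltr_wpDl ?sqr_ge0.
have [|n nP] := van (t / (nrm x ^+ 2 + 1)); first exact: divr_gt0.
apply: le_trans (top n x (fun i _ => xg i)) _.
have := nP n (leqnn n); rewrite ler_pdivlMr//= => /(le_trans _); apply.
by rewrite ler_wpM2l ?lerDl// ltW.
Qed.

End Spectral.

(** * Uniqueness of dimension and counting *)

Section Dimension.
Variables (R : realType) (H : completeNormedModType R[i]).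

Lemma has_dim_le (M : set H) n m : has_dim M n -> has_dim M m -> (n <= m)%N.
Proof.
move=> [b [Mb fb _]] [b' [_ _ sb']]; rewrite leqNgt; apply/negP => mn.
have /choice[C CP] : forall i, exists c : 'I_m -> R[i], b i = \sum_(j < m) c j *: b' j.
  by move=> i; apply: sb'.
pose D := \matrix_(i < n, j < m) C i j.
have /rowV0Pn[v /sub_kermxP vD v0] : kermx D != 0.
  rewrite -mxrank_eq0 mxrank_ker subn_eq0 -ltnNge.
  exact: leq_ltn_trans (rank_leq_col _) mn.
case/negP: v0; apply/eqP/rowP => i; rewrite mxE; move: i; apply: fb.
under eq_bigr do rewrite CP scaler_sumr.
rewrite exchange_big big1//= => j _.
under eq_bigr do rewrite scalerA.
rewrite -scaler_suml; have := congr1 (fun A : 'rV_m => A 0 j) vD.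
by rewrite !mxE; under eq_bigr do rewrite mxE; move=> ->; rewrite scale0r.
Qed.

Lemma has_dim_unique (M : set H) n m : has_dim M n -> has_dim M m -> n = m.
Proof. by move=> h1 h2; apply/eqP; rewrite eqn_leq !(has_dim_le h1 h2, has_dim_le h2 h1). Qed.

Lemma card_proper (A B : set nat) k n : A k -> ~ B k -> B `<=` A ->
  (A #= `I_n)%card -> (B #= `I_n)%card -> False.
Proof.
move=> Ak Bk BA An Bn.
have fA : finite_set (A `\ k).
  by apply: (@sub_finite_set _ _ A); [exact: subDsetl | apply/finite_setP; exists n].
have /finite_setP[m Am] := fA.
have mn : (`I_m.+1 #<= `I_n)%card.
  have Am1 : (A #= `I_m.+1)%card by apply/eq_cardSP; exists k.
  by rewrite -(card_le_eql Am1) -(card_le_eqr An).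
have nm : (`I_n #<= `I_m)%card.
  rewrite -(card_le_eql Bn) -(card_le_eqr Am).
  by apply: subset_card_le => j Bj; split; [exact: BA | move=> jk; apply: Bk; rewrite -jk].
by move: mn nm; rewrite !card_le_II => mn /(leq_trans mn); rewrite ltnn.
Qed.

End Dimension.

(** * Singular numbers as decreasing eigenvalues *)

Section SingularNumbers.
Variables (R : realType) (H : completeNormedModType R[i]).
Variable dot : {dot H for Num.conj}.
Hypothesis hdot : inner_product_norm dot.
Variable e : nat -> H.
Hypothesis he : orthonormal_basis dot e.
Implicit Types (x y z w : H) (f g : nat -> H).

Local Notation proj_on := (proj_on dot).
Local Notation expansion := (expansion dot).

(** At the first difference, say [s2 k < s1 k], every index where [s2] equals [s1 k] lies below [k],
    so [s1] takes this value there and once more at [k]. Both multiplicities equal the same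
    dimension. *)
Lemma singular_sequence_unique T (s s' : nat -> R) :
  singular_sequence dot T s -> singular_sequence dot T s' -> s = s'.
Proof.
have key (s1 s2 : nat -> R) k : singular_sequence dot T s1 -> singular_sequence dot T s2 ->
    (forall j, (j < k)%N -> s1 j = s2 j) -> s2 k < s1 k -> False.
  move=> [p1 d1 c1] [p2 d2 c2] eqk lt.
  have l0 : 0 < s1 k by exact: le_lt_trans lt.
  have [n [An dn]] := c1 _ l0; have [m [Bm dm]] := c2 _ l0.
  have E := has_dim_unique dm dn; rewrite E in Bm.
  have small j : (k <= j)%N -> s2 j <> s1 k.
    by move=> kj E'; have := d2 _ _ kj; rewrite E'; lra.
  apply: (@card_proper [set j | s1 j = s1 k] [set j | s2 j = s1 k] k n) => //=.
    exact: small.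
  move=> j /= sj; have [jk|kj] := ltnP j k; first by rewrite eqk.
  by case: (small _ kj).
move=> h h'; apply/funext => k; elim/ltn_ind: k => k IH.
case: (ltgtP (s k) (s' k)) => // lt; exfalso.
  by apply: (key s' s k) => // j jk; rewrite IH.
exact: (key s s' k).
Qed.

Lemma positive_adjoint T : bounded_op T -> positive_op dot T -> adjoint dot T = T.
Proof. by move=> bT pT; apply: (adjointE hdot) => x y; rewrite (self_adjoint bT.1 pT). Qed.

Definition eigensystem T g (eta : nat -> R) :=
  [/\ orthonormal_on dot setT g, forall n, T (g n) = (eta n)%:C *: g n, forall n, 0 < eta n,
      forall n m, (n <= m)%N -> eta m <= eta n &
      forall x, (forall n, dot x (g n) = 0) -> T x = 0].

Lemma singular_numbersE T g eta : compact_op T -> positive_op dot T ->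
  eigensystem T g eta -> singular_numbers dot T = eta.
Proof.
move=> cT pT [on Tg pos dec ker].
have van : vanishing eta.
  by apply: (eigenvalues_vanish hdot cT on Tg) => n; exact: ltW.
have lT := cT.1.1.
suff sT : singular_sequence dot T eta.
  apply: (@singular_sequence_unique T) => //.
  by apply: (@xgetPex _ (fun=> 0) [set s | singular_sequence dot T s]); exists eta.
split=> [j|//|l l0]; first exact: ltW.
have exa : exists a, eta a <= l.
  by have [a aP] := van _ l0; exists a; exact: aP.
have exa' : exists a, eta a < l.
  by have [|a aP] := van (l / 2); [lra | exists a; have := aP a (leqnn a); lra].
(* The indices with eigenvalue [l] form the interval from [a] to [a' - 1], which is empty when [l]
   is not an eigenvalue. *)
case: (ex_minnP exa) => a la amin; case: (ex_minnP exa') => a' la' amin'.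
have aa' : (a <= a')%N by apply: amin; exact: ltW.
have etaE j : (eta j == l) = (a <= j < a')%N.
  apply/eqP/andP => [ej|[aj ja']].
    split; first by apply: amin; rewrite ej.
    by rewrite ltnNge; apply/negP => /dec; rewrite ej; lra.
  apply: le_anti; rewrite (le_trans (dec _ _ aj) la)/= leNgt; apply/negP => /amin'.
  by rewrite leqNgt ja'.
exists (a' - a)%N; split.
  apply/card_set_bijP; exists (fun j => j - a)%N; split.
  - move=> j /= /eqP; rewrite etaE; lia.
  - move=> i j; rewrite !inE /= => /eqP; rewrite etaE => hi /eqP; rewrite etaE => hj; lia.
  - move=> j /= ja; exists (a + j)%N; last by lia.
    by apply/eqP; rewrite etaE; lia.
exists (fun i => g (a + i)%N); split.
- move=> i /=; rewrite (positive_adjoint cT.1 pT).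
  have -> : l = eta (a + i)%N by apply/esym/eqP; rewrite etaE; have := ltn_ord i; lia.
  by rewrite Tg (linZ lT) Tg scalerA rcX expr2.
- move=> c c0 i; have := congr1 (fun v => dot v (g (a + i)%N)) c0.
  rewrite dot0l dot_suml (bigD1 i)//= big1 ?addr0.
    by rewrite dotZl on// eqxx mulr1.
  move=> j ji; rewrite dotZl on//.
  have -> : ((a + j)%N == (a + i)%N) = (j == i) by rewrite eqn_add2l.
  by rewrite (negPf ji) mulr0.
- move=> x /=; rewrite (positive_adjoint cT.1 pT) => TTx.
  have xg j : ~~ (a <= j < a')%N -> dot x (g j) = 0.
    rewrite -etaE => ne.
    have := congr1 (fun v => dot v (g j)) TTx.
    rewrite dotZl !(self_adjoint lT pT) Tg (linZ lT) Tg !dotZr !conj_rc => E.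
    have : ((eta j ^+ 2 - l ^+ 2)%:C) * dot x (g j) = 0.
      by rewrite rcB mulrBl -E !rcX; ring.
    move=> /eqP; rewrite mulf_eq0 => /orP[|/eqP//].
    rewrite -[0]/(0%:C) (inj_eq (@complexI R)) subr_eq0 eqrXn2// ?(negPf ne)// ltW//.
  (* [y] is orthogonal to all [g j], so [T y = 0]; it is also in the eigenspace for [l ^+ 2 > 0], so
     [y = 0]. *)
  pose y := x - \sum_(i < a' - a) dot x (g (a + i)%N) *: g (a + i)%N.
  have yg j : dot y (g j) = 0.
    rewrite dotBl dot_suml; have [/andP[aj ja']|nj] := boolP (a <= j < a')%N.
      have ja : (j - a < a' - a)%N by lia.
      rewrite (bigD1 (Ordinal ja))//= big1 ?addr0.
        by rewrite subnKC// dotZl on// eqxx mulr1 subrr.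
      move=> i; rewrite -val_eqE /= => ne; rewrite dotZl on//.
      have -> : ((a + i)%N == j) = false by lia.
      by rewrite mulr0.
    rewrite xg// sub0r big1 ?oppr0// => i _; rewrite dotZl on//.
    have -> : ((a + i)%N == j) = false by have := ltn_ord i; move: nj; lia.
    by rewrite mulr0.
  have Ty := ker _ yg.
  have TTg i : (i < a' - a)%N -> T (T (g (a + i)%N)) = (l ^+ 2)%:C *: g (a + i)%N.
    move=> ia; have -> : l = eta (a + i)%N by apply/esym/eqP; rewrite etaE; lia.
    by rewrite Tg (linZ lT) Tg scalerA rcX expr2.
  have : T (T y) = (l ^+ 2)%:C *: y.
    rewrite /y !(linB lT) TTx !(lin_sum lT) scalerBr scaler_sumr; congr (_ - _).
    apply: eq_bigr => i _; rewrite !(linZ lT) TTg ?ltn_ord//.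
    by rewrite !scalerA mulrC.
  rewrite Ty (lin0 lT) => /esym/eqP; rewrite scaler_eq0 => /orP[|/eqP y0].
    by rewrite -[0]/(0%:C) (inj_eq (@complexI R)) expf_eq0 /= gt_eqF.
  exists (fun i => dot x (g (a + i)%N)); apply/eqP; rewrite -subr_eq0; exact/eqP.
Qed.

End SingularNumbers.

(** * Range projections and traces *)

Section Projections.
Variables (R : realType) (H : completeNormedModType R[i]).
Variable dot : {dot H for Num.conj}.
Hypothesis hdot : inner_product_norm dot.
Variable e : nat -> H.
Hypothesis he : orthonormal_basis dot e.
Implicit Types (x y z w : H) (f g : nat -> H).

Local Notation proj_on := (proj_on dot).
Local Notation expansion := (expansion dot).

Lemma closure_perp (M : set H) y : (forall z, M z -> dot y z = 0) ->
  forall z, closure M z -> dot y z = 0.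
Proof.
move=> h z cz; apply: cabs_eq0; apply/eqP.
rewrite eq_le cabs_ge0 andbT; apply/ler_addgt0Pr => t t0; rewrite add0r.
have d0 : 0 < nrm y + 1 by rewrite ltr_wpDl ?nrm_ge0.
have [|u Mu zu] := (closure_nrmP M z).1 cz (t / (nrm y + 1)); first exact: divr_gt0.
have -> : dot y z = dot y (z - u) by rewrite dotBr (h u Mu) subr0.
apply: le_trans (cauchy_schwarz hdot _ _) _.
move: zu; rewrite ler_pdivlMr// => /(le_trans _); apply.
by rewrite mulrC ler_wpM2l ?nrm_ge0// lerDl.
Qed.

Lemma orth_projE (M : set H) x y : M y -> (forall z, M z -> dot (x - y) z = 0) ->
  orth_proj dot M x = y.
Proof.
move=> My yP; rewrite /orth_proj; set S := [set y | _].
have [Mz zP] : S (xget 0 S) by apply: xgetPex; exists y.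
set z := xget 0 S in Mz zP *.
apply/eqP; rewrite -subr_eq0; apply/eqP/nrm_sqr_eq0/complexI.
rewrite -(dotE hdot).
have -> : dot (z - y) (z - y) = dot (x - y) (z - y) - dot (x - z) (z - y).
  by rewrite -dotBl; congr (dot _ _); rewrite opprB [RHS]addrC addrA subrK.
by rewrite !dotBr (yP z)// (yP y)// (zP z)// (zP y)// !subrr.
Qed.

Lemma proj_on0 f : onz dot f -> proj_on f 0 = 0.
Proof.
move=> of_; apply: nrm_sqr_eq0; apply: complexI; rewrite -(dotE hdot).
by rewrite (proj_on_self hdot of_) dot0r.
Qed.

Lemma proj_on_perp0 f x : onz dot f -> (forall k, dot x (f k) = 0) -> proj_on f x = 0.
Proof.
move=> of_ xf; apply: nrm_sqr_eq0; apply: complexI; rewrite -(dotE hdot).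
by rewrite (proj_on_self hdot of_) (proj_on_perp hdot of_)// => k; exact: dot_eq0C.
Qed.

Lemma proj_on_fix f k : orthonormal_on dot setT f -> proj_on f (f k) = f k.
Proof.
move=> on; have of_ := onb_onz on; apply: (@dot_ext _ _ dot hdot) => y.
apply: (cvg_dotl hdot (N := k.+1) (@expansion_cvg _ _ _ hdot _ of_ _)) => n kn.
rewrite /expansion (bigD1_seq k) ?mem_index_iota ?iota_uniq//= big1 ?addr0.
  by rewrite on// eqxx scale1r.
by move=> j /negPf jk; rewrite on// eq_sym jk scale0r.
Qed.

(** Each [g k] is the image of a multiple of itself, and by symmetry the range is orthogonal to the
    complement of [g], on which [T] vanishes. *)
Lemma range_projE T g eta : bounded_op T -> positive_op dot T ->
  eigensystem dot T g eta -> range_proj dot T = proj_on g.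
Proof.
move=> bT pT [on Tg pos _ ker]; have og := onb_onz on; have lT := bT.1.
apply/funext => x; apply: orth_projE.
  apply/closure_nrmP => t t0.
  have /cvg_nrmP/(_ t t0)[N NP] := @expansion_cvg _ _ _ hdot _ og x.
  exists (expansion g x N); last by rewrite nrmB NP.
  exists (\sum_(0 <= k < N) (dot x (g k) * ((eta k)^-1)%:C) *: g k) => //.
  rewrite (lin_sum lT); apply: eq_bigr => k _.
  rewrite (linZ lT) Tg scalerA -mulrA -rcM mulVf ?gt_eqF// mulr1 //.
apply: closure_perp => _ [y _ <-].
rewrite -(self_adjoint lT pT) ker ?dot0l// => n.
by rewrite dotBl (proj_on_dot hdot og) subrr.
Qed.

Lemma proj_join_proj f : onz dot f -> proj_join dot (proj_on f) (proj_on f) = proj_on f.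
Proof.
move=> of_; apply/funext => x; apply: orth_projE.
  apply: subset_closure; exists (proj_on f x); first by exists x.
  by exists 0; [exists 0 => //; exact: proj_on0 | rewrite addr0].
apply: closure_perp => _ [_ [y _ <-] [_ [z _ <-] <-]].
have p0 w : dot (x - proj_on f x) (proj_on f w) = 0.
  apply: dot_eq0C; apply: (proj_on_perp hdot of_) => k; apply: dot_eq0C.
  by rewrite dotBl (proj_on_dot hdot of_) subrr.
by rewrite dotDr !p0 addr0.
Qed.

(** Linearly dependent vectors are kept: as [0^-1 = 0], normalization turns their remainder into a
    zero entry, which [onz] allows. *)
Lemma gram_schmidt (u : nat -> H) : exists z : nat -> H,
  [/\ onz dot z, forall k, lspan (initial u k.+1) (z k) &
      forall k, lspan (initial z k.+1) (u k)].
Proof.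
pose nz w := ((nrm w)^-1)%:C *: w.
pose P (l : seq H) z := z = nz (u (size l) -
  \sum_(0 <= i < size l) dot (u (size l)) (nth 0 l i) *: nth 0 l i).
have [||z zP] := @history_choice H 0 (fun=> True) P => //.
  by move=> l _; eexists; split; first by [].
pose w n := u n - expansion z (u n) n.
have zE n : z n = nz (w n).
  have [_] := zP n; rewrite /P size_mkseq => ->; congr (nz (_ - _)).
  by apply: eq_big_nat => i /andP[_ i_n]; rewrite nth_mkseq.

have wE n : w n = (nrm (w n))%:C *: z n.
  rewrite zE /nz scalerA -rcM; have [n0|n0] := eqVneq (nrm (w n)) 0.
    by rewrite (nrm_eq0 n0) scaler0.
  by rewrite mulfV// scale1r.
have oz : onz dot z.
  suff h n : forall i j, (i < n)%N -> (j < n)%N -> dot (z i) (z j) = ((i == j) && (z i != 0))%:R.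
    by move=> i j; apply: (h (maxn i j).+1); rewrite ltnS ?leq_maxl ?leq_maxr.
  elim: n => // n IH.
  (* Replacing the entries not yet treated by 0 makes [onz] hold at all indices, so the lemmas on
     expansions apply inside the induction. *)
  pose f i := if (i < n)%N then z i else 0.
  have of_ : onz dot f.
    move=> i j; rewrite /f; case: (ltnP i n) => i_n; case: (ltnP j n) => jn.
    - exact: IH.
    - by rewrite dot0r; have -> : (i == j) = false by lia.
    - by rewrite dot0l eqxx andbF.
    - by rewrite dot0l eqxx andbF.
  have wz k : (k < n)%N -> dot (w n) (z k) = 0.
    move=> kn; rewrite /w dotBl.
    have -> : expansion z (u n) n = expansion f (u n) n.
      by apply: eq_big_nat => i /andP[_ i_n]; rewrite /f i_n.
    have {2}-> : z k = f k by rewrite /f kn.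
    by rewrite (expansion_dot of_) kn /f kn subrr.
  have znk k : (k < n)%N -> dot (z n) (z k) = 0.
    by move=> kn; rewrite zE dotZl wz// mulr0.
  move=> i j; rewrite !ltnS (leq_eqVlt i) (leq_eqVlt j).
  move=> /predU1P[->|il] /predU1P[->|jl].
  - rewrite eqxx /= {1 2}zE /nz dotZl dotZr conj_rc (dotE hdot).
    have [n0|n0] := eqVneq (nrm (w n)) 0.
      by rewrite zE /nz n0 invr0 scale0r eqxx mul0r.
    have -> : z n != 0.
      apply/eqP => z0; move: n0; rewrite wE z0 scaler0 nrm0 eqxx//.
    by rewrite -!rcM expr2 mulKf// mulVf.
  - by rewrite znk//; have -> : (n == j) = false by lia.
  - by rewrite (dot_eq0C (znk _ il)); have -> : (i == n) = false by lia.
  - exact: IH.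
have psp S k y : (forall i, (i < k)%N -> lspan S (z i)) -> lspan S (expansion z y k).
  move=> h; rewrite /expansion; elim: k h => [|k IH] h.
    by rewrite big_geq//; exact: (lspan_subsp S).1.
  rewrite big_nat_recr//=; apply: lspanD; last by apply: lspanZ; exact: h.
  by apply: IH => i ik; apply: h; exact: ltnW.
exists z; split=> //.
- elim/ltn_ind => k IH; rewrite zE; apply: lspanZ; rewrite /w -scaleN1r.
  apply: lspanD; first by apply: lspan_in; exists k => //=.
  apply: lspanZ; apply: psp => i ik; apply: lspan_mono (IH i ik).
  by move=> _ [j ji <-]; exists j => //=; move: ji => /=; lia.
- move=> k; rewrite -(subrK (expansion z (u k) k) (u k)) -/(w k) wE.
  apply: lspanD; first by apply: lspanZ; apply: lspan_in; exists k => //=.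
  by apply: psp => i ik; apply: lspan_in; exists i => //=; lia.
Qed.

(** Gram-Schmidt is applied to the projections of the [e k] to the complement of [g]; finite and
    infinite dimension of this complement are treated alike. *)
Lemma kernel_family g : orthonormal_on dot setT g -> exists z : nat -> H,
  [/\ onz dot z, forall k n, dot (z k) (g n) = 0 &
      forall x, (forall n, dot x (g n) = 0) -> (forall k, dot x (z k) = 0) -> x = 0].
Proof.
move=> on; have og := onb_onz on.
pose Q x := x - proj_on g x.
have Qg x n : dot (Q x) (g n) = 0 by rewrite dotBl (proj_on_dot hdot og) subrr.
have [z [oz zQ Qz]] := gram_schmidt (Q \o e).
exists z; split=> //.
  move=> k n; apply: (lspan_dot _ (zQ k)) => _ [j _ <-]; exact: Qg.
move=> x xg xz; apply: (total_e hdot he) => k.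
have Qx : dot (Q (e k)) x = 0.
  by apply: (lspan_dot _ (Qz k)) => _ [j _ <-]; apply/dot_eq0C/xz.
have := proj_on_perp hdot og (e k) (fun n => dot_eq0C (xg n)).
move=> p0; apply: dot_eq0C.
by move: Qx; rewrite /Q dotBl p0 subr0.
Qed.

End Projections.

(** * Counting indices in the extended reals *)

Section Counting.
Variable R : realType.
Implicit Types (P Q : pred nat).

(** Cardinality written as a series, the shape in which traces of projections appear. *)
Definition ecount P : \bar R := (\sum_(0 <= k <oo) ((P k)%:R : R)%:E)%E.

Lemma sum_count P n :
  (\sum_(0 <= k < n) ((P k)%:R : R)%:E)%E = (count P (iota 0 n))%:R%:E.
Proof.
rewrite sumEFin -sum1_count natr_sum [in RHS]big_mkcond /= /index_iota subn0.
by congr (_%:E); apply: eq_bigr => j _; case: (P j).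
Qed.

Lemma ecount_ge P n : ((count P (iota 0 n))%:R%:E <= ecount P)%E.
Proof. by rewrite -sum_count; apply: nneseries_lim_ge => k _ _; rewrite lee_fin ler0n. Qed.

Lemma ecount_finite P n : (forall k, (n <= k)%N -> ~~ P k) ->
  ecount P = (count P (iota 0 n))%:R%:E.
Proof.
move=> nP; apply/eqP; rewrite eq_le ecount_ge andbT.
apply: lime_le.
  by apply: is_cvg_nneseries => k _ _; rewrite lee_fin ler0n.
near=> m; rewrite sum_count.
rewrite lee_fin ler_nat.
have nm : (n <= m)%N by near: m; exists n.
rewrite -(subnKC nm) iotaD count_cat add0n.
have -> : count P (iota n (m - n)) = 0%N.
  apply/eqP; rewrite -leqn0 leqNgt -has_count; apply/hasP => -[k].
  by rewrite mem_iota => /andP[/nP /negPf ->].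
by rewrite addn0.
Unshelve. all: by end_near.
Qed.

Lemma ecount_infinite P : (forall n, exists2 k, (n <= k)%N & P k) -> ecount P = +oo%E.
Proof.
move=> inf; have big m : exists n, (m <= count P (iota 0 n))%N.
  elim: m => [|m [n mn]]; first by exists 0%N.
  have [k nk Pk] := inf n; exists k.+1.
  have -> : iota 0 k.+1 = iota 0 k ++ [:: k] by rewrite -addn1 iotaD.
  rewrite count_cat /= Pk addn0 addn1 ltnS.
  apply: leq_trans mn _; rewrite -(subnKC nk) iotaD count_cat; exact: leq_addr.
apply: eq_infty => r.
have [n nP] := big (Num.truncn r).+1.
apply: le_trans (ecount_ge P n); rewrite lee_fin.
by apply/ltW/(lt_le_trans (truncnS_gt _)); rewrite ler_nat.
Qed.

Lemma infinite_or_bounded P :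
  (forall n, exists2 k, (n <= k)%N & P k) \/ exists n, forall k, (n <= k)%N -> ~~ P k.
Proof.
have [h|h] := pselect (exists n, forall k, (n <= k)%N -> ~~ P k); [by right|left].
move=> n; apply: contrapT => ne; apply: h; exists n => k nk.
by apply/negP => Pk; apply: ne; exists k.
Qed.

(* [1 / (k + 1)] turns an infinite set of indices into a vanishing sequence. *)
Lemma enumeration P : (forall n, exists2 k, (n <= k)%N & P k) ->
  exists s : nat -> nat, [/\ injective s, forall n, P (s n) & forall k, P k -> exists n, s n = k].
Proof.
move=> inf; pose x k : R := (P k)%:R / k.+1%:R.
have xp k : (0 < x k) = P k.
  by rewrite /x; case: (P k); rewrite ?mul0r ?ltxx// mul1r invr_gt0 ltr0n.
have [|||s [sinj sp _ ssurj]] := @decreasing_enumeration R x.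
- by move=> k; rewrite divr_ge0.
- move=> t t0; exists (Num.truncn t^-1) => n nN.
  apply: (@le_trans _ _ n.+1%:R^-1).
    by rewrite /x; case: (P n); rewrite ?mul1r// mul0r invr_ge0.
  rewrite -[t]invrK lef_pV2 ?posrE ?invr_gt0 ?ltr0n//.
  by apply/ltW/(lt_le_trans (truncnS_gt _)); rewrite ler_nat ltnS.
- by move=> n; have [k nk Pk] := inf n; exists k; rewrite ?xp.
exists s; split=> // [n|k Pk]; first by rewrite -xp.
by apply: ssurj; rewrite xp.
Qed.

(** Among [n + 1] distinct indices some [M] is at least [n]; its term is at most [x n], and the
    others are handled by induction. *)
Lemma sum_uniq_le_psum (x : nat -> R) (l : seq nat) :
  (forall n m, (n <= m)%N -> x m <= x n) -> uniq l ->
  \sum_(j <- l) x j <= psum x (size l).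
Proof.
move=> xn; move E : (size l) => n; elim: n l E => [|n IH] l E u.
  by move/eqP: E; rewrite size_eq0 => /eqP ->; rewrite big_nil psum0.
have [M Ml Mn] : exists2 M, M \in l & (n <= M)%N.
  apply: contrapT => ne.
  have sub : {subset l <= iota 0 n}.
    move=> j jl; rewrite mem_iota /= add0n ltnNge; apply/negP => nj.
    by apply: ne; exists j.
  by have := uniq_leq_size u sub; rewrite size_iota E ltnn.
rewrite (big_rem M)//= psumS addrC lerD//; last exact: xn.
by apply: IH; rewrite ?rem_uniq// size_rem// E.
Qed.

End Counting.

(** * Traces of kernel projections, and diagonals of conjugated operators *)

Section Traces.
Variables (R : realType) (H : completeNormedModType R[i]).
Variable dot : {dot H for Num.conj}.
Hypothesis hdot : inner_product_norm dot.
Variable e : nat -> H.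
Hypothesis he : orthonormal_basis dot e.
Implicit Types (x y w : H) (f g z : nat -> H).

Local Notation proj_on := (proj_on dot).
Local Notation expansion := (expansion dot).
Local Notation sqd := (sqd dot).

Lemma parseval_series f x : onz dot f ->
  ((nrm (proj_on f x) ^+ 2)%:E = \sum_(0 <= k <oo) (sqd x (f k))%:E)%E.
Proof.
move=> of_; apply/eqP; rewrite eq_le; apply/andP; split.
  apply/lee_addgt0Pr => t t0.
  have [N NP] := parseval_cvg hdot of_ x t0.
  apply: (@le_trans _ _ ((psum (fun k => sqd x (f k)) N)%:E + t%:E)%E).
    by rewrite -EFinD lee_fin -lerBlDr NP.
  rewrite leeD2r// /psum -sumEFin.
  by apply: nneseries_lim_ge => k _ _; rewrite lee_fin sqd_ge0.
apply: lime_le; first by apply: is_cvg_nneseries => k _ _; rewrite lee_fin sqd_ge0.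
by near=> n; rewrite sumEFin lee_fin; exact: (proj_on_bound hdot of_).
Unshelve. all: by end_near.
Qed.

(** The trace is the double series of [|<e k, z j>| ^ 2]. Summed over [k] first, it gives the
    squared norm of [z j], which is 1 or 0. *)
Lemma trace_kernel A g eta z : bounded_op A -> positive_op dot A ->
  eigensystem dot A g eta -> onz dot z -> (forall k n, dot (z k) (g n) = 0) ->
  (forall x, (forall n, dot x (g n) = 0) -> (forall k, dot x (z k) = 0) -> x = 0) ->
  trace_op dot e (corange_proj dot A) = ecount R (fun k => z k != 0).
Proof.
move=> bA pA eig oz zg tot; have [on _ _ _ _] := eig; have og := onb_onz on.
rewrite /trace_op /corange_proj (range_projE hdot bA pA eig).
have QE x : x - proj_on g x = proj_on z x.
  apply/eqP; rewrite -subr_eq0; apply/eqP/tot => k.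
    by rewrite !dotBl (proj_on_dot hdot og) subrr sub0r (proj_on_perp hdot oz) ?oppr0.
  rewrite !dotBl (proj_on_dot hdot oz) (proj_on_perp hdot og) ?subr0 ?subrr// => j.
  exact/dot_eq0C/zg.
under eq_eseriesr => k _.
  rewrite QE.
  have -> : (complex.Re (dot (proj_on z (e k)) (e k)))%:E =
     (\sum_(0 <= j <oo) (sqd (e k) (z j))%:E)%E.
    by rewrite -(proj_on_self hdot oz) (dotE hdot) /= parseval_series.
  over.
rewrite nneseries_interchange; last by move=> i j; rewrite lee_fin sqd_ge0.
apply: eq_eseriesr => j _.
under eq_eseriesr => k _ do rewrite sqdC.
have oe := onb_onz (onb_e he).
rewrite -(parseval_series _ oe) (proj_on_id hdot oe _ (total_e hdot he)).
by congr (_%:E); apply: complexI; rewrite -(dotE hdot) oz eqxx /= rmorph_nat.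
Qed.

Lemma diagonal_apply B k : diagonal_ops dot e B -> B (e k) = dot (B (e k)) (e k) *: e k.
Proof.
move=> [_ dB]; apply: (total_ext (total_e hdot he)) => j; rewrite dotZl (onb_e he)//.
by have [->|kj] := eqVneq k j; rewrite ?mulr1// mulr0 dB.
Qed.

Lemma diagonal_eigensystem B : diagonal_ops dot e B -> compact_op B -> positive_op dot B ->
  (forall n, exists2 k, (n <= k)%N & 0 < quad dot B (e k)) ->
  exists s : nat -> nat,
  [/\ injective s, eigensystem dot B (e \o s) (quad dot B \o e \o s),
     forall k, 0 < quad dot B (e k) -> exists n, s n = k & vanishing (quad dot B \o e)].
Proof.
move=> dB cB pB inf.
have Be k : B (e k) = (quad dot B (e k))%:C *: e k.
  by rewrite [LHS]diagonal_apply// (quadE pB).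
have van : vanishing (quad dot B \o e).
  by apply: (eigenvalues_vanish hdot cB (onb_e he) Be) => n; exact: quad_ge0.
have [|s [sinj sp sdec ssurj]] := @decreasing_enumeration R (quad dot B \o e) _ van inf.
  by move=> k; exact: quad_ge0.
exists s; split=> //; split=> //.
- by move=> i j _ _; rewrite /= (onb_e he)// (inj_eq sinj).
- by move=> n; exact: Be.
- move=> x xs; apply: (total_e hdot he) => k.
  rewrite (self_adjoint cB.1.1 pB) Be dotZr conj_rc.
  have [/ssurj[n <-]|] := ltP 0 (quad dot B (e k)); first by rewrite xs mulr0.
  move=> le; have -> : quad dot B (e k) = 0 by apply: le_anti; rewrite le quad_ge0.
  by rewrite mul0r.
Qed.

(** Each [e k] is either one of the eigenvectors [e (s n)] or orthogonal to all of them. *)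
Lemma trace_diagonal B s : diagonal_ops dot e B -> positive_op dot B -> injective s ->
  eigensystem dot B (e \o s) (quad dot B \o e \o s) ->
  (forall k, 0 < quad dot B (e k) -> exists n, s n = k) ->
  trace_op dot e (corange_proj dot B) = ecount R (fun k => quad dot B (e k) == 0).
Proof.
move=> dB pB sinj eig ssurj; have [on _ pos _ _] := eig.
rewrite /trace_op /corange_proj (range_projE hdot dB.1 pB eig).
apply: eq_eseriesr => k _; congr (_%:E).
have [b0|bn0] := eqVneq (quad dot B (e k)) 0.
  rewrite proj_on_perp0 ?subr0 //; [by rewrite (onb_e he)// eqxx | exact: onb_onz |].
  move=> n; rewrite /= (onb_e he)//; case: eqP => // E.
  by have := pos n; rewrite /= -E b0 ltxx.
have [|n E] := ssurj k; first by rewrite lt_def bn0 quad_ge0.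
have := proj_on_fix hdot n on; rewrite /= E => ->.
by rewrite subrr dot0l.
Qed.

Lemma dot_disjoint x y : (forall k, dot x (e k) = 0 \/ dot y (e k) = 0) -> dot x y = 0.
Proof.
move=> h; apply: (cvg_dotl hdot (N := 0) (@cvg_e _ _ _ _ he x)) => n _.
rewrite dot_suml big1// => k _; rewrite dotZl.
by have [->|/dot_eq0C ->] := h k; rewrite ?mul0r ?mulr0.
Qed.

Section PartialIsometry.
Variables (A V : H -> H) (g : nat -> H) (eta : nat -> R).
Hypothesis cA : compact_op A.
Hypothesis pA : positive_op dot A.
Hypothesis eig : eigensystem dot A g eta.
Hypothesis bV : bounded_op V.
Hypothesis VV : adjoint dot V \o V = proj_on g.

Let lA : linear A := cA.1.1.
Let og : onz dot g. Proof. by case: eig => on *; exact: onb_onz. Qed.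

Local Notation adjV := (adjoint dot V).

Lemma conjugate_dot k : dot ((V \o A \o adjV) (e k)) (e k) = (quad dot A (adjV (e k)))%:C.
Proof. by rewrite /= (adjointP hdot he bV) (quadE pA). Qed.

(** A zero of the diagonal at [k] means [A (adjV (e k)) = 0]. If only finitely many entries were
    positive, [A = A \o adjV \o V] would have its range spanned by finitely many
    [A (adjV (e i))]. *)
Lemma conjugate_diagonal_infinite : ~ finite_rank A ->
  forall n, exists2 k, (n <= k)%N & 0 < quad dot A (adjV (e k)).
Proof.
move=> nfr n; apply: contrapT => ne; apply: nfr.
have AV0 k : (n <= k)%N -> A (adjV (e k)) = 0.
  move=> nk; apply: (quad_eq0 hdot cA pA); apply/eqP; rewrite eq_le (quad_ge0 pA) andbT leNgt.
  by apply/negP => lt; apply: ne; exists k.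
exists n, (fun i : 'I_n => A (adjV (e i))) => x.
exists (fun i : 'I_n => dot (V x) (e i)).
apply: (@dot_ext _ _ dot hdot) => y.
have [_ _ _ _ ker] := eig.
have -> : A x = A (adjV (V x)).
  have := congr1 (fun S => S x) VV => /= ->.
  apply/eqP; rewrite -subr_eq0 -(linB lA); apply/eqP/ker => k.
  by rewrite dotBl (proj_on_dot hdot og) subrr.
pose w := V (A y).
have we k : (n <= k)%N -> dot w (e k) = 0.
  by move=> nk; rewrite (adjointP hdot he bV) (self_adjoint lA pA) AV0// dot0r.
have : dot (V x - expansion e (V x) n) w = 0.
  apply: dot_disjoint => k; have [kn|/we ->] := ltnP k n; [left|by right].
  by rewrite dotBl (expansion_e he) kn subrr.
rewrite dotBl => /eqP; rewrite subr_eq0 => /eqP E.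
have -> : dot (A (adjV (V x))) y = dot (V x) w.
  by rewrite (self_adjoint lA pA) dotC -(adjointP hdot he bV) -dotC.
rewrite E /expansion big_mkord !dot_suml; apply: eq_bigr => k _; rewrite !dotZl; congr (_ * _).
by rewrite (self_adjoint lA pA) [RHS]dotC -(adjointP hdot he bV) -dotC.
Qed.

(** Conjugation by [V] loses no trace. The first [m] eigencomponents of [adjV (e k)] bound the
    diagonal entry from below by the sum of [eta n * |<V (g n), e k>| ^ 2]; summing over [k],
    Parseval and [|V (g n)| = 1] return the sum of the [eta n]. *)
Lemma conjugate_trace m (t : R) : 0 < t ->
  exists K, psum eta m <= psum (fun k => quad dot A (adjV (e k))) K + t.
Proof.
have [on Ag pos _ _] := eig; move=> t0.
pose c n k := sqd (V (g n)) (e k).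
have c0 n k : 0 <= c n k by exact: sqr_ge0.
have lower k : psum (fun n => eta n * c n k) m <= quad dot A (adjV (e k)).
  set x := adjV (e k); pose p := expansion g x m.
  have Ap : A p = \sum_(0 <= n < m) dot x (g n) *: ((eta n)%:C *: g n).
    by rewrite (lin_sum lA); apply: eq_bigr => n _; rewrite (linZ lA) Ag.
  have perp : dot (A p) (x - p) = 0.
    rewrite Ap dot_suml big_nat big1// => n /andP[_ nm].
    rewrite !dotZl (dot_eq0C (_ : dot (x - p) (g n) = 0)) ?mulr0//.
    by rewrite dotBl (expansion_dot og) nm subrr.
  have qp : quad dot A p = psum (fun n => eta n * c n k) m.
    apply: complexI; rewrite -(quadE pA) Ap dot_suml rmorph_sum /= !big_nat.
    apply: eq_bigr => n nm; rewrite !dotZl (dotC dot (g n)) (expansion_dot og).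
    rewrite (andP nm).2 mulrCA mul_conj -rcM; congr ((_ * _)%:C).
    by rewrite -sqdE sqdC /c !sqdE (adjointP hdot he bV).
  have : quad dot A (p + (x - p)) = quad dot A p + quad dot A (x - p).
    by have := quad_comb lA pA 1 1 perp; rewrite !scale1r expr1n !mul1r.
  by rewrite addrC subrK qp => ->; rewrite lerDl (quad_ge0 pA).
have nV n : nrm (V (g n)) = 1.
  apply: (nrm_dot1 hdot); rewrite (adjointP hdot he bV).
  have := congr1 (fun S => S (g n)) VV => /= ->.
  by rewrite (proj_on_fix hdot)// on// eqxx.
have upper m' (s : R) : 0 < s -> exists N, forall K, (N <= K)%N ->
    psum eta m' - s <= psum (fun n => eta n * psum (c n) K) m'.
  elim: m' s => [|m' IH] s s0; first by exists 0%N => K _; rewrite !psum0; lra.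
  have [|N1 N1P] := IH (s / 2); first by lra.
  have oe := onb_onz (onb_e he).
  have [|N2 N2P] := parseval_cvg hdot oe (V (g m')) (_ : 0 < s / 2 / eta m').
    by rewrite !divr_gt0.
  exists (maxn N1 N2) => K NK; rewrite !psumS.
  have := N1P K; have -> : (N1 <= K)%N by lia.
  move=> /(_ isT); have := N2P K; have -> : (N2 <= K)%N by lia.
  move=> /(_ isT); rewrite (proj_on_id hdot oe _ (total_e hdot he)) nV expr1n => h.
  have := ler_wpM2l (ltW (pos m')) h.
  by rewrite mulrBr mulr1 mulrC divfK ?gt_eqF//; rewrite -/(c m'); lra.
have [K KP] := upper m t t0; exists K; rewrite -lerBlDr.
apply: le_trans (KP K (leqnn K)) _.
have -> : psum (fun n => eta n * psum (c n) K) m =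
    psum (fun k => psum (fun n => eta n * c n k) m) K.
  rewrite /psum exchange_big_nat; apply: eq_bigr => n _ /=.
  by rewrite mulr_sumr.
by apply: ler_psum => k _; exact: lower.
Qed.

End PartialIsometry.

End Traces.

(** * Orthonormal bases with a prescribed diagonal *)

Section KernelSplitting.
Variable R : realType.

(** [al] assigns kernel vectors to zeros of the diagonal and [be] lists the [r] that are left over.
    If one set is infinite, so is the other, because [oo - p = oo]; a bijection then leaves nothing
    over. *)
Lemma split_kernel (Z D : pred nat) p :
  (ecount R Z - p%:R%:E <= ecount R D <= ecount R Z)%E ->
  exists r (al be : nat -> nat),
  [/\ (r <= p)%N,
      (forall k, D k -> Z (al k)) /\ (forall i, (i < r)%N -> Z (be i)),
      (forall k k', D k -> D k' -> al k = al k' -> k = k') /\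
        (forall i j, (i < r)%N -> (j < r)%N -> be i = be j -> i = j),
      forall k i, D k -> (i < r)%N -> al k != be i &
      forall j, Z j -> (exists2 k, D k & al k = j) \/ (exists2 i, (i < r)%N & be i = j)].
Proof.
move=> /andP[lo hi].
have [Zinf|[n nZ]] := infinite_or_bounded Z; have [Dinf|[m mD]] := infinite_or_bounded D.
- have [sZ [injZ ZZ surjZ]] := enumeration R Zinf.
  have [sD [injD DD surjD]] := enumeration R Dinf.
  have /choice[tau tauP] : forall k, exists j, D k -> sD j = k.
    by move=> k; have [/surjD[j E]|] := boolP (D k); [exists j | exists 0%N].
  exists 0%N, (sZ \o tau), id; split=> //.
  + by split=> // k _; exact: ZZ.
  + by split=> // k k' Dk Dk' /= /injZ E; rewrite -(tauP _ Dk) -(tauP _ Dk') E.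
  + move=> j /surjZ[i <-]; left; exists (sD i); first exact: DD.
    by rewrite /=; congr sZ; apply: injD; rewrite tauP.
- by move: lo; rewrite (ecount_infinite R Zinf) (ecount_finite R mD).
- by move: hi; rewrite (ecount_infinite R Dinf) (ecount_finite R nZ).
move: lo hi; rewrite (ecount_finite R nZ) (ecount_finite R mD).
rewrite -EFinB !lee_fin ler_nat lerBlDr -natrD ler_nat => lo hi.
pose lZ := [seq k <- iota 0 n | Z k]; pose lD := [seq k <- iota 0 m | D k].
have memZ j : (j \in lZ) = Z j.
  rewrite mem_filter mem_iota /= add0n; case: ltnP; rewrite ?andbT// => /nZ /negPf ->.
  by rewrite andbF.
have memD j : (j \in lD) = D j.
  rewrite mem_filter mem_iota /= add0n; case: ltnP; rewrite ?andbT// => /mD /negPf ->.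
  by rewrite andbF.
have uZ : uniq lZ by rewrite filter_uniq ?iota_uniq.
have sZ : size lZ = count Z (iota 0 n) by rewrite size_filter.
have sD : size lD = count D (iota 0 m) by rewrite size_filter.
rewrite -sZ -sD in lo hi.
have uD : uniq lD by rewrite filter_uniq ?iota_uniq.
clearbody lZ lD; clear sZ sD.
have ixD k : D k -> (index k lD < size lD)%N by rewrite -memD index_mem.
exists (size lZ - size lD)%N, (fun k => nth 0%N lZ (index k lD)),
  (fun i => nth 0%N lZ (size lD + i)).
have lt1 k : D k -> (index k lD < size lZ)%N by move=> /ixD; lia.
split.
- by lia.
- split=> [k Dk|i il]; rewrite -memZ mem_nth//; [exact: lt1 | by rewrite -ltn_subRL].
- split=> [k k' Dk Dk' E|i j il jl /eqP].
    have := nth_uniq 0%N (lt1 _ Dk) (lt1 _ Dk') uZ.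
    rewrite E eqxx => /esym/eqP E2.
    by rewrite -(nth_index 0%N (_ : k \in lD)) ?memD// E2 nth_index// memD.
  by rewrite nth_uniq -?ltn_subRL// eqn_add2l => /eqP.
- move=> k i Dk il; rewrite nth_uniq -?ltn_subRL//; last exact: lt1.
  by have := ixD _ Dk; lia.
- move=> j; rewrite -memZ => jZ.
  have [lt|le] := ltnP (index j lZ) (size lD).
    left; exists (nth 0%N lD (index j lZ)); first by rewrite -memD mem_nth.
    by rewrite index_uniq// nth_index.
  right; exists (index j lZ - size lD)%N.
    by apply: ltn_sub2r; rewrite ?index_mem//; apply: leq_ltn_trans le _; rewrite index_mem.
  by rewrite subnKC// nth_index.
Qed.

End KernelSplitting.

(** * Orthonormal systems whose partial traces exceed those of the eigenvectors *)

Section ExcessSystem.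
Variables (R : realType) (H : completeNormedModType R[i]).
Variable dot : {dot H for Num.conj}.
Hypothesis hdot : inner_product_norm dot.
Implicit Types (x y : H) (f g : nat -> H).

(* [f] is the Gram-Schmidt process applied to [z0 + l], [g 0], [g 1], etc, where
   [l] has a positive coefficient on every [g k]. With [w n] the component of
   [z0 + l] orthogonal to the first [n] vectors of [g], the spans of [f 0 .. f n]
   and of [g 0 .. g n.-1, w n] agree, whence the excess [quad (w n) / nrm (w n) ^+ 2]
   of the partial traces. *)
Lemma excess_system A g (eta : nat -> R) z0 : linear A -> positive_op dot A ->
  eigensystem dot A g eta -> dot z0 z0 = 1 -> (forall n, dot z0 (g n) = 0) ->
  exists f : nat -> H,
  [/\ orthonormal_on dot setT f, forall n, 0 < quad dot A (f n),
      forall n, psum eta n < psum (quad dot A \o f) n.+1,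
      forall y, dot z0 y = 0 -> (forall n, dot (g n) y = 0) -> forall n, dot (f n) y = 0 &
      forall x, (forall n, dot x (f n) = 0) -> dot x z0 = 0 /\ forall n, dot x (g n) = 0].
Proof.
move=> lA pA [on Ag pos _ _] zz zg; have og := onb_onz on.
(* Positive and square-summable coefficients, so that [l] exists and involves every [g k]. *)
pose c k : R := 2^-1 ^+ k.+1.
have c0 k : 0 < c k by rewrite exprn_gt0.
have c1 k : c k <= 1 by rewrite exprn_ile1//; lra.
have [l lP] : exists l : H, (fun n => \sum_(0 <= k < n) (c k)%:C *: g k) @ \oo --> l.
  apply: (@riesz_fischer _ _ dot hdot g og _ 1) => n.
  have : psum c n = 1 - 2^-1 ^+ n.
    elim: n => [|n IH]; first by rewrite psum0 expr0 subrr.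
    by rewrite psumS IH /c exprS; lra.
  have : psum (fun k => cabs (c k)%:C ^+ 2) n <= psum c n.
    apply: ler_psum => k _; rewrite cabs_real gtr0_norm// expr2.
    by rewrite -[X in _ <= X]mulr1 ler_pM2l.
  have : 0 <= (2^-1 : R) ^+ n by rewrite exprn_ge0.
  by lra.
have lg k : dot l (g k) = (c k)%:C.
  apply: (cvg_dotl hdot (N := k.+1) lP) => n kn.
  by rewrite (dot_comb og) /= kn (onb_neq0 _ on) mulr1.
have l0 y : (forall k, dot (g k) y = 0) -> dot l y = 0.
  move=> gy; apply: (cvg_dotl hdot (N := 0) lP) => n _.
  by rewrite dot_suml big1// => k _; rewrite dotZl gy mulr0.
pose w0 := z0 + l.
have w0g k : dot w0 (g k) = (c k)%:C by rewrite dotDl zg lg add0r.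
pose w n := w0 - expansion dot g w0 n.
have wS n : w n = w n.+1 + (c n)%:C *: g n.
  by rewrite /w /expansion big_nat_recr//= w0g opprD addrA addrNK.
have wg n k : (k < n)%N -> dot (w n) (g k) = 0.
  by move=> kn; rewrite dotBl (expansion_dot og) kn subrr.
have gz n : dot (g n) z0 = 0 by apply: dot_eq0C.
have wz n : dot (w n) z0 = 1.
  rewrite /w /w0 dotBl dotDl zz (l0 _ gz) /expansion dot_suml big1 ?addr0 ?subr0// => k _.
  by rewrite dotZl gz mulr0.
pose t n := nrm (w n) ^+ 2.
have t0 n : 0 < t n.
  rewrite lt_def sqr_ge0 andbT; apply/eqP => /nrm_sqr_eq0 w0'.
  by have := wz n; rewrite w0' dot0l => /eqP; rewrite eq_sym oner_eq0.
have gg n : dot (g n) (g n) = 1 by rewrite on// eqxx.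
have ww n : dot (w n) (w n) = (t n)%:C by rewrite (dotE hdot).
have gw n : dot (g n) (w n.+1) = 0 by apply/dot_eq0C/wg.
have tS n : t n = t n.+1 + c n ^+ 2.
  rewrite /t {1}wS (pythagoras hdot) ?dotZr ?wg ?mulr0//; congr (_ + _).
  by rewrite nrmZ cabs_real gtr0_norm// (nrm_dot1 hdot (gg n)) mulr1.
pose q n := quad dot A (w n).
have Agw n : dot (A (g n)) (w n.+1) = 0 by rewrite Ag dotZl gw mulr0.
have qg n : quad dot A (g n) = eta n.
  by apply: complexI; rewrite -(quadE pA) Ag dotZl gg mulr1.
have qS n : q n = q n.+1 + c n ^+ 2 * eta n.
  rewrite /q wS -[w n.+1 in LHS]scale1r -[1]/(1%:C) (quad_comb lA pA); last first.
    exact: (Aorth_sym lA pA).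
  by rewrite expr1n mul1r qg.
have q0 n : 0 < q n.
  by rewrite qS ltr_wpDl ?(quad_ge0 pA)// mulr_gt0// exprn_gt0.
pose d n := (Num.sqrt (t n.+1 * t n))^-1.
have dd n : d n ^+ 2 = (t n.+1 * t n)^-1.
  by rewrite exprVn sqr_sqrtr// mulr_ge0// ltW.
(* The combination of [g n] and [w n.+1] orthogonal to [w n], which equals [w n.+1 + c n g n]. Its
   squared norm is [t n.+1 * t n], whence the factor [d n]. *)
pose v n := (t n.+1)%:C *: g n + (- c n)%:C *: w n.+1.
pose f n := if n is m.+1 then (d m)%:C *: v m else ((Num.sqrt (t 0%N))^-1)%:C *: w 0%N.
have vw n : dot (v n) (w n) = 0.
  rewrite (wS n) dotDr dotZr conj_rc !dotDl !dotZl ww gg gw (wg n.+1 n)// rcN.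
  by ring.
have vg n k : (k < n)%N -> dot (v n) (g k) = 0.
  move=> kn; rewrite dotDl !dotZl wg ?mulr0 ?addr0; last exact: leqW.
  have nk : (n == k) = false by lia.
  by rewrite on// nk mulr0.
have vwm n m : (m <= n)%N -> dot (v n) (w m) = 0.
  move=> mn; rewrite -(subKn mn); move: (n - m)%N (leq_subr m n) => i.
  elim: i => [|i IH] i_n; first by rewrite subn0.
  have E : (n - i = (n - i.+1).+1)%N by lia.
  by rewrite wS dotDr dotZr -E IH ?(ltnW i_n)// vg ?mulr0 ?addr0//; lia.
have vv n : dot (v n) (v n) = (t n.+1 * t n)%:C.
  rewrite !dotDl !dotDr !dotZl !dotZr !conj_rc gg gw wg// ww (tS n) rcN.
  by rewrite rcM rcD (rcX (c n)); ring.
have norm1 (a : R) y : dot y y = a%:C -> 0 < a ->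
    dot (((Num.sqrt a)^-1)%:C *: y) (((Num.sqrt a)^-1)%:C *: y) = 1.
  move=> ya a0; rewrite dotZl dotZr conj_rc ya -!rcM mulrA -expr2 exprVn.
  by rewrite sqr_sqrtr ?(ltW a0)// mulVf// gt_eqF.
have ff n : dot (f n) (f n) = 1.
  case: n => [|n]; first exact: (norm1 (t 0%N)).
  by apply: (norm1 (t n.+1 * t n)); [exact: vv | exact: mulr_gt0].
have vf n m : (m <= n)%N -> dot (v n) (f m) = 0.
  case: m => [|m] mn /=; first by rewrite dotZr vwm// mulr0.
  by rewrite dotZr dotDr !dotZr vwm// vg// !mulr0 addr0 mulr0.
have fE n : f n.+1 = (d n)%:C *: v n by [].
have qf n : quad dot A (f n.+1) = (t n.+1 ^+ 2 * eta n + c n ^+ 2 * q n.+1) / (t n.+1 * t n).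
  apply: complexI; rewrite -(quadE pA) fE (linZ lA) dotZl dotZr conj_rc (quadE pA).
  rewrite (quad_comb lA pA) ?Agw// qg sqrrN -/(q _) -!rcM; congr (_%:C).
  by rewrite mulrA -expr2 dd mulrC.
have qf0 : quad dot A (f 0%N) = q 0%N / t 0%N.
  apply: complexI; rewrite -(quadE pA) /f (linZ lA) dotZl dotZr conj_rc (quadE pA).
  rewrite -!rcM; congr (_%:C); rewrite mulrA -expr2 exprVn sqr_sqrtr ?(ltW (t0 _))//.
  by rewrite mulrC.
exists f; split.
- move=> i j _ _; case: (ltngtP i j) => [ij|ji|->]; last by rewrite ff.
    by case: j ij => // j ij; apply: dot_eq0C; rewrite fE dotZl vf// mulr0.
  by case: i ji => // i ji; rewrite fE dotZl vf// mulr0.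
- case=> [|n]; first by rewrite qf0 divr_gt0.
  rewrite qf; apply: divr_gt0; last exact: mulr_gt0.
  apply: ltr_wpDr; first by rewrite mulr_ge0 ?sqr_ge0// ltW.
  by rewrite mulr_gt0// exprn_gt0.
- have trace n : psum (quad dot A \o f) n.+1 = psum eta n + q n / t n.
    elim: n => [|n IH]; first by rewrite psumS !psum0 /= qf0.
    rewrite psumS IH psumS [in LHS]/= qf (qS n).
    have tn0 : t n != 0 by rewrite gt_eqF.
    have tn10 : t n.+1 != 0 by rewrite gt_eqF.
    rewrite (tS n) in tn0 *.
    have key (a b T' C E : R) : T' != 0 -> T' + C != 0 ->
        a + (b + C * E) / (T' + C) + (T' ^+ 2 * E + C * b) / (T' * (T' + C)) = a + E + b / T'.
      by move=> h1 h2; field; rewrite h1 h2.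
    exact: key.
  by move=> n; rewrite trace ltrDl divr_gt0.
- move=> y zy gy.
  have wy n : dot (w n) y = 0.
    rewrite dotBl dotDl zy l0// addr0 dot_suml big1 ?subr0// => k _.
    by rewrite dotZl gy mulr0.
  case=> [|n]; first by rewrite dotZl wy mulr0.
  by rewrite fE dotZl dotDl !dotZl gy wy !mulr0 addr0 mulr0.
- move=> x xf.
  have xv n : dot x (v n) = 0.
    have := xf n.+1; rewrite fE dotZr conj_rc => /eqP; rewrite mulf_eq0 => /orP[|/eqP//].
    rewrite -[0]/(0%:C) (inj_eq (@complexI R)) invr_eq0 sqrtr_eq0.
    by rewrite leNgt mulr_gt0.
  have xw0 : dot x (w 0%N) = 0.
    have := xf 0%N; rewrite dotZr conj_rc => /eqP; rewrite mulf_eq0 => /orP[|/eqP//].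
    by rewrite -[0]/(0%:C) (inj_eq (@complexI R)) invr_eq0 sqrtr_eq0 leNgt t0.
  have xw n : dot x (w n) = 0 /\ dot x (g n) = 0.
    have step m : dot x (w m) = 0 -> dot x (g m) = 0.
      (* Inverting the passage from [g m], [w m.+1] to [w m], [v m] recovers the eigenvectors one at
         a time from [w 0] and the [v m]. *)
      move=> xwm; have E : (t m)%:C *: g m = (c m)%:C *: w m + v m.
        rewrite (wS m) /v scalerDr scalerA rcN scaleNr.
        rewrite [_ - _ *: _]addrC addrACA subrr add0r -scalerDl; congr (_ *: _).
        by rewrite (tS m) rcD (rcX (c m)); ring.
      have : (t m)%:C * dot x (g m) = 0.
        have <- : dot x ((t m)%:C *: g m) = (t m)%:C * dot x (g m) by rewrite dotZr conj_rc.
        by rewrite E dotDr dotZr xwm xv mulr0 addr0.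
      move=> /eqP; rewrite mulf_eq0 => /orP[|/eqP//].
      by rewrite -[0]/(0%:C) (inj_eq (@complexI R)) gt_eqF.
    elim: n => [|n [IHw IHg]]; first by split=> //; exact: step.
    have xwS : dot x (w n.+1) = 0.
      by move: IHw; rewrite (wS n) dotDr dotZr IHg mulr0 addr0.
    by split=> //; exact: step.
  have xg n : dot x (g n) = 0 by have [] := xw n.
  split=> //.
  have : dot x w0 = 0 by have [+ _] := xw 0%N; rewrite /w /expansion big_geq// subr0.
  rewrite dotDr (dot_eq0C (l0 x _)) ?addr0// => k.
  exact/dot_eq0C/xg.
Qed.

End ExcessSystem.

(** * A basis realizing a given diagonal *)

Section Orbits.
Variables (R : realType) (H : completeNormedModType R[i]).
Variable dot : {dot H for Num.conj}.
Hypothesis hdot : inner_product_norm dot.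
Variable e : nat -> H.
Hypothesis he : orthonormal_basis dot e.
Variable A : H -> H.
Hypothesis hA : compact_positive dot A.
Hypothesis hrank : ~ finite_rank A.
Implicit Types (x y : H) (B : H -> H).

Let cA : compact_op A := hA.1.
Let pA : positive_op dot A := hA.2.
Let bA : bounded_op A := cA.1.
Let lA : linear A := bA.1.

Local Notation quadA := (quad dot A).

Variables (g : nat -> H) (eta : nat -> R) (z : nat -> H).
Hypothesis eig : eigensystem dot A g eta.
Hypothesis oz : onz dot z.
Hypothesis zg : forall k n, dot (z k) (g n) = 0.
Hypothesis gz_total : forall x,
  (forall n, dot x (g n) = 0) -> (forall k, dot x (z k) = 0) -> x = 0.

Let on : orthonormal_on dot setT g. Proof. by case: eig. Qed.
Let Ag n : A (g n) = (eta n)%:C *: g n. Proof. by case: eig. Qed.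
Let pos n : 0 < eta n. Proof. by case: eig. Qed.
Let gz k n : dot (g n) (z k) = 0. Proof. exact/dot_eq0C/zg. Qed.
Let Az k : A (z k) = 0. Proof. by case: eig => _ _ _ _; apply => n; exact: zg. Qed.

(** Collects what orbit membership contributes: infinitely many positive diagonal entries, hence an
    infinite decreasing enumeration [s], and a diagonal sum not below that of the eigenvalues. *)
Lemma diagonal_of_partial_isometry_orbit B :
  (diagonal_part dot e @` partial_isometry_orbit dot A) B ->
  diagonal_ops dot e B -> compact_positive dot B ->
  exists s : nat -> nat,
  [/\ injective s, eigensystem dot B (e \o s) (quad dot B \o e \o s),
      forall k, 0 < quad dot B (e k) -> exists n, s n = k, vanishing (quad dot B \o e) &
      forall m (t : R), 0 < t ->
        exists K, psum eta m <= psum (quad dot B \o e) K + t].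
Proof.
move=> [_ [V [[bV _] VV] <-] EB] dB [cB pB].
have {}VV : adjoint dot V \o V = proj_on dot g.
  rewrite VV (positive_adjoint hdot bA pA) (range_projE hdot bA pA eig).
  exact/proj_join_proj/onb_onz.
have bE k : quad dot B (e k) = quadA (adjoint dot V (e k)).
  apply: complexI; rewrite -(quadE pB) -EB (diagonal_part_dot he).
  by rewrite (conjugate_dot hdot he pA bV).
have [|s [sinj eigB ssurj van]] := diagonal_eigensystem hdot he dB cB pB.
  move=> n; have [k nk kp] := conjugate_diagonal_infinite hdot he cA pA eig bV VV hrank n.
  by exists k; rewrite ?bE.
exists s; split=> // m t t0.
have [K KP] := conjugate_trace hdot he cA pA eig bV VV m t0.
by exists K; apply: le_trans KP _; rewrite (eq_psum (y := quad dot B \o e))// => k _; rewrite -bE.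
Qed.

(** Zero entries contribute nothing, and the positive ones occupy distinct places in the decreasing
    enumeration. *)
Lemma sum_diagonal_le (b : nat -> R) (s : nat -> nat) (l : seq nat) :
  (forall k, 0 <= b k) -> (forall k, 0 < b k -> exists n, s n = k) ->
  (forall n m, (n <= m)%N -> b (s m) <= b (s n)) -> uniq l ->
  \sum_(k <- l) b k <= psum (b \o s) (size l).
Proof.
move=> b0 ssurj sdec ul.
have /choice[tau tauP] : forall k, exists n, 0 < b k -> s n = k.
  by move=> k; have [/ssurj[n E]|_] := ltP 0 (b k); [exists n | exists 0%N].
pose l' := [seq tau k | k <- l & 0 < b k].
have -> : \sum_(k <- l) b k = \sum_(n <- l') (b \o s) n.
  rewrite big_map big_filter [LHS](bigID (fun k => 0 < b k))/= addrC big1 ?add0r.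
    by apply: eq_bigr => k kp; rewrite tauP.
  by move=> k; rewrite -leNgt => le; apply: le_anti; rewrite le b0.
apply: le_trans (sum_uniq_le_psum _ _) _ => //.
  rewrite map_inj_in_uniq ?filter_uniq// => k k'; rewrite !mem_filter.
  by move=> /andP[kp _] /andP[kp' _] E; rewrite -(tauP _ kp) -(tauP _ kp') E.
apply: psum_homo => [k|]; first exact: b0.
by rewrite size_map size_filter count_size.
Qed.

(* The [r] kernel vectors that must contribute to the diagonal are inserted
   after the first [N] eigenvectors, which the [r]-majorization permits. *)
Lemma basis_with_diagonal (b : nat -> R) (s : nat -> nat) p :
  (forall k, 0 <= b k) -> vanishing b -> injective s ->
  (forall n, 0 < b (s n)) -> (forall n m, (n <= m)%N -> b (s m) <= b (s n)) ->
  (forall k, 0 < b k -> exists n, s n = k) ->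
  (forall m (t : R), 0 < t -> exists K, psum eta m <= psum b K + t) ->
  p_majorized p (b \o s) eta ->
  (ecount R (fun k => z k != 0%R) - p%:R%:E <= ecount R (fun k => b k == 0%R)
     <= ecount R (fun k => z k != 0%R))%E ->
  exists F : nat -> H, [/\ orthonormal_on dot setT F, total_system dot F & forall k, quadA (F k) = b k].
Proof.
move=> b0 bv sinj sp sdec ssurj tr [maj [N majN]] cnt.
have {}maj n : psum (b \o s) n <= psum eta n by exact: maj.
have {}majN n : (N <= n)%N -> psum (b \o s) (n + p) <= psum eta n by exact: majN.
have [r [al [be [rp [alZ beZ] [alinj beinj] albe cover]]]] := split_kernel cnt.
pose xi := b \o s; have xi0 n : 0 <= xi n by exact: b0.
pose v i := if (i < N)%N then g i else if (i < N + r)%N then z (be (i - N)%N) else g (i - r)%N.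
have zz k : z k != 0 -> dot (z k) (z k) = 1 by move=> zk; rewrite oz eqxx zk.
have qg n : quadA (g n) = eta n.
  by apply: complexI; rewrite -(quadE pA) Ag dotZl on// eqxx mulr1.
have qz k : quadA (z k) = 0 by rewrite /quad Az dot0l.
have onv : orthonormal_on dot setT v.
  move=> i j _ _; rewrite /v.
  case: (ltnP i N) => iN; case: (ltnP j N) => jN; rewrite ?on//;
    case: (ltnP i (N + r)) => ir; case: (ltnP j (N + r)) => jr; rewrite ?on ?zg ?gz//;
    try (by congr (_%:R); congr nat_of_bool; lia);
    try (by have -> : (i == j) = false by lia).
  have ir' : (i - N < r)%N by lia.
  have jr' : (j - N < r)%N by lia.
  have [->|ij] := eqVneq i j; first by rewrite zz// beZ.
  rewrite oz; case: eqP => //= E; have := beinj _ _ ir' jr' E.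
  by move: ij; lia.
have Av i : A (v i) = (quadA (v i))%:C *: v i.
  by rewrite /v; do ?case: ifP => _; rewrite ?qg ?qz ?Ag ?Az ?scale0r.
have pv1 n : (n <= N)%N -> psum (quadA \o v) n = psum eta n.
  by move=> nN; apply: eq_psum => i iN; rewrite /= /v ifT ?qg//; lia.
have pv2 n : (n <= r)%N -> psum (quadA \o v) (N + n) = psum eta N.
  elim: n => [|n IH] nr; first by rewrite addn0 pv1.
  rewrite addnS psumS IH ?(ltnW nr)//= /v ifF; last lia.
  by rewrite ifT ?qz ?addr0//; lia.
have pv3 n : psum (quadA \o v) (N + r + n) = psum eta (N + n).
  elim: n => [|n IH]; first by rewrite !addn0 pv2.
  rewrite !addnS !psumS IH /= /v ifF; last lia.
  by rewrite ifF; [rewrite qg; congr (_ + eta _); lia | lia].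
have etav : vanishing eta.
  by apply: (eigenvalues_vanish hdot cA on Ag) => n; exact: ltW.
have adm : admissible dot A xi v.
  split.
  - split=> // i j _ _ ij; rewrite Av dotZl onv//.
    have /negPf ij' : i != j by apply/eqP.
    by rewrite ij' mulr0.
  - move=> t t0; have [M MP] := etav t t0; exists (N + r + M)%N => n Mn /=.
    by rewrite /v ifF; [rewrite ifF; [rewrite qg MP//; lia | lia] | lia].
  - move=> n; have [nN|Nn] := leqP n N; first by rewrite pv1//; exact: maj.
    have [nr|rn] := leqP n (N + r).
      rewrite -(subnKC (ltnW Nn)) pv2; last lia.
      by apply: le_trans (majN N (leqnn N)); apply: psum_homo => //; lia.
    rewrite -(subnKC (ltnW rn)) pv3.
    apply: le_trans (majN (N + (n - (N + r)))%N (leq_addr _ _)).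
    by apply: psum_homo => //; lia.
  - have [U|nU] := pselect (forall c : R, exists n, c < psum xi n); [by left | right].
    have [c cP] : exists c : R, forall n, psum xi n <= c.
      apply: contrapT => nc; apply: nU => c; apply: contrapT => nn; apply: nc.
      by exists c => n; rewrite leNgt; apply/negP => lt; apply: nn; exists n.
    move=> t M t0.
    (* Beyond [n1] the sums of [xi] grow by at most [t / 2], and the trace inequality costs another
       [t / 2]; so the excess at [N + r + l] is at most [t]. *)
    have [||n1 _ n1P] := @almost_minimal_tail R (fun n => c - psum xi n) (t / 2) 0.
    + by move=> n; rewrite subr_ge0.
    + by lra.
    pose l := (M + n1)%N; exists (N + r + l)%N; first by rewrite /l; lia.
    have [|K KP] := tr (N + l)%N (t / 2); first by lra.
    have h1 : psum b K <= psum xi K.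
      have := sum_diagonal_le b0 ssurj sdec (iota_uniq 0 K).
      by rewrite size_iota /psum /index_iota subn0.
    have h2 : psum xi K <= psum xi (maxn K n1) by apply: psum_homo => //; exact: leq_maxl.
    have h3 : psum xi n1 <= psum xi (N + r + l) by apply: psum_homo => //; rewrite /l; lia.
    have := n1P _ (leq_maxr K n1); rewrite pv3; lra.
have [||f [onf qf spf totf]] := complete_schur_horn (M := (N + r)%N) hdot lA pA sp sdec _ adm _.
(* If all [xi n] exceeded [t], the injection [s] would take all its values below [M]. *)
- move=> t t0; have [M MP] := bv t t0.
  apply: contrapT => nex.
  have big n : t < xi n.
    rewrite ltNge; apply/negP => le; apply: nex; exists n => m nm.
    exact: le_trans (sdec _ _ nm) le.
  have lt n : (s n < M)%N.
    by rewrite ltnNge; apply/negP => /MP; have := big n; rewrite /xi /=; lra.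
  have /leq_card : injective (fun i : 'I_M.+1 => Ordinal (lt i)).
    by move=> i j [] /sinj/val_inj.
  by rewrite !card_ord ltnn.
- by move=> i iM; rewrite /v ifF; [rewrite ifF; [rewrite qg | lia] | lia].
have /choice[tau tauP] : forall k, exists n, 0 < b k -> s n = k.
  by move=> k; have [/ssurj[n E]|_] := ltP 0 (b k); [exists n | exists 0%N].
have bp k : b k != 0 -> 0 < b k by move=> bk; rewrite lt_def bk b0.
pose F k := if b k == 0 then z (al k) else f (tau k).
have fz k i : b k == 0 -> dot (f i) (z (al k)) = 0.
  move=> bk; apply: (lspan_dot _ (spf i)) => _ [j _ <-]; rewrite /v.
  case: ifP => jN; first exact: gz.
  case: ifP => jr; last exact: gz.
  have jr' : (j - N < r)%N by lia.
  rewrite oz; case: eqP => //= E; have := albe k _ bk jr'.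
  by rewrite E eqxx.
exists F; split.
- move=> i j _ _; rewrite /F; case: ifP => bi; case: ifP => bj.
  + have [->|ij] := eqVneq i j; first by rewrite zz// alZ.
    rewrite oz; case: eqP => //= E; have := alinj _ _ bi bj E.
    by move/eqP: ij.
  + rewrite (dot_eq0C (fz _ _ bi)); case: eqP => // E.
    by move: bi; rewrite E bj.
  + by rewrite fz//; case: eqP => // E; move: bj; rewrite -E bi.
  + rewrite onf//; congr (_%:R); congr nat_of_bool.
    apply/eqP/eqP => [E|-> //].
    have Ei : s (tau i) = i by apply: tauP; rewrite bp ?bi.
    have Ej : s (tau j) = j by apply: tauP; rewrite bp ?bj.
    by rewrite -Ei E.
- move=> x xF.
  have xf n : dot (f n) x = 0.
    have := xF (s n); rewrite /F gt_eqF// => /dot_eq0C.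
    by have -> : tau (s n) = n by apply: sinj; exact: tauP.
  have xv := totf x xf.
  have xg n : dot x (g n) = 0.
    apply: dot_eq0C; have [nN|Nn] := ltnP n N; first by have := xv n; rewrite /v nN.
    by have := xv (n + r)%N; rewrite /v ifF; [rewrite ifF; [rewrite addnK | lia] | lia].
  apply: gz_total => // j; have [->|zj] := eqVneq (z j) 0; first by rewrite dot0r.
  have [[k bk <-]|[i ir <-]] := cover j zj.
    by have := xF k; rewrite /F bk.
  apply: dot_eq0C; have := xv (N + i)%N; rewrite /v ifF; last lia.
  by rewrite ifT; [rewrite addKn | lia].
- move=> k; rewrite /F; case: eqP => [->|/eqP bk]; first by rewrite qz.
  by rewrite qf /= tauP// bp.
Qed.

End Orbits.

(** * Bases whose diagonals violate the conditions *)

Section ProperInclusion.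
Variables (R : realType) (H : completeNormedModType R[i]).
Variable dot : {dot H for Num.conj}.
Hypothesis hdot : inner_product_norm dot.
Variable A : H -> H.
Hypothesis lA : linear A.
Hypothesis pA : positive_op dot A.
Implicit Types (x y : H).

Local Notation quadA := (quad dot A).

Variables (g : nat -> H) (eta : nat -> R) (z : nat -> H).
Hypothesis eig : eigensystem dot A g eta.
Hypothesis oz : onz dot z.
Hypothesis zg : forall k n, dot (z k) (g n) = 0.
Hypothesis gz_total : forall x,
  (forall n, dot x (g n) = 0) -> (forall k, dot x (z k) = 0) -> x = 0.

Let on : orthonormal_on dot setT g. Proof. by case: eig. Qed.
Let Ag n : A (g n) = (eta n)%:C *: g n. Proof. by case: eig. Qed.
Let pos n : 0 < eta n. Proof. by case: eig. Qed.
Let gz k n : dot (g n) (z k) = 0. Proof. exact/dot_eq0C/zg. Qed.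
Let Az k : A (z k) = 0. Proof. by case: eig => _ _ _ _; apply => n; exact: zg. Qed.
Let qg n : quadA (g n) = eta n.
Proof. by apply: complexI; rewrite -(quadE pA) Ag dotZl on// eqxx mulr1. Qed.
Let qz k : quadA (z k) = 0. Proof. by rewrite /quad Az dot0l. Qed.
Let zz k : z k != 0 -> dot (z k) (z k) = 1.
Proof. by move=> zk; rewrite oz eqxx zk. Qed.

(* Each kernel vector is mixed with an eigenvector. *)
Lemma positive_basis : (forall n, exists2 k, (n <= k)%N & z k != 0) ->
  exists F : nat -> H, [/\ orthonormal_on dot setT F, total_system dot F & forall k, 0 < quadA (F k)].
Proof.
move=> inf; have [s [sinj sz ssurj]] := enumeration R inf.
have zs n m : dot (z (s n)) (z (s m)) = (n == m)%:R.
  by rewrite oz sz andbT (inj_eq sinj).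
(* Mixing in equal parts gives both new vectors the value [eta n / 2]. *)
have half : 0 <= (2^-1 : R) <= 1 by apply/andP; split; lra.
have /choice[w /choice[y wy]] : forall n, exists w y,
  [/\ [/\ dot w w = 1, dot y y = 1 & dot w y = 0],
    0 < quadA w, 0 < quadA y,
    lspan [set g n; z (s n)] w /\ lspan [set g n; z (s n)] y &
    lspan [set w; y] (g n) /\ lspan [set w; y] (z (s n))].
  move=> n; have [||||w [y [h1 qw qy h2 h3]]] := rotation lA pA half (u := g n) (v := z (s n)).
  - by rewrite on// eqxx.
  - by rewrite zs eqxx.
  - exact: gz.
  - by rewrite Ag dotZl gz mulr0.
  have p := pos n; exists w, y; split=> //.
    by rewrite qw qg qz mulr0 addr0 mulr_gt0//; lra.
  by rewrite qy qg qz mulr0 addr0 mulr_gt0//; lra.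
have perp n m : n != m -> forall u v, lspan [set g n; z (s n)] u ->
    lspan [set g m; z (s m)] v -> dot u v = 0.
  move=> nm u v un vm; apply: (lspan_dot _ un) => _ [->|->]; apply: dot_eq0C;
    apply: (lspan_dot _ vm) => _ [->|->].
  - by rewrite on// eq_sym (negPf nm).
  - exact: zg.
  - exact: gz.
  - by rewrite zs eq_sym (negPf nm).
(* The pairs are interleaved by parity, so distinct halves belong to orthogonal planes. *)
pose F k := if odd k then y k./2 else w k./2.
have Fs k : lspan [set g k./2; z (s k./2)] (F k).
  by rewrite /F; have [_ _ _ [? ?] _] := wy k./2; case: (odd k).
exists F; split.
- move=> i j _ _; have [E|ne] := eqVneq i./2 j./2; last first.
    rewrite (perp _ _ ne _ _ (Fs i) (Fs j)); case: eqP => // E.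
    by move: ne; rewrite E eqxx.
  have [[ww yy wy0] _ _ _ _] := wy j./2.
  have -> : (i == j) = (odd i == odd j).
    apply/eqP/eqP => [->//|E2]; rewrite -(odd_double_half i) -(odd_double_half j).
    by rewrite E E2.
  by rewrite /F E; case: (odd i); case: (odd j); rewrite ?ww ?yy ?wy0 ?(dot_eq0C wy0).
- move=> x xF.
  have xw n : dot (w n) x = 0.
    by have := xF n.*2; rewrite /F odd_double doubleK => /dot_eq0C.
  have xy n : dot (y n) x = 0.
    by have := xF n.*2.+1; rewrite /F /= odd_double /= uphalf_double => /dot_eq0C.
  have xs n v : lspan [set w n; y n] v -> dot x v = 0.
    by move=> vs; apply: dot_eq0C; apply: (lspan_dot _ vs) => _ [->|->].
  apply: gz_total => [n|k].
    by have [_ _ _ _ [+ _]] := wy n; exact: xs.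
  have [->|/ssurj[n <-]] := eqVneq (z k) 0; first by rewrite dot0r.
  by have [_ _ _ _ [_]] := wy n; exact: xs.
- by move=> k; rewrite /F; have [_ ? ? _ _] := wy k./2; case: (odd k).
Qed.

(* All kernel vectors but one are themselves basis vectors. *)
Lemma excess_basis n j0 : (forall k, (n <= k)%N -> ~~ (z k != 0)) -> z j0 != 0 ->
  exists c (F : nat -> H),
  [/\ count (fun k => z k != 0) (iota 0 n) = c.+1,
      orthonormal_on dot setT F, total_system dot F,
      (forall k, (k < c)%N -> quadA (F k) = 0) /\ (forall k, (c <= k)%N -> 0 < quadA (F k)) &
      forall m, psum eta m < psum (fun i => quadA (F (c + i)%N)) m.+1].
Proof.
move=> nz zj0; pose l := [seq k <- iota 0 n | z k != 0].
have meml j : (j \in l) = (z j != 0).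
  rewrite mem_filter mem_iota /= add0n; case: ltnP => h; rewrite ?andbT ?andbF//.
  by have := nz _ h => /negPf ->.
have ul : uniq l by rewrite filter_uniq ?iota_uniq.
have sl : size l = count (fun k => z k != 0) (iota 0 n) by rewrite size_filter.
case El : l meml ul sl => [|k0 l'] meml ul sl.
  by have := meml j0; rewrite in_nil zj0.
have zk0 : z k0 != 0 by rewrite -meml mem_head.
have [f [onf pf ef pyf tf]] := excess_system hdot lA pA eig (zz zk0) (zg k0).
pose c := size l'; pose F k := if (k < c)%N then z (nth 0%N l' k) else f (k - c)%N.
have zl k : (k < c)%N -> z (nth 0%N l' k) != 0.
  by move=> kc; rewrite -meml inE mem_nth ?orbT.
have k0l : k0 \notin l' by case/andP: ul.
have fz k i : (k < c)%N -> dot (f i) (z (nth 0%N l' k)) = 0.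
  move=> kc; apply: pyf => [|m]; last exact: gz.
  rewrite oz; case: eqP => //= E; move: k0l; rewrite E mem_nth//.
exists c, F; split.
- by rewrite -sl.
- move=> i j _ _; rewrite /F; case: (ltnP i c) => ic; case: (ltnP j c) => jc.
  + rewrite oz zl// andbT nth_uniq//; by case/andP: ul.
  + by rewrite (dot_eq0C (fz _ _ ic)); have -> : (i == j) = false by lia.
  + by rewrite fz//; have -> : (i == j) = false by lia.
  + by rewrite onf//; congr (_%:R); congr nat_of_bool; lia.
- move=> x xF.
  have [|x0 xg] := tf x.
    by move=> i; have := xF (c + i)%N; rewrite /F ifF; [rewrite addKn | lia].
  apply: gz_total => // k; have [->|] := eqVneq (z k) 0; first by rewrite dot0r.
  rewrite -meml inE => /orP[/eqP->//|kl'].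
  by have := xF (index k l'); rewrite /F index_mem kl' nth_index.
- split=> k kc; rewrite /F; first by rewrite kc qz.
  by rewrite ltnNge kc /=; exact: pf.
- move=> m; have := ef m; congr (_ < _); apply: eq_psum => i _.
  by rewrite /= /F ifF; [rewrite addKn | lia].
Qed.

End ProperInclusion.

Theorem proposition6p10 (R : realType) (H : completeNormedModType R[i])
    (dot : {dot H for Num.conj}) (hdot : inner_product_norm dot)
    (e : nat -> H) (he : orthonormal_basis dot e)
    (A : H -> H) (hA : compact_positive dot A) (hrank : ~ finite_rank A) :
  let E := diagonal_part dot e in
  let Tr := trace_op dot e in
  let s := singular_numbers dot in
  let nullA := Tr (corange_proj dot A) in
  let S :=
    \bigcup_(p in [set p : nat | (p%:R%:E <= nullA)%E])
      (E @` partial_isometry_orbit dot A `&`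
       [set B | (diagonal_ops dot e `&` compact_positive dot) B /\
                p_majorized p (s B) (s A) /\
                (nullA - p%:R%:E <= Tr (corange_proj dot B) <= nullA)%E]) in
  S `<=` E @` unitary_orbit dot A /\
  (range_proj dot A <> id -> S `<` E @` unitary_orbit dot A).
Proof.
move=> E Tr s nullA S.
have [cA pA] := hA; have bA := cA.1; have lA := bA.1.
have [g [eta [on Ag pos dec ker]]] := spectral_sequence hdot cA pA hrank.
have eig : eigensystem dot A g eta by [].
have [z [oz zg gzt]] := kernel_family hdot he on.
have sA : s A = eta by exact: (singular_numbersE hdot cA pA eig).
have nullE : nullA = ecount R (fun k => z k != 0).
  exact: (trace_kernel hdot he bA pA eig oz zg gzt).
have conj_orbit F : orthonormal_on dot setT F -> total_system dot F -> exists T,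
    unitary_orbit dot A T /\ forall k, dot (T (e k)) (e k) = (quad dot A (F k))%:C.
  move=> onF totF; have [U uU UF] := unitary_of_bases hdot he onF totF.
  exists (U \o A \o adjoint dot U); split; first by exists U.
  by move=> k; have [bU _ _] := uU; rewrite (conjugate_dot hdot he pA bU) UF.
have data p B : (E @` partial_isometry_orbit dot A) B -> diagonal_ops dot e B ->
    compact_positive dot B -> p_majorized p (s B) (s A) ->
    (nullA - p%:R%:E <= Tr (corange_proj dot B) <= nullA)%E ->
    exists t : nat -> nat, let b := quad dot B \o e in
    [/\ injective t, (forall n, 0 < b (t n)) /\ (forall k, 0 < b k -> exists n, t n = k),
      vanishing b /\ (forall n m, (n <= m)%N -> b (t m) <= b (t n)),
      (forall m (x : R), 0 < x -> exists K, psum eta m <= psum b K + x) /\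
        p_majorized p (b \o t) eta &
      (ecount R (fun k => z k != 0%R) - p%:R%:E <= ecount R (fun k => b k == 0%R)
        <= ecount R (fun k => z k != 0%R))%E].
  move=> BV dB [cB pB] maj tr.
  have [t [tinj eigB tsurj van trb]] :=
    diagonal_of_partial_isometry_orbit hdot he hA hrank eig BV dB (conj cB pB).
  have [_ _ bp bdec _] := eigB.
  exists t; split=> //.
  - split=> //; move: maj; rewrite sA.
    by have -> : s B = quad dot B \o e \o t by exact: (singular_numbersE hdot cB pB eigB).
  - by move: tr; rewrite nullE /Tr (trace_diagonal hdot he dB pB tinj eigB tsurj).
have SU : S `<=` E @` unitary_orbit dot A.
  move=> B [p _ [BV [[dB cpB] [maj tr]]]].
  have [t [tinj [bp tsurj] [van bdec] [trb majb] cnt]] := data p B BV dB cpB maj tr.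
  have [F [onF totF qF]] := basis_with_diagonal hdot hA eig oz zg gzt
    (fun k => quad_ge0 cpB.2 (e k)) van tinj bp bdec tsurj trb majb cnt.
  have [T [UT Te]] := conj_orbit F onF totF.
  exists T => //; apply: (diagonal_partE hdot he dB) => k.
  by rewrite Te qF (quadE cpB.2).
split=> // rA; split=> // US.
have [j0 zj0] : exists j, z j != 0.
  apply: contrapT => nz; apply: rA; rewrite (range_projE hdot bA pA eig).
  apply/funext => x; apply: (proj_on_id hdot (onb_onz on)) => y yg.
  apply: gzt => // k; have [->|zk] := eqVneq (z k) 0; first by rewrite dot0r.
  by exfalso; apply: nz; exists k.
(* Under the assumed equality the diagonal given by any basis belongs to the union. Membership
   itself supplies that [E T] is diagonal, compact and positive, so [data] applies to it. *)
have refute F : orthonormal_on dot setT F -> total_system dot F -> exists p t,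
    [/\ injective t, forall k, 0 < quad dot A (F k) -> exists n, t n = k,
      forall n m, (n <= m)%N -> quad dot A (F (t m)) <= quad dot A (F (t n)),
      p_majorized p (quad dot A \o F \o t) eta &
      (ecount R (fun k => z k != 0%R) - p%:R%:E <= ecount R (fun k => quad dot A (F k) == 0%R))%E].
  move=> onF totF; have [T [UT Te]] := conj_orbit F onF totF.
  have [p _ [BV [[dB cpB] [maj tr]]]] : S (E T) by apply: US; exists T.
  have bE : quad dot (E T) \o e = quad dot A \o F.
    apply/funext => k; apply: complexI.
    by rewrite /= -(quadE cpB.2) (diagonal_part_dot he) Te.
  have [t] := data p (E T) BV dB cpB maj tr; cbv zeta; rewrite bE.
  move=> [tinj [_ tsurj] [_ bdec] [_ majb] /andP[cnt _]].
  exists p, t; split=> //.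
have [inf|[n nz]] := infinite_or_bounded (fun k => z k != 0).
  have [F [onF totF Fp]] := positive_basis lA pA eig oz zg gzt inf.
  have [p [t [_ _ _ _]]] := refute F onF totF.
  rewrite (ecount_infinite R inf) (ecount_finite R (n := 0%N)) //.
  by move=> k _; rewrite gt_eqF.
have [c [F [Ec onF totF [F0 Fp] ex]]] := excess_basis hdot lA pA eig oz zg gzt nz zj0.
have [p [t [tinj tsurj tdec [_ [N NP]] cnt]]] := refute F onF totF.
(* The kernel has dimension [c.+1] while the diagonal has only [c] zeros, which rules out
   [p = 0]. *)
have p1 : (0 < p)%N.
  move: cnt; rewrite (ecount_finite R nz) Ec (ecount_finite R (n := c)); last first.
    by move=> k ck; rewrite gt_eqF// Fp.
  rewrite lee_subel_addr// -EFinD lee_fin -natrD ler_nat => le.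
  have := count_size (fun k => quad dot A (F k) == 0) (iota 0 c); rewrite size_iota; lia.
(* The [N.+1] entries from index [c] on already sum to more than the first [N] eigenvalues; the
   largest [N + p] entries sum to at least as much since [p >= 1]. *)
have := NP N (leqnn N); apply/negP; rewrite -ltNge.
apply: lt_le_trans (ex N) _.
have := sum_diagonal_le (b := quad dot A \o F) (fun k => quad_ge0 pA (F k)) tsurj tdec
  (iota_uniq c N.+1).
rewrite size_iota => le; apply: le_trans (_ : psum (quad dot A \o F \o t) N.+1 <= _).
  apply: le_trans le; rewrite /psum big_mkord -[in iota _ _](addn0 c) iotaDl big_map.
  by rewrite -/(index_iota 0 N.+1) big_mkord.
by apply: psum_homo => [k|]; [exact: quad_ge0 | lia].
Qed.
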